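(* Let $\mathfrak g$ be a nilpotent Lie algebra. Let $M,m\subset\mathbb P\mathfrak g$ be the sets of Ricci-maximal and Ricci-minimal points, respectively. Denote closures in $\mathbb P\mathfrak g$ by a bar. (a) (i) If $\mathfrak g$ is two-step nilpotent, then $\overline M=\mathbb P\mathfrak g'$, where $\mathfrak g'=[\mathfrak g,\mathfrak g]$. (ii) If $\mathfrak g$ has a codimension one abelian ideal $\mathfrak a$ and is not two-step nilpotent, then $\overline M=\mathbb P\mathfrak a$. (iii) In all the other cases, $\overline M=\mathbb P\mathfrak g$. (b) $\overline m=\mathbb P\mathfrak g$.
   Context: Lie algebras are real and finite-dimensional. A Lie algebra $\mathfrak g$ is two-step nilpotent if $[\mathfrak g,[\mathfrak g,\mathfrak g]]=0$. A positive definite inner product $\langle\cdot,\cdot\rangle$ on $\mathfrak g$ determines a left-invariant Riemannian metric on a Lie group with Lie algebra $\mathfrak g$, and $\operatorname{Ric}$ denotes its Ricci curvature as a symmetric bilinear form on $\mathfrak g$. Explicitly, for $\mathfrak g$ nilpotent and $\{e_i\}$ an orthonormal basis, $$\operatorname{Ric}(X,Y)=\tfrac14\sum_{i,j}\langle[e_i,e_j],X\rangle\langle[e_i,e_j],Y\rangle-\tfrac12\sum_i\langle[X,e_i],[Y,e_i]\rangle.$$ The Ricci operator $\operatorname{ric}\in\operatorname{End}(\mathfrak g)$ is defined by $\langle\operatorname{ric}X,Y\rangle=\operatorname{Ric}(X,Y)$ for $X,Y\in\mathfrak g$. For a linear space $L$, $\mathbb PL$ is the projective space of $L$ and $\pi:L\setminus\{0\}\to\mathbb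 PL$ is the natural projection; for a subspace $L\subset\mathfrak g$, $\mathbb PL$ is regarded as a subset of $\mathbb P\mathfrak g$. A point $u\in\mathbb P\mathfrak g$ is called Ricci-maximal (respectively, Ricci-minimal) if there exists an inner product on $\mathfrak g$ such that a vector $X\in\pi^{-1}(u)\subset\mathfrak g$ is an eigenvector of the Ricci operator for that inner product with the maximal (respectively, minimal) eigenvalue.
   Formalization: In (a)(i) the Lie algebra is additionally assumed nonabelian (g' ≠ 0): for a nonzero abelian g, which satisfies [g,[g,g]]=0, Ric vanishes for every inner product, so M is all of Pg while Pg' is empty. *)

(* Defs.v *)
From HB Require Import structures.
From mathcomp Require Import all_boot all_order all_algebra.
From mathcomp Require Import sesquilinear ring.
From mathcomp Require Import all_classical all_reals all_analysis.

Set Implicit Arguments.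
Unset Strict Implicit.
Unset Printing Implicit Defensive.

Import Order.TTheory GRing.Theory Num.Theory.
Import numFieldNormedType.Exports.
Import passmx.

Local Open Scope classical_set_scope.
Local Open Scope ring_scope.

HB.mixin Record Vector_isLieAlgebra (F : fieldType) V of Vector F V := {
  lie : V -> V -> V ;
  lie_linear_l : forall y, linear (lie^~ y) ;
  lie_linear_r : forall x, linear (lie x) ;
  lie_alt : forall x, lie x x = 0 ;
  lie_jacobi : forall x y z,
    lie x (lie y z) + lie y (lie z x) + lie z (lie x y) = 0
}.

#[short(type="lieAlgType")]
HB.structure Definition LieAlgebra (F : fieldType) :=
  {V of Vector_isLieAlgebra F V & Vector F V}.

Section LieAlgebraTheory.
Variables (F : fieldType) (g : lieAlgType F).
Implicit Types U W X a : {vspace g}.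

HB.instance Definition _ :=
  bilinear_isBilinear.Build F g g g *:%R *:%R (@lie F g)
    (@lie_linear_l F g, @lie_linear_r F g).

(* [U, W] is the linear span of all brackets; by bilinearity it is enough to
   take the brackets of basis vectors (see liev_subP). *)
Definition liev U W : {vspace g} :=
  <<[seq lie u w | u <- vbasis U, w <- vbasis W]>>%VS.

Lemma mem_liev U W u w : u \in U -> w \in W -> lie u w \in liev U W.
Proof.
move=> uU wW; rewrite (coord_vbasis uU) (coord_vbasis wW).
rewrite linear_sumlz memv_suml// => i _; rewrite linear_sumr memv_suml// => j _.
rewrite linearZl_LR linearZr !memvZ// memv_span//.
by apply/allpairsP; exists ((vbasis U)`_i, (vbasis W)`_j);
  rewrite !mem_nth ?size_tuple.
Qed.

Lemma liev_subP U W X :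
  reflect {in U & W, forall u w, lie u w \in X} (liev U W <= X)%VS.
Proof.
apply: (iffP idP) => [sX u w uU wW|h].
  exact: subvP sX _ (mem_liev uU wW).
apply/span_subvP => _ /allpairsP[[u w] /= [/vbasis_mem uU /vbasis_mem wW ->]].
exact: h.
Qed.

Definition derived_lie : {vspace g} := liev fullv fullv.

Definition lie_nilpotent : Prop := exists k, iter k (liev fullv) fullv = 0%VS.

(* Abelian Lie algebras are included. *)
Definition two_step_nilpotent : Prop := liev fullv derived_lie = 0%VS.

Definition codim1_abelian_ideal a : Prop :=
  [/\ (liev fullv a <= a)%VS, liev a a = 0%VS
    & \dim {: g} = (\dim a).+1].

End LieAlgebraTheory.

Arguments derived_lie {F} g.
Arguments lie_nilpotent {F} g.
Arguments two_step_nilpotent {F} g.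

Section ProjectiveSpace.
Variables (R : realType) (V : vectType R).

Record projective := Projective {
  pline :> {vspace V} ;
  _ : \dim pline == 1%N
}.

HB.instance Definition _ := [isSub for pline].
HB.instance Definition _ := [Choice of projective by <:].

Lemma dim_line_eq1 (v : V) : v != 0 -> \dim <[v]> == 1%N.
Proof. by move=> v0; rewrite dim_vline v0. Qed.

Definition proj_pi (v : V) (v0 : v != 0) : projective :=
  Projective (dim_line_eq1 v0).

Definition proj_sub (L : {vspace V}) : set projective :=
  [set u | (pline u <= L)%VS].

(* Quotient topology along proj_pi, where V carries its usual topology,
   i.e. that of 'rV[R]_(\dim V) transported along coordinates in a basis. *)
Definition proj_open (A : set projective) : Prop :=
  open [set x : 'rV[R]_(\dim {: V}) |
    exists v0 : vecof (vbasis {: V}) x != 0, A (proj_pi v0)].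

Lemma proj_openT : proj_open setT.
Proof.
rewrite /proj_open.
suff -> : [set x : 'rV[R]_(\dim {: V}) |
    exists v0 : vecof (vbasis {: V}) x != 0, setT (proj_pi v0)] = ~` [set 0].
  by apply: closed_openC; apply/accessible_closed_set1/hausdorff_accessible;
     exact: norm_hausdorff.
apply/seteqP; split=> x /=.
  by move=> [+ _]; rewrite vecof_eq0 ?vbasisP// => /eqP.
by move=> /eqP x0; unshelve eexists => //; rewrite vecof_eq0 ?vbasisP.
Qed.

Lemma proj_openI : setI_closed proj_open.
Proof.
move=> A B oA oB; rewrite /proj_open.
suff -> : [set x : 'rV[R]_(\dim {: V}) | exists v0 : vecof (vbasis {: V}) x != 0,
     (A `&` B) (proj_pi v0)] =
   [set x | exists v0 : vecof (vbasis {: V}) x != 0, A (proj_pi v0)] `&`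
   [set x | exists v0 : vecof (vbasis {: V}) x != 0, B (proj_pi v0)].
  exact: openI.
apply/seteqP; split=> x /= [].
  by move=> v0 [Av Bv]; split; exists v0.
move=> [v0 Av] [v1 Bv]; exists v0; split=> //.
by rewrite (bool_irrelevance v0 v1).
Qed.

Lemma proj_open_bigU (I : Type) (f : I -> set projective) :
  (forall i, proj_open (f i)) -> proj_open (\bigcup_i f i).
Proof.
move=> of_; rewrite /proj_open.
suff -> : [set x : 'rV[R]_(\dim {: V}) | exists v0 : vecof (vbasis {: V}) x != 0,
     (\bigcup_i f i) (proj_pi v0)] = \bigcup_i
   [set x | exists v0 : vecof (vbasis {: V}) x != 0, f i (proj_pi v0)].
  by apply: bigcup_open => i _; exact: of_.
apply/seteqP; split=> x /=.
  by move=> [v0 [i _ fi]]; exists i => //; exists v0.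
by move=> [i _ [v0 fi]]; exists v0; exists i.
Qed.

HB.instance Definition _ :=
  isOpenTopological.Build projective proj_openT proj_openI proj_open_bigU.

End ProjectiveSpace.

Section OrthonormalBasis.
Variables (R : realType) (V : vectType R) (dot : {dot V for (@idfun R)}).

Definition orthonormal_basis (e : seq V) : bool :=
  basis_of fullv e && orthonormal dot e.

Lemma scalar_sum (f : V -> R) (a : V -> R) (e : seq V) : scalar f ->
  f (\sum_(u <- e) a u *: u) = \sum_(u <- e) a u * f u.
Proof.
move=> lf; elim: e => [|u e IH].
  by have := lf (-1) 0 0; rewrite !big_nil scaler0 addr0 mulN1r addNr.
by rewrite !big_cons lf IH.
Qed.

Lemma dot_linearl y : scalar (dot^~ y).
Proof. by move=> a u v; rewrite linearPl. Qed.

Lemma dot_linearr x : scalar (dot x).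
Proof. by move=> a u v; rewrite linearPr. Qed.

Lemma dotZl a x y : dot (a *: x) y = a * dot x y.
Proof. exact: linearZl_LR. Qed.

Lemma dotC x y : dot x y = dot y x.
Proof. by rewrite hermC expr0 mul1r. Qed.

Lemma orthonormal_cons u (s : seq V) : orthonormal dot (u :: s) =
  [&& dot u u == 1, all [pred v | dot u v == 0] s & orthonormal dot s].
Proof. by rewrite /orthonormal/= andbT -!andbA; congr (_ && _); rewrite andbCA. Qed.

Lemma orthonormal_expand e x : orthonormal dot e -> x \in <<e>>%VS ->
  x = \sum_(u <- e) dot x u *: u.
Proof.
elim: e x => [|u e IH] x; first by rewrite span_nil memv0 big_nil => _ /eqP.
rewrite orthonormal_cons span_cons => /and3P[/eqP uu /allP ue oe].
have ue' w : w \in <<e>>%VS -> dot u w = 0.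
  move=> we; rewrite (IH _ oe we) (scalar_sum _ _ (dot_linearr u)) big_seq big1// => v /ue /eqP ->.
  by rewrite mulr0.
move=> /memv_addP[_ /vlineP[c ->] [y ye ->]]; rewrite big_cons.
have -> : dot (c *: u + y) u = c by rewrite dot_linearl uu (dotC y) ue'// addr0 mulr1.
congr (_ + _); rewrite {1}(IH _ oe ye) big_seq [RHS]big_seq.
by apply: eq_bigr => v ve; rewrite dot_linearl ue' ?mulr0 ?add0r// memv_span.
Qed.

Lemma onb_exists : exists e, orthonormal_basis e.
Proof.
suff /(_ (\dim {: V}) (leqnn _)) [e [se ee oe]] : forall n,
    (n <= \dim {: V})%N ->
    exists e : seq V, [/\ size e = n, free e & orthonormal dot e].
  by exists e; rewrite /orthonormal_basis oe basisEfree ee subvf se leqnn.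
elim=> [_|n IH ltn]; first by exists [::]; rewrite nil_free.
have [e [se fe oe]] := IH (ltnW ltn).
have [v ve] : exists v, v \notin <<e>>%VS.
  apply/not_existsP => h; have : (fullv <= <<e>>)%VS.
    by apply/subvP => v _; have /negP := h v; rewrite negbK.
  move=> /dimvS /leq_trans/(_ (dim_span e)); rewrite se => /(leq_trans ltn).
  by rewrite ltnn.
pose p := \sum_(u <- e) dot v u *: u.
have pe : p \in <<e>>%VS.
  by rewrite /p big_seq memv_suml// => u ue; rewrite memvZ// memv_span.
pose w := v - p.
have wNe : w \notin <<e>>%VS by apply: contra ve => we; rewrite -(subrK p v) memvD.
have w0 : w != 0 by apply: contra wNe => /eqP ->; rewrite mem0v.
have we u : u \in e -> dot w u = 0.
  move=> ue; have ue' := memv_span ue.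
  rewrite linearBl/= /p (scalar_sum _ _ (dot_linearl u)).
  rewrite {1}(orthonormal_expand oe ue') (scalar_sum _ _ (dot_linearr v)).
  by apply/eqP; rewrite subr_eq0; apply/eqP; apply: eq_bigr => t _;
    rewrite mulrC (dotC u).
have dw : 0 < dot w w by exact: neq0_dnorm_gt0.
have r0 : Num.sqrt (dot w w) != 0 by rewrite gt_eqF// sqrtr_gt0.
pose z := (Num.sqrt (dot w w))^-1 *: w.
exists (z :: e); split; first by rewrite /= se.
  rewrite free_cons fe andbT; apply: contra wNe => ze.
  by rewrite -[w]scale1r -(divff r0) -scalerA memvZ.
rewrite orthonormal_cons oe andbT; apply/andP; split; last first.
  by apply/allP => u ue; apply/eqP; rewrite dotZl (we u ue) mulr0.
rewrite dotZl (dotC w) dotZl -[X in _ * (_ * X)]sqr_sqrtr ?ltW//.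
by rewrite expr2 mulKf// mulVf.
Qed.

(* An orthonormal basis chosen by xget; traces do not depend on the choice. *)
Definition onb : seq V := xget [::] [set e | orthonormal_basis e].

Lemma onbP : orthonormal_basis onb.
Proof. by have [e oe] := onb_exists; apply: (@xgetPex _ [::] [set e | orthonormal_basis e]); exists e. Qed.

Lemma onb_expand e x : orthonormal_basis e -> x = \sum_(u <- e) dot x u *: u.
Proof.
by move=> /andP[be oe]; apply: orthonormal_expand; rewrite // (span_basis be) memvf.
Qed.

Lemma trace_onb (B : V -> V -> R) (e f : seq V) :
    (forall v, scalar (B^~ v)) -> (forall u, scalar (B u)) ->
    orthonormal_basis e -> orthonormal_basis f ->
  \sum_(u <- e) B u u = \sum_(u <- f) B u u.
Proof.
move=> Bl Br oe of_.
under eq_bigr => u _ do rewrite {2}(onb_expand u of_) (scalar_sum _ _ (Br u)).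
rewrite exchange_big/=; apply: eq_bigr => v _.
rewrite (_ : B _ _ = \sum_(u <- e) dot v u * B u v); last first.
  by rewrite {1}(onb_expand v oe) (scalar_sum _ _ (Bl v)).
by apply: eq_bigr => u _; rewrite dotC.
Qed.

End OrthonormalBasis.

Section Ricci.
Variables (R : realType) (g : lieAlgType R) (dot : {dot g for (@idfun R)}).

(* Ricci curvature of the left-invariant metric dot in an orthonormal basis e,
   for g nilpotent: the Killing form and mean curvature terms of the general
   formula vanish. *)
Definition ricci_in (e : seq g) (x y : g) : R :=
  4^-1 * (\sum_(u <- e) \sum_(v <- e) dot (lie u v) x * dot (lie u v) y)
  - 2^-1 * \sum_(u <- e) dot (lie x u) (lie y u).

Definition ricci_form : g -> g -> R := ricci_in (onb dot).

Lemma ricci_formE e x y : orthonormal_basis dot e ->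
  ricci_form x y = ricci_in e x y.
Proof.
move=> oe; have of_ := onbP dot; rewrite /ricci_form /ricci_in.
set f := onb dot in of_ *; congr (_ * _ - _ * _); last first.
  apply: (@trace_onb _ _ dot (fun u v => dot (lie x u) (lie y v))) => // [v|u] a s t.
    by rewrite linearPr linearPl.
  by rewrite linearPr linearPr.
transitivity (\sum_(u <- f) \sum_(v <- e) dot (lie u v) x * dot (lie u v) y).
  apply: eq_bigr => u _.
  apply: (@trace_onb _ _ dot (fun v w => dot (lie u v) x * dot (lie u w) y)) => // [v|w] a s t /=.
    by rewrite linearPr linearPl mulrDl mulrA.
  by rewrite linearPr linearPl mulrDr mulrCA.
rewrite exchange_big [RHS]exchange_big/=; apply: eq_bigr => v _.
apply: (@trace_onb _ _ dot (fun u w => dot (lie u v) x * dot (lie w v) y)) => // [u|w] a s t /=.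
  by rewrite linearPl linearPl mulrDl mulrA.
by rewrite linearPl linearPl mulrDr mulrCA.
Qed.

Lemma ricci_form_linearl y : scalar (ricci_form^~ y).
Proof.
move=> a s t; rewrite /ricci_form /ricci_in.
under eq_bigr => u _.
  under eq_bigr => v _ do rewrite linearPr/= mulrDl -mulrA.
  rewrite big_split/= -mulr_sumr; over.
rewrite big_split/= -mulr_sumr.
under [X in _ - _ * X]eq_bigr => u _ do rewrite linearPl linearPl/=.
by rewrite big_split/= -mulr_sumr; ring.
Qed.

Definition ricci_fun (x : g) : g := \sum_(u <- onb dot) ricci_form x u *: u.

Lemma ricci_fun_linear : linear ricci_fun.
Proof.
move=> a s t; rewrite /ricci_fun scaler_sumr -big_split/=.
by apply: eq_bigr => u _; rewrite ricci_form_linearl scalerDl scalerA.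
Qed.

HB.instance Definition _ := GRing.isLinear.Build R g g *:%R ricci_fun
  ricci_fun_linear.

Definition ricci_op : 'End(g) := linfun ricci_fun.

Lemma ricci_formC x y : ricci_form x y = ricci_form y x.
Proof.
rewrite /ricci_form /ricci_in; congr (_ * _ - _ * _).
  by apply: eq_bigr => u _; apply: eq_bigr => v _; rewrite mulrC.
by apply: eq_bigr => u _; rewrite hermC expr0 mul1r.
Qed.

Lemma ricci_opP x y : dot (ricci_op x) y = ricci_form x y.
Proof.
rewrite lfunE/= /ricci_fun (scalar_sum _ _ (dot_linearl dot y)).
rewrite ricci_formC [in RHS](onb_expand y (onbP dot)).
rewrite (scalar_sum _ _ (ricci_form_linearl x)).
by apply: eq_bigr => u _; rewrite mulrC ricci_formC dotC.
Qed.

End Ricci.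

Definition ricci_maximal (R : realType) (g : lieAlgType R) : set (projective g) :=
  [set u | exists (dot : {dot g for (@idfun R)}) (x : g) (x0 : x != 0) (l : R),
    [/\ proj_pi x0 = u, x \in leigenspace (ricci_op dot) l
      & forall m, leigenvalue (ricci_op dot) m -> m <= l]].

Definition ricci_minimal (R : realType) (g : lieAlgType R) : set (projective g) :=
  [set u | exists (dot : {dot g for (@idfun R)}) (x : g) (x0 : x != 0) (l : R),
    [/\ proj_pi x0 = u, x \in leigenspace (ricci_op dot) l
      & forall m, leigenvalue (ricci_op dot) m -> l <= m]].

Arguments ricci_maximal {R} g.
Arguments ricci_minimal {R} g.

(* Main.v *)
(* Giving the vectors of an adapted basis the lengths t^(-d_i) produces inner
   products whose Ricci operators converge, as t tends to 0, to an explicit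
   operator L.  Extremal eigenvectors subconverge to eigenvectors of L, so X lies
   over the closure of the extremal points as soon as <X> contains every
   eigenvector of L whose eigenvalue is beyond some fixed diagonal entry of L.

   Maximal points: concentrating L on one bracket [u,v] shows that a point X
   outside the closure satisfies [u,[X,u]] = a(u) [X,[X,u]] for all u, with a
   linear in u.  Since X may be moved in an open set, more relations follow, and
   the kernel of a turns out to be a codimension one abelian ideal unless g is
   two-step nilpotent.  When g is two-step nilpotent, or has such an ideal, the
   formula for Ric keeps maximal eigenvectors in g', respectively in the ideal.

   Minimal points: one degeneration works for every X with [X,A], [X,B]
   independent for some A, B; such X are dense if there is one.  If there is none,
   then dim g' <= 1, and every noncentral X is minimal for an explicit metric. *)

Require Import Defs.
From HB Require Import structures.
From mathcomp Require Import all_boot all_order all_algebra.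
From mathcomp Require Import sesquilinear ring lra zify.
From mathcomp Require Import all_classical all_reals all_analysis.

Set Implicit Arguments.
Unset Strict Implicit.
Unset Printing Implicit Defensive.

Import Order.TTheory GRing.Theory Num.Theory.
Import numFieldNormedType.Exports.
Import passmx.

Local Open Scope classical_set_scope.
Local Open Scope ring_scope.

(** * Limits of extremal points *)

(** The eigenvalue bound survives the limit because a diagonal entry of the Ricci operator in the
    adapted basis is a Rayleigh quotient: it is below the largest eigenvalue for every t, and it
    converges with the operator. If Z = [u,v] is the only surviving bracket, read through a form th
    with th(u) = th(v) = 0 and th(Z) = 1, then L has 1/2 as its only positive eigenvalue, with
    eigenvector Z + th([Z,u])/2 v - th([Z,v])/2 u. Letting th blow up on [Z,u] turns this direction
    into v, unless [u,Z] or Z satisfies a linear dependence; nilpotency turns that dependence into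
    the relation of the overview. The relations make ker a an ideal on which triple brackets vanish.
    That it is abelian needs a second degeneration, with two surviving brackets of unequal size: a
    noncommuting pair in ker a would put X itself into the closure. For minimal points, an
    eigenvalue of L below the threshold is the equality case of Cauchy-Schwarz, which would force ad
    X to have rank one modulo X. *)

Section Compactness.
Variable R : realType.

Lemma continuous_bigsum (T : topologicalType) (I : Type) (r : seq I)
    (f : I -> T -> R) :
  (forall i, continuous (f i)) -> continuous (fun x => \sum_(i <- r) f i x).
Proof.
move=> cf; elim: r => [|i r IH].
  have -> : (fun x => \sum_(i <- [::]) f i x) = cst 0.
    by apply/funext => x; rewrite big_nil.
  exact: cst_continuous.
have -> : (fun x => \sum_(j <- i :: r) f j x) =
    f i \+ (fun x => \sum_(j <- r) f j x).
  by apply/funext => x; rewrite big_cons.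
by move=> x; apply: continuousD; [exact: cf|exact: IH].
Qed.

Lemma continuous_mul (T : topologicalType) (f g : T -> R) :
  continuous f -> continuous g -> continuous (fun x => f x * g x).
Proof. by move=> cf cg x; apply: continuousM; [exact: cf|exact: cg]. Qed.

Lemma continuous_add (T : topologicalType) (f g : T -> R) :
  continuous f -> continuous g -> continuous (fun x => f x + g x).
Proof. by move=> cf cg x; apply: continuousD; [exact: cf|exact: cg]. Qed.

Lemma continuous_sub (T : topologicalType) (f g : T -> R) :
  continuous f -> continuous g -> continuous (fun x => f x - g x).
Proof. by move=> cf cg x; apply: continuousB; [exact: cf|exact: cg]. Qed.

Lemma continuous_pow (T : topologicalType) (f : T -> R) k :
  continuous f -> continuous (fun x => f x ^+ k).
Proof.
move=> cf; elim: k => [|k IH]; first exact: cst_continuous.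
have -> : (fun x => f x ^+ k.+1) = (fun x => f x * f x ^+ k).
  by apply/funext => x; rewrite exprS.
exact: continuous_mul.
Qed.

Lemma closed_eq0 (T : topologicalType) (f : T -> R) :
  continuous f -> closed [set x | f x = 0].
Proof.
move=> cf; rewrite (_ : [set x | _] = f @^-1` [set 0])//.
by apply: closed_comp => [x _|]; [exact: cf|exact: closed_eq].
Qed.

Definition sphere n : set 'rV[R]_n := [set x | \sum_i x 0 i ^+ 2 = 1].
Arguments sphere : clear implicits.

Lemma continuous_coord n i : continuous (fun x : 'rV[R]_n => x 0 i).
Proof. exact: coord_continuous. Qed.

Lemma compact_sphere n : compact (sphere n).
Proof.
apply: (@subclosed_compact _ _ [set x : 'rV[R]_n | forall i, `[-1, 1]%classic (x 0 i)]).
- rewrite (_ : sphere n = [set x | \sum_i x 0 i ^+ 2 - 1 = 0]).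
    apply: closed_eq0; apply: continuous_sub; last exact: cst_continuous.
    by apply: continuous_bigsum => i; apply: continuous_pow; exact: continuous_coord.
  by apply/seteqP; split=> x /=; rewrite /sphere/= => /eqP; rewrite ?subr_eq0 => /eqP //; move=> ->; rewrite subrr.
- by apply: (@rV_compact R n (fun=> `[-1, 1]%classic)) => i; exact: segment_compact.
- move=> x Sx i /=; rewrite in_itv/= -ler_norml -(@ler_pXn2r _ 2) ?nnegrE// expr1n real_normK ?num_real//.
  by rewrite -Sx (bigD1 i)//= lerDl sumr_ge0// => j _; exact: sqr_ge0.
Qed.

Lemma sphere_scale n (x : 'rV[R]_n) : x != 0 ->
  exists2 c : R, c != 0 & sphere n (c *: x).
Proof.
move=> x0; have /rV0Pn[i xi] := x0.
have s0 : 0 < \sum_i x 0 i ^+ 2.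
  rewrite (bigD1 i)//= ltr_wpDr//; first by rewrite sumr_ge0// => j _; exact: sqr_ge0.
  by rewrite exprn_even_gt0.
exists (Num.sqrt (\sum_i x 0 i ^+ 2))^-1; first by rewrite invr_neq0// gt_eqF// sqrtr_gt0.
rewrite /sphere/=; under eq_bigr => j _ do rewrite mxE exprMn.
by rewrite -mulr_sumr exprVn sqr_sqrtr ?ltW// mulVf// gt_eqF.
Qed.

Lemma sphere_neq0 n (x : 'rV[R]_n) : sphere n x -> x != 0.
Proof.
rewrite /sphere/= => Sx; apply/eqP => x0; move: Sx; rewrite x0 big1 => [/eqP|i _].
  by rewrite eq_sym oner_eq0.
by rewrite mxE expr0n.
Qed.

Variable V : vectType R.

Lemma scalar_fun0 (F : V -> R) : scalar F -> F 0 = 0.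
Proof. by move=> Fl; have := Fl (-1) 0 0; rewrite scaler0 addr0 mulN1r addNr. Qed.

Lemma scalar_funZ (F : V -> R) a v : scalar F -> F (a *: v) = a * F v.
Proof. by move=> Fl; have := Fl a v 0; rewrite addr0 (scalar_fun0 Fl) addr0. Qed.

Lemma orthonormal_nthP (dot : {dot V for (@idfun R)}) (e : seq V) :
  orthonormal dot e <-> forall i j, (i < size e)%N -> (j < size e)%N ->
    dot e`_i e`_j = (i == j)%:R.
Proof.
elim: e => [|u e IH]; first by split.
rewrite orthonormal_cons; split=> [/and3P[/eqP uu /allP ue /IH oe] [|i] [|j]//= li lj|h].
- by have /eqP := ue _ (mem_nth 0 lj).
- by rewrite dotC; have /eqP := ue _ (mem_nth 0 li).
- exact: oe.
- apply/and3P; split; first by have /= -> := h 0%N 0%N isT isT.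
    by apply/allP => _ /(nthP 0)[i li <-]; have /= -> := h 0%N i.+1 isT li.
  by apply/IH => i j li lj; have := h i.+1 j.+1 li lj.
Qed.

(** The Rayleigh quotient attains its maximum on the compact unit sphere of orthonormal coordinates,
    and a maximiser is an eigenvector. The vector [f] guarantees that the sphere is nonempty. *)
Lemma max_eigen (dot : {dot V for (@idfun R)}) (B : V -> V -> R) (f : V) :
  f != 0 -> (forall v, scalar (B^~ v)) -> (forall u, scalar (B u)) ->
  (forall u v, B u v = B v u) ->
  exists x l, [/\ x != 0, forall y, B x y = l * dot x y
                 & forall v, B v v <= l * dot v v].
Proof.
move=> f0 Bl Br Bs; have [e oe] := onb_exists dot.
pose n := size e; pose vec (x : 'rV[R]_n) : V := \sum_(i < n) x 0 i *: e`_i.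
have vecS v : v = vec (\row_i dot v e`_i).
  rewrite /vec {1}(onb_expand v oe) (big_nth 0) big_mkord.
  by apply: eq_bigr => i _; rewrite mxE.
have ev (F : V -> R) (x : 'rV[R]_n) : scalar F -> F (vec x) = \sum_(i < n) x 0 i * F e`_i.
  move=> Fl; rewrite /vec; elim/big_rec2: _ => [|i y z _ <-]; [exact: scalar_fun0|exact: Fl].
have oij (i j : 'I_n) : dot e`_i e`_j = (i == j)%:R.
  by case/andP: oe => _ /orthonormal_nthP -> //; exact: ltn_ord.
have dv x : dot (vec x) (vec x) = \sum_i x 0 i ^+ 2.
  rewrite (ev (dot^~ (vec x))) ?dot_linearl//; last exact: dot_linearl.
  apply: eq_bigr => i _; rewrite (ev (dot e`_i)); last exact: dot_linearr.
  by rewrite (bigD1 i)//= big1 ?oij ?eqxx ?mulr1 ?addr0 ?expr2// => j /negbTE ji;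
     rewrite oij eq_sym ji mulr0.
pose g x := B (vec x) (vec x).
have cg : continuous g.
  have -> : g = fun x => \sum_i x 0 i * \sum_j x 0 j * B e`_i e`_j.
    apply/funext => x; rewrite /g (ev (B^~ _))//; apply: eq_bigr => i _.
    by rewrite (ev (B _)).
  apply: continuous_bigsum => i; apply: continuous_mul; first exact: continuous_coord.
  apply: continuous_bigsum => j; apply: continuous_mul; first exact: continuous_coord.
  exact: cst_continuous.
have [c c0 Sc] : exists2 c : R, c != 0 & sphere n (c *: \row_i dot f e`_i).
  apply: sphere_scale; apply: contra f0 => /eqP r0.
  by rewrite (vecS f) r0 /vec big1// => i _; rewrite mxE scale0r.
have [x /set_mem Sx mx] := compact_EVT_max (ex_intro _ _ Sc) (@compact_sphere n)
  (continuous_subspaceT cg).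
have dx : dot (vec x) (vec x) = 1 by rewrite dv.
have ray v : B v v <= g x * dot v v.
  have [->|v0] := eqVneq v 0.
    by rewrite (scalar_fun0 (Bl 0)) (scalar_fun0 (dot_linearl dot 0)) mulr0.
  have [k k0 Sk] : exists2 k : R, k != 0 & sphere n (k *: \row_i dot v e`_i).
    apply: sphere_scale; apply: contra v0 => /eqP r0.
    by rewrite (vecS v) r0 /vec big1// => i _; rewrite mxE scale0r.
  have vk : vec (k *: \row_i dot v e`_i) = k *: v.
    by rewrite [in RHS](vecS v) /vec scaler_sumr; apply: eq_bigr => i _; rewrite mxE scalerA.
  have BZ : B (k *: v) (k *: v) = k ^+ 2 * B v v.
    by rewrite (scalar_funZ _ _ (Bl _)) (scalar_funZ _ _ (Br _)) mulrA -expr2.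
  have := mx _ (mem_set Sk); rewrite /g vk BZ.
  have : k ^+ 2 * dot v v = 1 by rewrite -Sk -dv vk dotZl dotC dotZl; ring.
  move=> h1 h2.
  have k2 : 0 < k ^+ 2 by rewrite exprn_even_gt0.
  by rewrite -(ler_pM2l k2) (le_trans h2)// mulrCA h1 mulr1.
exists (vec x), (g x); split=> //.
  by apply/eqP => v0; move: dx; rewrite v0 (scalar_fun0 (dot_linearl dot 0)) => /eqP; rewrite eq_sym oner_eq0.
(* The form [l dot - B] is positive semidefinite and vanishes at the maximiser. *)
move=> y; pose D v := g x * dot v v - B v v.
pose b := g x * dot (vec x) y - B (vec x) y.
have Dt t : D (t *: y + vec x) = t ^+ 2 * D y + 2 * t * b.
  rewrite /D /b (Bl _ t) (Br y t) (Br (vec x) t) (Bs y (vec x)).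
  rewrite dot_linearl !dot_linearr (dotC dot y (vec x)) dx.
  by rewrite -[B (vec x) (vec x)]/(g x); ring.
have D0 t : 0 <= t ^+ 2 * D y + 2 * t * b by rewrite -Dt subr_ge0 ray.
have Dy : 0 <= D y by rewrite subr_ge0 ray.
suff b0 : b = 0 by apply/esym/eqP; rewrite -subr_eq0; apply/eqP.
apply/eqP; rewrite -sqrf_eq0 -[_ == _]negbK; apply/negP => bn0.
have b2 : 0 < b ^+ 2 by rewrite lt_def bn0 sqr_ge0.
(* The denominator [1 + D y] is positive even if [D y = 0], and at this parameter the quadratic is
   negative unless [b = 0]. *)
have := D0 (- b / (1 + D y)).
have D1 : 1 + D y != 0 by rewrite gt_eqF// ltr_wpDr.
have -> : (- b / (1 + D y)) ^+ 2 * D y + 2 * (- b / (1 + D y)) * b =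
  - (b ^+ 2 * (2 + D y)) / (1 + D y) ^+ 2 by field.
rewrite leNgt => /negP; apply; rewrite mulNr oppr_lt0; apply: divr_gt0.
  by apply: mulr_gt0 => //; rewrite ltr_wpDr.
by rewrite exprn_even_gt0.
Qed.

End Compactness.
Arguments sphere {R} n.

(** * Closure in projective space, tested on vectors and along curves *)

Section ProjectiveClosure.
Variables (R : realType) (V : vectType R).
Implicit Types (Q : set (projective V)) (x y : V).
Local Notation n := (\dim {: V}).
Local Notation e := (vbasis {: V}).

Let be : basis_of {: V} e. Proof. exact: vbasisP. Qed.

(** Vacuous at the zero vector, so a point given by a linear formula need not be shown nonzero
    first. *)
Definition in_cl Q x : Prop := forall x0 : x != 0, closure Q (proj_pi x0).

Lemma proj_pi_eq x y (x0 : x != 0) (y0 : y != 0) :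
  x \in <[y]>%VS -> proj_pi x0 = proj_pi y0.
Proof.
move=> xy; apply: val_inj => /=; apply/eqP.
by rewrite eqEdim -memvE xy !dim_vline x0 y0.
Qed.

Lemma in_clZ Q c x : in_cl Q x -> in_cl Q (c *: x).
Proof.
move=> Qx cx0; have x0 : x != 0 by apply: contraNneq cx0 => ->; rewrite scaler0.
by rewrite (proj_pi_eq cx0 x0) ?memvZ ?memv_line.
Qed.

Lemma in_clZ' Q c x : c != 0 -> in_cl Q (c *: x) -> in_cl Q x.
Proof. by move=> c0 h; have := @in_clZ _ c^-1 _ h; rewrite scalerA mulVf// scale1r. Qed.

(** Open sets of the projective space are by definition open cones in coordinates; [U] is the cone
    over the complement of the closure. *)
Lemma not_in_cl_open Q x : ~ in_cl Q x ->
  exists U : set 'rV[R]_n, [/\ open U, U (rVof e x),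
    forall c z, c != 0 -> U z -> U (c *: z) &
    forall y, U (rVof e y) -> ~ in_cl Q y].
Proof.
move=> /existsNP[x0 Qx].
exists [set z | exists v0 : vecof e z != 0, (~` closure Q) (proj_pi v0)]; split.
- have : Defs.proj_open (~` closure Q) by exact: (closed_openC (@closed_closure _ Q)).
  by [].
- have r0 : vecof e (rVof e x) != 0 by rewrite rVofK.
  exists r0 => /= h; apply: Qx; rewrite (@proj_pi_eq _ _ _ r0)//.
  by rewrite rVofK// memv_line.
- move=> c z c0 [z0 Qz]; have cz0 : vecof e (c *: z) != 0.
    by rewrite linearZ/= scaler_eq0 negb_or c0.
  exists cz0; rewrite (proj_pi_eq cz0 z0)//.
  by rewrite linearZ/= memvZ// memv_line.
- move=> y [y0 Qy] cy; apply: Qy; have y0' : y != 0 by move: y0; rewrite rVofK.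
  by rewrite (@proj_pi_eq _ _ y0 y0') ?rVofK ?memv_line//; exact: cy.
Qed.

Lemma continuous_row (T : topologicalType) (f : T -> 'rV[R]_n) :
  (forall j, continuous (fun s => f s 0 j)) -> continuous f.
Proof.
move=> cf s A [P Ps PA].
have : nbhs s [set t | forall j, P 0 j (f t 0 j)].
  by apply: filter_forall => j; exact: (cf j s _ (Ps 0 j)).
by apply: filterS => t Pt; apply: PA => i j; rewrite (ord1 i); exact: Pt.
Qed.

(** Openness of the complement along a continuous curve. The quadratic term serves the path of
    [limit_family_maximal]; elsewhere [z = 0]. *)
Lemma not_in_cl_near Q (x y z : V) : ~ in_cl Q x ->
  exists2 d : R, 0 < d &
    forall s, `|s| < d -> ~ in_cl Q (x + s *: y + s ^+ 2 *: z).
Proof.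
move=> Qx; pose f s := x + s *: y + s ^+ 2 *: z.
have /not_in_cl_open[U [oU U0 _ UQ]] : ~ in_cl Q (f 0).
  by rewrite /f expr0n /= !scale0r !addr0.
have cr : continuous (fun s => rVof e (f s)).
  apply: continuous_row => j.
  have -> : (fun s : R => rVof e (f s) 0 j) =
      (fun s => rVof e x 0 j + s * rVof e y 0 j + s ^+ 2 * rVof e z 0 j).
    by apply/funext => s; rewrite /f !linearD/= !linearZ/= !mxE.
  apply: continuous_add; first apply: continuous_add.
  - exact: cst_continuous.
  - by apply: (@continuous_mul _ _ id); [by move=> ?; exact: cvg_id|exact: cst_continuous].
  - apply: continuous_mul; last exact: cst_continuous.
    by apply: continuous_pow; by move=> ?; exact: cvg_id.
have /nbhs_ballP[d d0 dU] : nbhs (0 : R) ((fun s => rVof e (f s)) @^-1` U).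
  by apply: cr; exact: open_nbhs_nbhs.
exists d => // s sd; apply: UQ; apply: dU.
by rewrite -ball_normE /= sub0r normrN.
Qed.

Lemma in_cl_path Q (x y z : V) (d : R) : 0 < d ->
  (forall s, 0 < s < d -> in_cl Q (x + s *: y + s ^+ 2 *: z)) -> in_cl Q x.
Proof.
move=> d0 h; apply: contrapT => /(@not_in_cl_near Q x y z)[c c0 hc].
have m0 : 0 < Num.min c d / 2 by rewrite divr_gt0// lt_min c0 d0.
have m2 : Num.min c d / 2 < Num.min c d.
  by rewrite ltr_pdivrMr// ltr_pMr ?ltr1n// lt_min c0 d0.
apply: (hc (Num.min c d / 2)).
  by rewrite gtr0_norm// (lt_le_trans m2)// ge_min lexx.
by apply: h; rewrite m0/= (lt_le_trans m2)// ge_min lexx orbT.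
Qed.

Section EigenLimit.
Variables (S : finType) (k : S -> nat) (M : S -> 'End(V)).

Definition polyend (t : R) : 'End(V) := \sum_s (t ^+ k s) *: M s.

Lemma polyendE t x : polyend t x = \sum_s t ^+ k s *: M s x.
Proof. by rewrite sum_lfunE; apply: eq_bigr => s _; rewrite scale_lfunE. Qed.

(** Suppose [X] is off the closure, with open cone [U] around it. The pairs of [t] in [[0, 1]] and a
    unit eigenvector of [polyend t] outside [U] with eigenvalue at or above the threshold form a
    compact set. Its projection to [t] is closed and contains all of []0, 1]], hence [0]; the
    eigenvector found there is a multiple of [X] outside [U], which is absurd. *)
Lemma eigen_limit (chi : V -> R) (f X : V) Q : scalar chi ->
  (forall t, 0 < t <= 1 -> exists x (x0 : x != 0) l,
    [/\ polyend t x = l *: x, chi (polyend t f) <= l & Q (proj_pi x0)]) ->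
  (forall x l, x != 0 -> polyend 0 x = l *: x -> chi (polyend 0 f) <= l ->
    x \in <[X]>%VS) ->
  in_cl Q X.
Proof.
move=> chil hQ h0; apply: contrapT => /not_in_cl_open[U [oU UX UZ UQ]].
pose F (p : R * 'rV[R]_n) j : R :=
  \sum_s p.1 ^+ k s * \sum_i p.2 0 i * mxof e e (M s) i j.
have FE t (x : 'rV[R]_n) j : F (t, x) j = rVof e (polyend t (vecof e x)) 0 j.
  rewrite polyendE linear_sum summxE /F; apply: eq_bigr => s _.
  rewrite linearZ/= mxE -mul_mxof mxE; congr (_ * _).
pose l (p : R * 'rV[R]_n) := \sum_j p.2 0 j * F p j.
pose G (p : R * 'rV[R]_n) := \sum_j (F p j - l p * p.2 0 j) ^+ 2.
have c1 : continuous (fst : R * 'rV[R]_n -> R) by move=> p; exact: cvg_fst.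
have c2 i : continuous (fun p : R * 'rV[R]_n => p.2 0 i).
  move=> p; apply: (@continuous_comp _ _ _ snd (fun x : 'rV[R]_n => x 0 i)).
    exact: cvg_snd.
  exact: continuous_coord.
have cF j : continuous (F^~ j).
  apply: continuous_bigsum => s; apply: continuous_mul; first exact: continuous_pow.
  by apply: continuous_bigsum => i; apply: continuous_mul => //; exact: cst_continuous.
have cl : continuous l.
  by apply: continuous_bigsum => j; apply: continuous_mul.
have cG : continuous G.
  apply: continuous_bigsum => j; apply: continuous_pow.
  by apply: continuous_sub => //; exact: continuous_mul.
pose H (p : R * 'rV[R]_n) := \sum_s p.1 ^+ k s * chi (M s f) - l p.
have cH : continuous H.
  apply: continuous_sub => //.
  apply: continuous_bigsum => s; apply: continuous_mul; first exact: continuous_pow.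
  exact: cst_continuous.
have HE t (x : 'rV[R]_n) : H (t, x) = chi (polyend t f) - l (t, x).
  rewrite /H polyendE; congr (_ - _).
  elim/big_rec2: _ => [|s y1 y2 _ ->]; first by rewrite scalar_fun0.
  by rewrite chil.
pose T : set (R * 'rV[R]_n) :=
  (`[0, 1]%classic `*` sphere n) `&` (snd @^-1` (~` U))
    `&` [set p | G p = 0] `&` (H @^-1` [set x | x <= 0]).
have cT : compact T.
  have cB := compact_setX (@segment_compact R 0 1) (@compact_sphere R n).
  apply: (subclosed_compact _ cB); last by move=> p [[[]]].
  have cS : closed (`[0, 1]%classic `*` sphere n : set (R * 'rV[R]_n)).
    by apply: compact_closed; [exact: norm_hausdorff|exact: cB].
  apply: closedI; first apply: closedI; first apply: closedI => //.
  - by apply: closed_comp; [move=> p _; exact: cvg_snd|exact: open_closedC].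
  - exact: closed_eq0.
  - by apply: closed_comp; [move=> p _; exact: cH|exact: closed_le].
have cT1 : closed (fst @` T).
  apply: compact_closed; first exact: norm_hausdorff.
  by apply: continuous_compact => //; apply: continuous_subspaceT.
have T1 t : 0 < t <= 1 -> (fst @` T) t.
  move=> t01; have [x [x0 [c [Ax cx Qx]]]] := hQ t t01.
  have [a a0 Sa] : exists2 a : R, a != 0 & sphere n (a *: rVof e x).
    by apply: sphere_scale; rewrite rVof_eq0.
  pose y := a *: rVof e x.
  have ly : polyend t (vecof e y) = c *: vecof e y.
    by rewrite /y !linearZ/= rVofK// Ax !scalerA mulrC.
  have Fy j : F (t, y) j = c * y 0 j by rewrite FE ly linearZ/= vecofK// mxE.
  have lE : l (t, y) = c.
    rewrite /l -[RHS]mulr1 -Sa mulr_sumr; apply: eq_bigr => j _.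
    by rewrite Fy/= expr2; ring.
  exists (t, y) => //; split; first split; first split.
  - by split=> //=; rewrite in_itv/= (andP t01).2 ltW// (andP t01).1.
  - rewrite /= => Uy; apply: (UQ (a *: x)); first by rewrite linearZ.
    move=> ax0; rewrite (proj_pi_eq ax0 x0); first exact: subset_closure.
    by rewrite memvZ// memv_line.
  - by rewrite /= /G big1// => j _; rewrite Fy lE subrr expr0n.
  - by rewrite /= HE lE subr_le0.
have [] : (fst @` T) 0.
  apply: contrapT => n0; have : nbhs (0 : R) (~` (fst @` T)) by apply: open_nbhs_nbhs; split => //; exact: closed_openC.
  move=> /nbhs_ballP[d /= d0 dT].
  have m1 : 0 < Num.min 1 (d / 2) by rewrite lt_min ltr01 divr_gt0.
  apply: (dT (Num.min 1 (d / 2))); last by apply: T1; rewrite m1/= ge_min lexx.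
  rewrite -ball_normE /= sub0r normrN gtr0_norm// gt_min; apply/orP; right.
  by rewrite ltr_pdivrMr// ltr_pMr// ltr1n.
move=> [t x] [[[[_ /= Sx] nUx] /= Gx] /= Hx] /= t0; subst t.
have x0 := sphere_neq0 Sx.
have vx0 : vecof e x != 0 by rewrite vecof_eq0.
have Ax : polyend 0 (vecof e x) = l (0, x) *: vecof e x.
  apply: (can_inj (rVofK be)); apply/rowP => j; rewrite -FE linearZ/= vecofK// mxE.
  apply/eqP; rewrite -subr_eq0 -sqrf_eq0; apply/eqP.
  by have /psumr_eq0P -> // := Gx; move=> i _; exact: sqr_ge0.
have := h0 _ _ vx0 Ax; rewrite -subr_le0 -HE => /(_ Hx) /vlineP[c cX].
have c0 : c != 0 by apply: contraNneq vx0 => c0; rewrite cX c0 scale0r.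
apply: nUx; change (U x).
have -> : x = c *: rVof e X by rewrite -linearZ/= -cX vecofK.
exact: UZ.
Qed.
End EigenLimit.
End ProjectiveClosure.

(** * Degenerations of inner products *)

Section LieRules.
Variables (F : fieldType) (g : lieAlgType F).
Implicit Types x y z : g.

Lemma lieDl x y z : lie (x + y) z = lie x z + lie y z. Proof. exact: linearDl. Qed.
Lemma lieDr z x y : lie z (x + y) = lie z x + lie z y. Proof. exact: linearDr. Qed.
Lemma lieZl a x y : lie (a *: x) y = a *: lie x y. Proof. exact: linearZl_LR. Qed.
Lemma lieZr a x y : lie x (a *: y) = a *: lie x y. Proof. exact: linearZr. Qed.
Lemma lie0l x : lie 0 x = 0. Proof. exact: linear0l. Qed.
Lemma lie0r x : lie x 0 = 0. Proof. exact: linear0r. Qed.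
Lemma lieNl x y : lie (- x) y = - lie x y. Proof. exact: linearNl. Qed.
Lemma lieNr x y : lie x (- y) = - lie x y. Proof. exact: linearNr. Qed.
Lemma lieBl x y z : lie (x - y) z = lie x z - lie y z.
Proof. by rewrite lieDl lieNl. Qed.
Lemma lieBr z x y : lie z (x - y) = lie z x - lie z y.
Proof. by rewrite lieDr lieNr. Qed.
Lemma lieC x y : lie x y = - lie y x.
Proof.
apply/eqP; rewrite -addr_eq0; have := lie_alt (x + y).
by rewrite lieDl !lieDr !lie_alt add0r addr0 => ->.
Qed.
Lemma lie_suml (I : Type) (r : seq I) (u : I -> g) x :
  lie (\sum_(i <- r) u i) x = \sum_(i <- r) lie (u i) x.
Proof. exact: linear_sumlz. Qed.
Lemma lie_sumr (I : Type) (r : seq I) (u : I -> g) x :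
  lie x (\sum_(i <- r) u i) = \sum_(i <- r) lie x (u i).
Proof. exact: linear_sumr. Qed.
End LieRules.

Lemma scalar_bigsum (R : realType) (V : vectType R) (F : V -> R) (I : Type)
    (r : seq I) (a : I -> R) (v : I -> V) : scalar F ->
  F (\sum_(i <- r) a i *: v i) = \sum_(i <- r) a i * F (v i).
Proof.
move=> Fl; elim/big_rec2: _ => [|i y z _ <-]; first exact: scalar_fun0.
exact: Fl.
Qed.

(** * Inner products diagonal in a fixed basis, and their Ricci operators *)

Section WeightedBasis.
Variables (R : realType) (V : vectType R) (T : finType).
Variables (f : T -> V) (c : T -> V -> R).
Hypothesis cl : forall i, scalar (c i).
Hypothesis cf : forall i j, c i (f j) = (i == j)%:R.
Hypothesis fE : forall x, x = \sum_i c i x *: f i.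

Lemma dual_inj x y : (forall i, c i x = c i y) -> x = y.
Proof. by move=> h; rewrite (fE x) (fE y); apply: eq_bigr => i _; rewrite h. Qed.

Lemma weighted_dot_exists (s : T -> R) : (forall i, 0 < s i) ->
  exists dot : {dot V for (@idfun R)},
    forall x y, dot x y = \sum_i (s i) ^- 2 * (c i x * c i y).
Proof.
move=> s0; pose w x y := \sum_i (s i) ^- 2 * (c i x * c i y).
have wl y : scalar (w^~ y).
  move=> a u v; rewrite /w mulr_sumr -big_split/=; apply: eq_bigr => i _.
  by rewrite cl; ring.
have wC x y : w x y = w y x by apply: eq_bigr => i _; rewrite [c i x * _]mulrC.
have wr x : scalar (w x) by move=> a u v; rewrite !(wC x) wl.
have wbil : bilinear_for *%R (@idfun R \; *%R) w by split=> [y a u v|x a u v]; [exact: wl|exact: wr].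
have wpos u : u != 0 -> 0 < w u u.
  move=> u0; have s2 i : 0 < (s i) ^- 2 by rewrite invr_gt0 exprn_gt0.
  have w0 i : 0 <= (s i) ^- 2 * (c i u * c i u).
    by apply: mulr_ge0; [exact: ltW|rewrite -expr2 sqr_ge0].
  rewrite lt_def sumr_ge0// andbT; apply: contra u0 => /eqP/psumr_eq0P z.
  apply/eqP/dual_inj => i; rewrite (scalar_fun0 (cl i)); apply/eqP.
  have /eqP := z (fun i _ => w0 i) i isT.
  by rewrite mulf_eq0 gt_eqF//= mulf_eq0 orbb.
pose B := bilinear_isBilinear.Build R V V R *%R (@idfun R \; *%R) w wbil.
have wH x y : w x y = (-1) ^+ false * idfun (w y x) by rewrite expr0 mul1r wC.
pose H := isHermitianSesquilinear.Build R V false (@idfun R) w wH.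
pose D := isDotProduct.Build R V w wpos.
pose d : {dot V for (@idfun R)} := HB.pack w B H D.
by exists d.
Qed.

Variables (s : T -> R) (dot : {dot V for (@idfun R)}).
Hypothesis s0 : forall i, 0 < s i.
Hypothesis dotE : forall x y, dot x y = \sum_i (s i) ^- 2 * (c i x * c i y).

Lemma dot_weighted_l i y : dot (f i) y = (s i) ^- 2 * c i y.
Proof.
rewrite dotE (bigD1 i)//= big1 => [|j ji]; first by rewrite cf eqxx mul1r addr0.
by rewrite cf (negbTE ji) mul0r mulr0.
Qed.

Lemma weighted_onb : orthonormal_basis dot [seq s i *: f i | i <- index_enum T].
Proof.
set e := map _ _; apply/andP; split; last first.
  apply/orthonormal_nthP => i j; rewrite size_map => li lj.
  have x0 : T by case: (index_enum T) li => [|x].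
  rewrite !(nth_map x0)//. rewrite dotZl (dotC dot (f _)) dotZl dot_weighted_l cf.
  rewrite nth_uniq ?index_enum_uniq//.
  rewrite eq_sym; case: eqP => [<-|_]; last by rewrite !mulr0.
  rewrite mulr1 mulrA -expr2 divff// expf_neq0//.
  by rewrite gt_eqF.
rewrite basisEfree subvf/=; apply/andP; split.
  rewrite -[e]in_tupleE; apply/freeP => k k0 i.
  have li : (i < size (index_enum T))%N by rewrite -(size_map (fun i => s i *: f i)).
  have x0 : T by case: (index_enum T) li => [|x].
  pose j := nth x0 (index_enum T) i.
  have := congr1 (c j) k0; rewrite (scalar_fun0 (cl j)) scalar_bigsum//.
  rewrite (bigD1 i)//= (nth_map x0)// (scalar_funZ _ _ (cl j)) cf eqxx mulr1.
  rewrite big1 => [|m mi]; last first.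
    have lm : (m < size (index_enum T))%N by rewrite -(size_map (fun i => s i *: f i)).
    rewrite (nth_map x0)// (scalar_funZ _ _ (cl j)) cf nth_uniq ?index_enum_uniq//.
    by rewrite eq_sym -(inj_eq val_inj) in mi; rewrite (negbTE mi) !mulr0.
  by rewrite addr0 => /eqP; rewrite mulf_eq0 [s j == 0]gt_eqF// orbF => /eqP.
suff sf : (fullv <= <<e>>)%VS by exact: leq_trans (dimvS sf) (dim_span e).
apply/subvP => x _; rewrite (fE x) memv_suml// => i _.
have si : s i != 0 by rewrite gt_eqF.
rewrite -[f i]scale1r -(mulVf si) -scalerA memvZ// memvZ// memv_span//.
by apply/mapP; exists i; rewrite ?mem_index_enum.
Qed.
End WeightedBasis.

Section WeightedRicci.
Variables (R : realType) (g : lieAlgType R) (T : finType).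
Variables (f : T -> g) (c : T -> g -> R).
Hypothesis cl : forall i, scalar (c i).
Hypothesis cf : forall i j, c i (f j) = (i == j)%:R.
Hypothesis fE : forall x, x = \sum_i c i x *: f i.
Variables (s : T -> R) (dot : {dot g for (@idfun R)}).
Hypothesis s0 : forall i, 0 < s i.
Hypothesis dotE : forall x y, dot x y = \sum_i (s i) ^- 2 * (c i x * c i y).

(** In the orthonormal basis [s i *: f i] each structure constant of the fixed basis picks up the
    factor [s i * s j / s l], so the metric enters only through these squares. *)
Lemma ricci_weighted x :
  ricci_op dot x =
    4^-1 *: (\sum_i \sum_j \sum_l
      ((s i * s j / s l) ^+ 2 * (c l (lie (f i) (f j)) * c l x)) *: lie (f i) (f j))
  - 2^-1 *: (\sum_k \sum_i \sum_j
      ((s k * s i / s j) ^+ 2 * (c j (lie x (f i)) * c j (lie (f k) (f i)))) *: f k).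
Proof.
have dl := @dot_linearl _ _ dot.
have dZ a v w : dot (a *: v) w = a * dot v w by exact: dotZl.
have dS (I : Type) (r : seq I) (v : I -> g) w : dot (\sum_(i <- r) v i) w = \sum_(i <- r) dot (v i) w.
  by rewrite linear_sumlz.
suff h y : dot (ricci_op dot x) y = dot (4^-1 *: (\sum_i \sum_j \sum_l
      ((s i * s j / s l) ^+ 2 * (c l (lie (f i) (f j)) * c l x)) *: lie (f i) (f j))
  - 2^-1 *: (\sum_k \sum_i \sum_j
      ((s k * s i / s j) ^+ 2 * (c j (lie x (f i)) * c j (lie (f k) (f i)))) *: f k)) y.
  apply: (dual_inj fE) => i; have := h (f i).
  by rewrite !(dotC dot _ (f i)) !(dot_weighted_l cf dotE) => /(mulfI _); apply;
    rewrite invr_eq0 expf_neq0// gt_eqF.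
rewrite ricci_opP (ricci_formE _ _ (weighted_onb cl cf fE s0 dotE)) /ricci_in.
rewrite !big_map linearBl/= !dZ; congr (_ * _ - _ * _).
  rewrite dS; apply: eq_bigr => i _; rewrite big_map dS; apply: eq_bigr => j _.
  rewrite dS lieZl lieZr scalerA !dZ (dotE _ x) mulrACA mulr_suml mulr_sumr; apply: eq_bigr => l _.
  rewrite dZ; field; rewrite gt_eqF//.
rewrite dS; under [RHS]eq_bigr => k _.
  rewrite dS; under eq_bigr => i _ do rewrite dS.
  over.
rewrite exchange_big/=; apply: eq_bigr => i _.
rewrite exchange_big/= !lieZr.
rewrite dZ dotC dZ dotC dotE !mulr_sumr; apply: eq_bigr => j _.
have -> : c j (lie y (f i)) = \sum_k c k y * c j (lie (f k) (f i)).
  rewrite {1}(fE y) lie_suml -scalar_bigsum//; congr (c j _).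
  by apply: eq_bigr => k _; rewrite lieZl.
rewrite !mulr_sumr; apply: eq_bigr => k _.
rewrite dZ (dot_weighted_l cf dotE); field; rewrite !gt_eqF//.
Qed.
End WeightedRicci.

(** * Extremal eigenvectors and bounds on the Ricci form *)

Section ExtremalPoints.
Variables (R : realType) (g : lieAlgType R).
Implicit Types (dot : {dot g for (@idfun R)}) (x v : g).

Lemma leigenspaceP dot x l :
  (x \in leigenspace (ricci_op dot) l) = (ricci_op dot x == l *: x).
Proof.
by rewrite memv_ker add_lfunE opp_lfunE scale_lfunE id_lfunE subr_eq0.
Qed.

Lemma eigenvalue_ricci_form dot l m :
  leigenvalue (ricci_op dot) m ->
  (forall v, ricci_form dot v v <= l * dot v v) -> m <= l.
Proof.
rewrite /leigenvalue -vpick0 => v0 h.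
have := memv_pick (leigenspace (ricci_op dot) m).
rewrite leigenspaceP => /eqP Hv; have := h (vpick (leigenspace (ricci_op dot) m)).
by rewrite -ricci_opP Hv dotZl ler_pM2r// neq0_dnorm_gt0.
Qed.

Lemma ricci_form_linearr dot x : scalar (ricci_form dot x).
Proof. by move=> a u v; rewrite !(ricci_formC _ x) ricci_form_linearl. Qed.

Lemma ricci_op_eigen dot x l :
  (forall y, ricci_form dot x y = l * dot x y) -> ricci_op dot x = l *: x.
Proof.
move=> h; apply/eqP; rewrite -subr_eq0; apply/eqP; set z := _ - _.
have [//|z0] := eqVneq z 0; have : 0 < dot z z by exact: neq0_dnorm_gt0.
rewrite {1}/z linearBl/= dotZl ricci_opP h subrr ltxx//.
Qed.

Lemma ricci_maximal_intro dot x (x0 : x != 0) l : ricci_op dot x = l *: x ->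
  (forall v, ricci_form dot v v <= l * dot v v) -> ricci_maximal g (proj_pi x0).
Proof.
move=> Hx h; exists dot, x, x0, l; split=> //; first by rewrite leigenspaceP Hx.
by move=> m em; exact: eigenvalue_ricci_form em h.
Qed.

Lemma ricci_minimal_intro dot x (x0 : x != 0) l : ricci_op dot x = l *: x ->
  (forall v, l * dot v v <= ricci_form dot v v) -> ricci_minimal g (proj_pi x0).
Proof.
move=> Hx h; exists dot, x, x0, l; split=> //; first by rewrite leigenspaceP Hx.
move=> m; rewrite /leigenvalue -vpick0 => v0.
have := memv_pick (leigenspace (ricci_op dot) m).
rewrite leigenspaceP => /eqP Hv; have := h (vpick (leigenspace (ricci_op dot) m)).
by rewrite -ricci_opP Hv dotZl ler_pM2r// neq0_dnorm_gt0.
Qed.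

(** The definition compares [l] with eigenvalues only; as the maximum of the Rayleigh quotient is
    itself an eigenvalue, [l] bounds the whole quadratic form. *)
Lemma ricci_maximal_elim u : ricci_maximal g u -> exists dot x l,
  [/\ x != 0, x \in pline u, ricci_op dot x = l *: x &
      forall v, ricci_form dot v v <= l * dot v v].
Proof.
move=> [dot [x [x0 [l [<- + h]]]]]; rewrite leigenspaceP => /eqP Hx.
exists dot, x, l; split=> //; first by rewrite /= memv_line.
have [y [m [y0 Hy hm]]] := max_eigen dot x0 (ricci_form_linearl dot)
  (ricci_form_linearr dot) (ricci_formC dot).
have ml : m <= l.
  apply: h; rewrite /leigenvalue; apply: contraNneq y0 => e0.
  by rewrite -memv0 -e0 leigenspaceP (ricci_op_eigen Hy).
move=> v; apply: le_trans (hm v) _.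
have [->|v0] := eqVneq v 0; first by rewrite (scalar_fun0 (dot_linearl dot 0)) !mulr0.
by rewrite ler_pM2r// neq0_dnorm_gt0.
Qed.
End ExtremalPoints.

Lemma linear_end_exists (R : realType) (V : vectType R) (h : V -> V) :
  linear h -> exists F : 'End(V), forall x, F x = h x.
Proof.
move=> hl; pose B := GRing.isLinear.Build R V V *:%R h hl.
pose L : {linear V -> V} := HB.pack h B.
by exists (linfun L) => x; rewrite lfunE.
Qed.

(** Indexes the terms of the Ricci operator by one finite type: [true] for those with coefficient
    1/4, [false] for those with -1/2. *)
Lemma sum_bool_triple (V : nmodType) (T : finType) (F : bool * (T * T * T) -> V) :
  \sum_s F s = \sum_i \sum_j \sum_l F (true, (i, j, l))
    + \sum_i \sum_j \sum_l F (false, (i, j, l)).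
Proof.
have h b : \sum_i \sum_j \sum_l F (b, (i, j, l)) = \sum_p F (b, p).
  rewrite pair_bigA/= (pair_bigA _ (fun (p : T * T) l => F (b, (p.1, p.2, l))))/=.
  by apply: eq_bigr => [[[i j] l]].
transitivity (\sum_b \sum_p F (b, p)); last by rewrite big_bool !h.
rewrite (pair_bigA _ (fun b p => F (b, p)))/=.
by apply: eq_bigr => [[b p]].
Qed.

(** * Limits of Ricci operators under powers of t *)

Section Degeneration.
Variables (R : realType) (g : lieAlgType R) (T : finType).
Variables (f : T -> g) (c : T -> g -> R) (d : T -> nat).
Hypothesis cl : forall i, scalar (c i).
Hypothesis cf : forall i j, c i (f j) = (i == j)%:R.
Hypothesis fE : forall x, x = \sum_i c i x *: f i.
Hypothesis dP : forall i j l, c l (lie (f i) (f j)) != 0 -> (d l <= d i + d j)%N.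

(* The operators [ricci_op], in the inner products for which the
   [t ^+ d i *: f i] are orthonormal, converge to this one as [t -> 0]. *)
Definition limit_ricci (x : g) : g :=
  4^-1 *: (\sum_i \sum_j \sum_l
    ((d i + d j <= d l)%N%:R * (c l (lie (f i) (f j)) * c l x)) *: lie (f i) (f j))
  - 2^-1 *: (\sum_k \sum_i \sum_j
    ((d k + d i <= d j)%N%:R * (c j (lie x (f i)) * c j (lie (f k) (f i)))) *: f k).

Lemma ricci_polyend : exists (M : bool * (T * T * T) -> 'End(g)) k,
  (forall x, polyend k M 0 x = limit_ricci x) /\
  forall t, 0 < t -> exists dot : {dot g for (@idfun R)},
   (forall i, dot (f i) (f i) = (t ^+ d i) ^- 2) /\
   [/\ forall i y, dot (f i) y = (t ^+ d i) ^- 2 * c i y &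
      forall x, ricci_op dot x = polyend k M t x].
Proof.
pose h (s : bool * (T * T * T)) (x : g) : g := let: (b, (i, j, l)) := s in
  if b then (4^-1 * (c l (lie (f i) (f j)) * c l x)) *: lie (f i) (f j)
  else - ((2^-1 * (c l (lie x (f j)) * c l (lie (f i) (f j)))) *: f i).
have hl s : linear (h s).
  case: s => [[] [[i j] l]] a u v /=.
    by rewrite cl scalerA -scalerDl; congr (_ *: _); ring.
  by rewrite lieDl lieZl cl scalerN scalerA -opprD -scalerDl; congr (- (_ *: _)); ring.
have [M MP] := choice (fun s => linear_end_exists (hl s)).
(* Truncated subtraction is harmless: [dP] makes the exponent exact wherever the structure constant
   is nonzero. At [t = 0] the convention [0 ^+ 0 = 1] keeps exactly the terms with
   [d i + d j <= d l]. *)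
pose k (s : bool * (T * T * T)) := let: (b, (i, j, l)) := s in
  (2 * (d i + d j - d l))%N.
have split_sum (a : R -> T -> T -> T -> R) (t : R) (x : g) :
  (forall i j l, c l (lie (f i) (f j)) != 0 -> a t i j l = t ^+ (2 * (d i + d j - d l))) ->
  polyend k M t x =
  4^-1 *: (\sum_i \sum_j \sum_l
    (a t i j l * (c l (lie (f i) (f j)) * c l x)) *: lie (f i) (f j))
  - 2^-1 *: (\sum_k \sum_i \sum_j
    (a t k i j * (c j (lie x (f i)) * c j (lie (f k) (f i)))) *: f k).
  move=> aE; rewrite polyendE.
  rewrite sum_bool_triple; congr (_ + _).
    rewrite scaler_sumr; apply: eq_bigr => i _.
    rewrite scaler_sumr; apply: eq_bigr => j _.
    rewrite scaler_sumr; apply: eq_bigr => l _.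
    rewrite MP /= !scalerA; congr (_ *: _).
    have [->|/aE ->] := eqVneq (c l (lie (f i) (f j))) 0; first by rewrite !(mul0r, mulr0).
    ring.
  rewrite scaler_sumr -sumrN; apply: eq_bigr => i _.
  rewrite scaler_sumr -sumrN; apply: eq_bigr => j _.
  rewrite scaler_sumr -sumrN; apply: eq_bigr => l _.
  rewrite MP /= scalerN !scalerA; congr (- (_ *: _)).
  have [->|/aE ->] := eqVneq (c l (lie (f i) (f j))) 0; first by rewrite !(mul0r, mulr0).
  ring.
exists M, k; split=> [x|t t0].
  apply: (split_sum (fun _ i j l => (d i + d j <= d l)%N%:R)) => i j l _.
  by rewrite expr0n muln_eq0/= subn_eq0.
have s0 i : 0 < t ^+ d i by rewrite exprn_gt0.
have [dot dotE] := weighted_dot_exists cl fE s0.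
exists dot; split; last split.
- by move=> i; rewrite (dot_weighted_l cf dotE) cf eqxx mulr1.
- by move=> i y; rewrite (dot_weighted_l cf dotE).
move=> x; rewrite (ricci_weighted cl cf fE s0 dotE) -(split_sum (fun t i j l => (t ^+ d i * t ^+ d j / t ^+ d l) ^+ 2))//.
move=> i j l /dP dl; rewrite -exprD -{1}(subnK dl) exprD mulfK ?gt_eqF//.
by rewrite -exprM mulnC.
Qed.

(** The entry [c k0 (ricci_op dot (f k0))] is the Rayleigh quotient at [f k0], so the largest
    eigenvalue dominates it for every [t > 0]; this is the threshold of [eigen_limit]. *)
Lemma degenerate_maximal k0 X :
  (forall x l, x != 0 -> limit_ricci x = l *: x ->
    c k0 (limit_ricci (f k0)) <= l -> x \in <[X]>%VS) ->
  in_cl (ricci_maximal g) X.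
Proof.
move=> hX; have [M [k [M0 Mt]]] := ricci_polyend.
apply: (@eigen_limit R g _ k M (c k0) (f k0) X) => //.
  move=> t /andP[t0 _]; have [dot [dff [df ric]]] := Mt t t0.
  have f0 : f k0 != 0.
    apply/eqP => z; have := cf k0 k0; rewrite z (scalar_fun0 (cl k0)) eqxx => /eqP.
    by rewrite eq_sym oner_eq0.
  have [x [l [x0 Hx hl]]] := max_eigen dot f0 (ricci_form_linearl dot)
    (ricci_form_linearr dot) (ricci_formC dot).
  exists x, x0, l; split; first by rewrite -ric (ricci_op_eigen Hx).
    have := hl (f k0); rewrite -ricci_opP dotC df dff mulrC ler_pM2r ?ric//.
    by rewrite invr_gt0 !exprn_gt0.
  by apply: ricci_maximal_intro hl; exact: ricci_op_eigen.
by move=> x l x0; rewrite !M0; exact: hX.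
Qed.

(** The argument for maxima applied to the negated operators. *)
Lemma degenerate_minimal k0 X :
  (forall x l, x != 0 -> limit_ricci x = l *: x ->
    l <= c k0 (limit_ricci (f k0)) -> x \in <[X]>%VS) ->
  in_cl (ricci_minimal g) X.
Proof.
move=> hX; have [M [k [M0 Mt]]] := ricci_polyend.
have pN t x : polyend k (fun s => - M s) t x = - polyend k M t x.
  by rewrite !polyendE -sumrN; apply: eq_bigr => s _; rewrite opp_lfunE scalerN.
apply: (@eigen_limit R g _ k (fun s => - M s) (c k0) (f k0) X) => //.
  move=> t /andP[t0 _]; have [dot [dff [df ric]]] := Mt t t0.
  have f0 : f k0 != 0.
    apply/eqP => z; have := cf k0 k0; rewrite z (scalar_fun0 (cl k0)) eqxx => /eqP.
    by rewrite eq_sym oner_eq0.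
  have [||u v|x [l [x0 Hx hl]]] := @max_eigen R g dot (fun u v => - ricci_form dot u v) _ f0.
  - by move=> v a u w; rewrite ricci_form_linearl; ring.
  - by move=> v a u w; rewrite ricci_form_linearr; ring.
  - by rewrite ricci_formC.
  have Hx' : ricci_op dot x = - l *: x.
    by apply: ricci_op_eigen => y; rewrite mulNr -Hx opprK.
  exists x, x0, l; split; first by rewrite pN -ric Hx' scaleNr opprK.
    rewrite pN -ric -scaleN1r scalar_funZ// mulN1r.
    have := hl (f k0); rewrite -ricci_opP dotC df dff mulrC -mulNr ler_pM2r//.
    by rewrite invr_gt0 !exprn_gt0.
  apply: ricci_minimal_intro Hx' _ => v; rewrite mulNr lerNl; exact: hl.
move=> x l x0; rewrite !pN !M0 => /(canRL (@opprK _)); rewrite -scaleNr => Hx.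
by rewrite -scaleN1r scalar_funZ// mulN1r -lerNl => h; exact: hX Hx h.
Qed.
End Degeneration.

(** [P] projects onto the span of the [w j] along the common kernel [K0] of the forms [th j], which
    contains the vectors of [v]. Completing [v] inside [K0] keeps the prescribed forms as the
    coordinates along the [w j]. *)
Lemma adapted_dual_basis (R : realType) (V : vectType R) (p q : nat)
    (v : p.-tuple V) (th : 'I_q -> V -> R) (w : 'I_q -> V) :
  (forall j, scalar (th j)) -> free v ->
  (forall j k, th j (w k) = (j == k)%:R) ->
  (forall j i, th j (tnth v i) = 0) ->
  exists (m : nat) (f : 'I_p + ('I_q + 'I_m) -> V)
    (c : 'I_p + ('I_q + 'I_m) -> V -> R),
  [/\ forall i, scalar (c i), forall i j, c i (f j) = (i == j)%:R,
      forall x, x = \sum_i c i x *: f i,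
      forall i, f (inl i) = tnth v i &
      forall j, f (inr (inl j)) = w j /\ c (inr (inl j)) = th j].
Proof.
move=> thl fv thw thv.
have [P PE] : exists P : 'End(V), forall x, P x = \sum_j th j x *: w j.
  apply: linear_end_exists => a x y; rewrite scaler_sumr -big_split/=.
  by apply: eq_bigr => j _; rewrite thl scalerDl scalerA.
have thP j x : th j (P x) = th j x.
  rewrite PE scalar_bigsum// (bigD1 j)//= thw eqxx mulr1 big1 ?addr0// => k kj.
  by rewrite thw eq_sym (negbTE kj) mulr0.
pose K0 := lker P.
have K0P x : (x \in K0) = [forall j, th j x == 0].
  rewrite memv_ker; apply/eqP/forallP => [x0 j|h].
    by rewrite -thP x0 scalar_fun0.
  by rewrite PE big1// => j _; rewrite (eqP (h j)) scale0r.
pose W := <<v>>%VS; pose r := vbasis (K0 :\: W)%VS; pose m := \dim (K0 :\: W).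
have WK : (W <= K0)%VS.
  apply/span_subvP => _ /tnthP[i ->]; rewrite K0P.
  by apply/forallP => j; rewrite thv.
pose X : (p + m).-tuple V := [tuple of v ++ r].
have XK : <<X>>%VS = K0.
  rewrite span_cat (span_basis (vbasisP _)) addvC addv_diff.
  exact/addv_idPl.
have fX : free X.
  rewrite cat_free fv (basis_free (vbasisP _))/= directv_addE.
  by rewrite !directv_trivial/= (span_basis (vbasisP _)) capvC capv_diff.
have XE x : x = P x + \sum_i coord X i (x - P x) *: X`_i.
  rewrite -coord_span; first by rewrite addrC subrK.
  rewrite XK K0P; apply/forallP => j.
  have -> : x - P x = (-1) *: P x + x by rewrite scaleN1r addrC.
  by rewrite thl thP mulN1r addNr.
have Xl (i : 'I_p) : X`_(lshift m i) = tnth v i.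
  by rewrite /= nth_cat size_tuple ltn_ord -tnth_nth.
have Xr (i : 'I_m) : X`_(rshift p i) = r`_i.
  by rewrite /= nth_cat size_tuple ltnNge leq_addr/= addKn.
pose f (i : 'I_p + ('I_q + 'I_m)) := match i with
  | inl i => tnth v i | inr (inl j) => w j | inr (inr k) => r`_k end.
pose c (i : 'I_p + ('I_q + 'I_m)) x := match i with
  | inl i => coord X (lshift m i) (x - P x)
  | inr (inl j) => th j x
  | inr (inr k) => coord X (rshift p k) (x - P x) end.
have Pw k : P (w k) = w k.
  rewrite PE (bigD1 k)//= thw eqxx scale1r big1 ?addr0// => j jk.
  by rewrite thw (negbTE jk) scale0r.
have PX (i : 'I_(p + m)) : P X`_i = 0.
  apply/eqP; rewrite -memv_ker -/K0 -XK memv_span// mem_nth//.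
  by case: i => i ? /=; rewrite size_cat !size_tuple.
have cX (i j : 'I_(p + m)) : coord X i (X`_j - P X`_j) = (i == j)%:R.
  by rewrite PX subr0 coord_free// eq_sym.
exists m, f, c; split=> //.
- have subP a x y : a *: x + y - P (a *: x + y) = a *: (x - P x) + (y - P y).
    by rewrite linearP scalerBr opprD addrACA.
  by case=> [i|[j|k]] a x y /=; rewrite ?thl// subP linearP.
- move=> [i|[i|i]] [j|[j|j]]; rewrite /c /f.
  + by rewrite -Xl cX (inj_eq (@lshift_inj _ _)).
  + by rewrite Pw subrr linear0.
  + by rewrite -Xr cX eq_lrshift.
  + exact: thv.
  + exact: thw.
  + by have /eqP := PX (rshift p j); rewrite Xr -memv_ker K0P => /forallP/(_ i)/eqP.
  + by rewrite -Xl cX eq_rlshift.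
  + by rewrite Pw subrr linear0.
  + by rewrite -Xr cX (inj_eq (@rshift_inj _ _)).
move=> x; rewrite {1}(XE x) {1}PE big_split_ord/= !big_sumType/= addrCA; congr (_ + (_ + _)).
  by apply: eq_bigr => i _; rewrite -Xl.
by apply: eq_bigr => i _; rewrite -Xr.
Qed.

(** * Degenerations in which only chosen brackets survive *)

Section GradedDegeneration.
Variables (R : realType) (g : lieAlgType R) (p q : nat).
Variables (v : p.-tuple g) (th : 'I_q -> g -> R) (w : 'I_q -> g).
Variables (dv : 'I_p -> nat) (D rho : nat).
Hypothesis thl : forall j, scalar (th j).
Hypothesis fv : free v.
Hypothesis thw : forall j k, th j (w k) = (j == k)%:R.
Hypothesis thv : forall j i, th j (tnth v i) = 0.
Hypothesis dv_gt0 : forall i, (0 < dv i)%N.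
Hypothesis dv_lt : forall i, (dv i < D)%N.
Hypothesis dv_ge : forall i j, i != j -> (D <= dv i + dv j)%N.
Hypothesis rho_lt : (rho < D)%N.
Hypothesis rho2 : (D < 2 * rho)%N.
Hypothesis rho_dv : forall i, (D < rho + dv i)%N.

(** The vectors of [v] have weights [dv], the [w j] the top weight [D], all other basis vectors
    weight [rho]. Two distinct basis vectors have total weight at least [D], with equality only
    inside [v]; so only brackets within [v] survive, seen through the [th j], and the limit does not
    depend on how the basis is completed. *)
Definition graded_ricci (x : g) : g :=
  4^-1 *: (\sum_i \sum_k \sum_j ((dv i + dv k <= D)%N%:R *
     (th j (lie (tnth v i) (tnth v k)) * th j x)) *: lie (tnth v i) (tnth v k))
  - 2^-1 *: (\sum_k \sum_i \sum_j ((dv k + dv i <= D)%N%:R *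
     (th j (lie x (tnth v i)) * th j (lie (tnth v k) (tnth v i)))) *: tnth v k).

Lemma graded_maximal j0 X :
  (forall x l, x != 0 -> graded_ricci x = l *: x ->
    th j0 (graded_ricci (w j0)) <= l -> x \in <[X]>%VS) ->
  in_cl (ricci_maximal g) X.
Proof.
move=> hX; have [m [f [c [cl cf fE fl fr]]]] := adapted_dual_basis thl fv thw thv.
pose d (i : 'I_p + ('I_q + 'I_m)) := match i with
  | inl i => dv i | inr (inl _) => D | inr (inr _) => rho end.
have fwE j : f (inr (inl j)) = w j by have [] := fr j.
have cwE j : c (inr (inl j)) = th j by have [] := fr j.
have dD i : (d i <= D)%N.
  by case: i => [i|[j|j]] //=; [exact: ltnW|exact: ltnW].
have d0 i : (0 < d i)%N.
  by case: i => [i|[j|j]] //=; [have := rho_lt; lia|have := rho2; lia].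
have dd i k : i != k -> (D <= d i + d k)%N.
  case: i k => [i|[i|i]] [k|[k|k]] //= ik; rewrite ?leq_addr ?leq_addl//.
  - by apply: dv_ge; apply: contraNneq ik => ->.
  - by have := rho_dv i; lia.
  - by have := rho_dv k; lia.
  - by have := rho2; lia.
have dP i k l : c l (lie (f i) (f k)) != 0 -> (d l <= d i + d k)%N.
  move=> h; apply: (leq_trans (dD l)); apply: dd; apply: contraNneq h => ->.
  by rewrite lie_alt scalar_fun0.
have dS i k l : i != k -> (d i + d k <= d l)%N ->
    exists i' k' j, [/\ i = inl i', k = inl k' & l = inr (inl j)].
  move=> ik; have := dd _ _ ik; have := dD l; have Dl : (d l == D) -> exists j, l = inr (inl j).
    case: l => [l|[l|l]] /=; [|by exists l|].
      by have := dv_lt l; lia.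
    by have := rho_lt; lia.
  case: i k ik => [i|[i|i]] [k|[k|k]] ik /= h1 h2 h3; last 8 first.
  - by have := dv_gt0 i; lia.
  - by have := rho_dv i; lia.
  - by have := dv_gt0 k; lia.
  - by lia.
  - by have := d0 (inr (inr k)); rewrite /=; lia.
  - by have := rho_dv k; lia.
  - by have := d0 (inr (inr i)); rewrite /=; lia.
  - by lia.
  have [|j lj] := Dl _; first by lia.
  by exists i, k, j.
have sum3 (F : 'I_p + ('I_q + 'I_m) -> 'I_p + ('I_q + 'I_m) -> 'I_p + ('I_q + 'I_m) -> g) :
    (forall i, F i i =1 fun=> 0) -> (forall i k l, ~~ (d i + d k <= d l)%N -> F i k l = 0) ->
    \sum_i \sum_k \sum_l F i k l = \sum_i \sum_k \sum_j F (inl i) (inl k) (inr (inl j)).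
  move=> F0 Fd.
  have Fz i k l : (forall i' k' j, ~ [/\ i = inl i', k = inl k' & l = inr (inl j)]) -> F i k l = 0.
    move=> h; have [->|ik] := eqVneq i k; first exact: F0.
    apply: Fd; apply/negP => /(dS _ _ _ ik)[i' [k' [j hh]]]; exact: h hh.
  rewrite big_sumType/= [X in _ + X]big1 ?addr0 => [|i _]; last first.
    by apply: big1 => k _; apply: big1 => l _; apply: Fz => ? ? ? [].
  apply: eq_bigr => i _; rewrite big_sumType/= [X in _ + X]big1 ?addr0 => [|k _]; last first.
    by apply: big1 => l _; apply: Fz => ? ? ? [].
  apply: eq_bigr => k _; rewrite big_sumType/= [X in X + _]big1 ?add0r => [|l _]; last first.
    by apply: Fz => ? ? ? [].
  rewrite big_sumType/= [X in _ + X]big1 ?addr0// => l _.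
  by apply: Fz => ? ? ? [].
have LE x : limit_ricci f c d x = graded_ricci x.
  rewrite /limit_ricci sum3; last 2 first.
  - by move=> i k; rewrite lie_alt scaler0.
  - by move=> i k l /negbTE ->; rewrite mul0r scale0r.
  rewrite sum3; last 2 first.
  - by move=> i k; rewrite lie_alt (scalar_fun0 (cl _)) !mulr0 scale0r.
  - by move=> i k l /negbTE ->; rewrite mul0r scale0r.
  congr (_ *: _ - _ *: _); apply: eq_bigr => i _; apply: eq_bigr => k _; apply: eq_bigr => j _.
    by rewrite !fl cwE.
  by rewrite !fl cwE.
apply: (degenerate_maximal cl cf fE dP (k0 := inr (inl j0))) => x l.
by rewrite !LE cwE fwE; exact: hX.
Qed.
End GradedDegeneration.

Lemma scalar_ext (R : realType) (V : vectType R) (x y : V) :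
  (forall phi : V -> R, (forall u v, phi (u + v) = phi u + phi v) ->
     (forall a u, phi (a *: u) = a * phi u) -> (forall u, phi (- u) = - phi u) ->
     phi 0 = 0 -> phi x = phi y) -> x = y.
Proof.
move=> h; rewrite (coord_vbasis (memvf x)) (coord_vbasis (memvf y)).
apply: eq_bigr => i _; congr (_ *: _); apply: h => [u v|a u|u|];
  by rewrite ?linearD ?linearZ ?linearN ?linear0.
Qed.

(* Decides identities in a module by testing them against linear forms. *)
Ltac module_ring :=
  let phi := fresh "phi" in let pD := fresh "pD" in let pZ := fresh "pZ" in
  let pN := fresh "pN" in let p0 := fresh "p0" in
  apply: scalar_ext => phi pD pZ pN p0; rewrite ?(pD, pZ, pN, p0).

(** * Explicit limit points from one and from two commutators *)

Section DegenerationFamilies.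
Variables (R : realType) (g : lieAlgType R).
Implicit Types (u v x A B C : g).

Lemma scalar_funD (F : g -> R) x y : scalar F -> F (x + y) = F x + F y.
Proof. by move=> Fl; have := Fl 1 x y; rewrite scale1r mul1r. Qed.

Lemma scalar_funN (F : g -> R) x : scalar F -> F (- x) = - F x.
Proof. by move=> Fl; rewrite -scaleN1r scalar_funZ// mulN1r. Qed.

(** Along an eigenvector, [th], [th (lie _ v)] and [th (lie _ u)] satisfy a triangular system with
    diagonal 1/2, -1/2, -1/2. So 1/2 is the only positive eigenvalue, and solving the system there
    gives the displayed vector. *)
Lemma commutator_maximal u v (th : g -> R) : scalar th ->
  th u = 0 -> th v = 0 -> th (lie u v) = 1 ->
  in_cl (ricci_maximal g)
    (lie u v + (2^-1 * th (lie (lie u v) u)) *: v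
             - (2^-1 * th (lie (lie u v) v)) *: u).
Proof.
move=> thl thu thv; set Z := lie u v => thZ.
have tD x y := scalar_funD x y thl.
have tZ a x := scalar_funZ a x thl.
have tN x := scalar_funN x thl.
have t0 := scalar_fun0 thl.
have fv : free [:: u; v].
  rewrite free_cons seq1_free span_seq1; apply/andP; split.
    apply/negP => /vlineP[k uk]; move: thZ; rewrite /Z uk lieZl lie_alt scaler0 t0.
    by move/eqP; rewrite eq_sym oner_eq0.
  apply/eqP => v0; move: thZ; rewrite /Z v0 lie0r t0 => /eqP.
  by rewrite eq_sym oner_eq0.
pose L := graded_ricci [tuple u; v] (fun _ : 'I_1 => th) (fun=> 2%N) 4.
have LE x : L x = 2^-1 *: (th x *: Z - th (lie x v) *: u + th (lie x u) *: v).
  rewrite /L /graded_ricci !big_ord_recl !big_ord0 !(tnth_nth 0)/=.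
  rewrite !lie_alt (lieC v u) -/Z tN t0 thZ.
  by module_ring; field.
have LZ : th (L Z) = 2^-1.
  by rewrite LE !(tZ, tD, tN) thu thv thZ; ring.
apply: (@graded_maximal R g 2 1 [tuple u; v] (fun=> th) (fun=> Z) (fun=> 2%N) 4 3 _ _ _ _ _ _ _ _ _ _ ord0) => //.
- by move=> j k; rewrite (ord1 j) (ord1 k) thZ.
- by move=> j [[|[|[]]] //= i]; rewrite (tnth_nth 0).
rewrite -/L LZ => x l x0 Lx l2.
have l0 : 0 < l by apply: lt_le_trans l2; rewrite invr_gt0.
move: (Lx); rewrite LE => Ex.
have E1 : l * th x = 2^-1 * th x.
  by have := congr1 th Ex; rewrite !(tZ, tD, tN) thu thv thZ => <-; ring.
have E2 : l * th (lie x v) = 2^-1 * (th x * th (lie Z v) - th (lie x v)).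
  have := congr1 (fun y => th (lie y v)) Ex.
  by rewrite /= !(lieZl, lieDl, lieNl) -/Z lie_alt !(tZ, tD, tN) t0 thZ => <-; ring.
have E3 : l * th (lie x u) = 2^-1 * (th x * th (lie Z u) - th (lie x u)).
  have := congr1 (fun y => th (lie y u)) Ex.
  rewrite /= !(lieZl, lieDl, lieNl) lie_alt (lieC v u) -/Z !(tZ, tD, tN) t0 thZ => <-; ring.
have [t_0|tx0] := eqVneq (th x) 0.
  have z2 : th (lie x v) = 0.
    apply/eqP; have /eqP : (l + 2^-1) * th (lie x v) = 0 by rewrite mulrDl E2 t_0; ring.
    by rewrite mulf_eq0 gt_eqF// ltr_wpDr// invr_ge0.
  have z3 : th (lie x u) = 0.
    apply/eqP; have /eqP : (l + 2^-1) * th (lie x u) = 0 by rewrite mulrDl E3 t_0; ring.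
    by rewrite mulf_eq0 gt_eqF// ltr_wpDr// invr_ge0.
  move: Ex; rewrite t_0 z2 z3 !scale0r subr0 addr0 scaler0 => /esym/eqP.
  by rewrite scaler_eq0 (negbTE x0) gt_eqF.
have lE : l = 2^-1 by apply: (mulIf tx0).
apply/vlineP; exists (th x).
have e2 : th (lie x v) = 2^-1 * (th x * th (lie Z v)) by rewrite lE in E2; lra.
have e3 : th (lie x u) = 2^-1 * (th x * th (lie Z u)) by rewrite lE in E3; lra.
apply: (scalerI (a := 2^-1)); first by rewrite invr_neq0.
rewrite -{1}lE -Ex e2 e3.
by module_ring; ring.
Qed.

(** Weights 5, 5, 4 for [A], [B], [C] and top weight 9 keep [[B,C]] and [[A,C]] and drop [[A,B]].
    The two brackets contribute the eigenvalues 1/2 and [rho ^+ 2 / 2]; [rho < 1] separates them, so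
    the [om] component of the top eigenvector vanishes. The equations for [al], [be], [ga] are the
    remaining triangular system, with diagonal [- rho ^+ 2 / 2], [- 1 / 2], [- (1 + rho ^+ 2) / 2],
    solved at the eigenvalue 1/2. *)
Lemma two_commutators_maximal A B C (ze om : g -> R) (rho al be ga : R) :
  scalar ze -> scalar om ->
  [/\ ze A = 0, ze B = 0 & ze C = 0] -> [/\ om A = 0, om B = 0 & om C = 0] ->
  ze (lie B C) = 1 -> ze (lie A C) = 0 ->
  om (lie B C) = 0 -> om (lie A C) = rho -> 0 < rho < 1 ->
  let z := lie B C in
  al * (1 + rho ^+ 2) = - (rho * om (lie z C)) ->
  be * 2 = - ze (lie z C) ->
  ga * (2 + rho ^+ 2) = - ze (lie B z) - al * ze (lie B A)
                         - rho * om (lie A z) - rho * be * om (lie A B) ->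
  in_cl (ricci_maximal g) (z + al *: A + be *: B + ga *: C).
Proof.
move=> zel oml [zeA zeB zeC] [omA omB omC] + zE + oE /andP[r0 r1] z alE beE gaE.
rewrite -/z => zz oz.
have zD x y := scalar_funD x y zel.
have zZ a x := scalar_funZ a x zel.
have zN x := scalar_funN x zel.
have z0 := scalar_fun0 zel.
have oD x y := scalar_funD x y oml.
have oZ a x := scalar_funZ a x oml.
have oN x := scalar_funN x oml.
have o0 := scalar_fun0 oml.
have CB : lie C B = - z by rewrite lieC.
have CA : lie C A = - lie A C by rewrite lieC.
have BA : lie B A = - lie A B by rewrite lieC.
have rn0 : rho != 0 by rewrite gt_eqF.
pose V := [tuple A; B; C].
pose th (j : 'I_2) := if val j == 0%N then ze else om.
pose w (j : 'I_2) := if val j == 0%N then z else rho^-1 *: lie A C.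
pose dv (i : 'I_3) := if val i == 2%N then 4%N else 5%N.
have fV : free V.
  apply/freeP => k; rewrite !big_ord_recl big_ord0/= addr0 => k0.
  set a := k _ in k0; set b := k _ in k0; set c := k _ in k0.
  have b0 : b = 0.
    have := congr1 (fun y => ze (lie y C)) k0.
    by rewrite /= !(lieZl, lieDl) lie_alt lie0l !(zD, zZ) z0 -/z zz zE; lra.
  have a0 : a = 0.
    have := congr1 (fun y => om (lie y C)) k0.
    rewrite /= !(lieZl, lieDl) lie_alt lie0l !(oD, oZ) o0 -/z oz oE b0 => /eqP.
    by rewrite !(mul0r, mulr0, addr0) mulf_eq0 (negbTE rn0) orbF => /eqP.
  have c0 : c = 0.
    move: k0; rewrite a0 b0 !scale0r !add0r => /eqP; rewrite scaler_eq0 => /orP[/eqP//|/eqP C0].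
    by move: zz; rewrite /z C0 lie0r z0 => /eqP; rewrite eq_sym oner_eq0.
  move=> [[|[|[|//]]] i3]; [rewrite -a0|rewrite -b0|rewrite -c0]; congr k; exact: val_inj.
pose L := graded_ricci V th dv 9.
have LE x : L x = 2^-1 *: (ze x *: z - ze (lie x C) *: B - ze (lie B x) *: C
   + (rho * om x) *: lie A C - (rho * om (lie x C)) *: A - (rho * om (lie A x)) *: C).
  rewrite /L /graded_ricci !big_ord_recl !big_ord0 !(tnth_nth 0)/=.
  rewrite /dv /th /= !mul0r !scale0r !lie_alt CB CA -/z (lieC B x) (lieC A x).
  rewrite !(zN, oN, z0, o0, zz, oz, zE, oE).
  by module_ring; rewrite !(mul0r, mulr0, addr0, add0r, mul1r, oppr0); field.
have omz : om z = 0 by [].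
have Lz : ze (L z) = 2^-1.
  by rewrite LE !(zZ, zD, zN) zeA zeB zeC zE zz omz; ring.
apply: (@graded_maximal R g 3 2 V th w dv 9 6 _ _ _ _ _ _ _ _ _ _ ord0) => //.
- by move=> j; rewrite /th; case: ifP.
- move=> [[|[|//]] ?] [[|[|//]] ?]; rewrite /th /w/= ?zZ ?oZ ?zz ?oz ?zE ?oE ?mulr0//.
  by rewrite mulVf.
- by move=> [[|[|//]] ?] [[|[|[|//]]] ?]; rewrite /th (tnth_nth 0)/=.
- by move=> [[|[|[|//]]] ?].
- by move=> [[|[|[|//]]] ?].
- by move=> [[|[|[|//]]] ?] [[|[|[|//]]] ?].
- by move=> [[|[|[|//]]] ?].
rewrite /= -/L; rewrite [th _ _]Lz => x l x0 Lx l2.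
have l0 : 0 < l by apply: lt_le_trans l2; rewrite invr_gt0.
move: (Lx); rewrite LE => Ex.
have F0 : om x = 0.
  have h : l * om x = 2^-1 * (rho ^+ 2 * om x).
    by have := congr1 om Ex; rewrite !(oZ, oD, oN) omA omB omC omz oE => <-; ring.
  have : (l - 2^-1 * rho ^+ 2) * om x = 0 by rewrite mulrBl h; ring.
  move=> /eqP; rewrite mulf_eq0 subr_eq0 => /orP[/eqP lr|/eqP//].
  have : rho ^+ 2 < 1 by rewrite exprn_ilt1// ltW.
  by move: l2; rewrite lr; lra.
rewrite F0 !(mulr0, scale0r, addr0) in Ex.
have E1 : l * ze x = 2^-1 * ze x.
  by have := congr1 ze Ex; rewrite !(zZ, zD, zN) zeA zeB zeC zz => <-; ring.
set p := ze (lie x C) in Ex; set P := om (lie x C) in Ex.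
have E2 : l * p = 2^-1 * (ze x * ze (lie z C) - p).
  have := congr1 (fun y => ze (lie y C)) Ex.
  by rewrite /= !(lieZl, lieDl, lieNl) -/z lie_alt !(zZ, zD, zN) z0 zz zE -/p => <-; ring.
have E3 : l * P = 2^-1 * (ze x * om (lie z C) - rho ^+ 2 * P).
  have := congr1 (fun y => om (lie y C)) Ex.
  by rewrite /= !(lieZl, lieDl, lieNl) -/z lie_alt !(oZ, oD, oN) o0 oz oE -/P => <-; ring.
(* Only this combination enters the coefficient of [C], and the eigenvector equation closes up on
   it. *)
set G := ze (lie B x) + rho * om (lie A x).
have E4 : l * G = 2^-1 * (ze x * (ze (lie B z) + rho * om (lie A z))
    - rho * P * ze (lie B A) - rho * p * om (lie A B) - (1 + rho ^+ 2) * G).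
  have h1 := congr1 (fun y => ze (lie B y)) Ex.
  have h2 := congr1 (fun y => om (lie A y)) Ex.
  move: h1 h2; rewrite /= !(lieZr, lieDr, lieNr) -/z !lie_alt.
  rewrite !(zZ, zD, zN, oZ, oD, oN) z0 o0 zz oE -/P -/p => h1 h2.
  rewrite {1}/G mulrDr -h1 (mulrCA l) -h2 /G; ring.
have Ex' : l *: x = 2^-1 *: (ze x *: z - p *: B - G *: C - (rho * P) *: A).
  by rewrite -Ex /G; module_ring; ring.
have pos k y : 0 <= k -> (l + k) * y = 0 -> y = 0.
  by move=> k0 /eqP; rewrite mulf_eq0 gt_eqF ?ltr_wpDr// => /eqP.
have [t_0|tx0] := eqVneq (ze x) 0.
  rewrite t_0 !mul0r in E2 E3 E4.
  have p0 : p = 0 by apply: (pos 2^-1); [rewrite invr_ge0|rewrite mulrDl E2; ring].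
  have P0 : P = 0.
    apply: (pos (2^-1 * rho ^+ 2)); first by rewrite mulr_ge0 ?invr_ge0 ?sqr_ge0.
    by rewrite mulrDl E3; ring.
  have G0 : G = 0.
    apply: (pos (2^-1 * (1 + rho ^+ 2))).
      by rewrite mulr_ge0 ?invr_ge0// addr_ge0 ?sqr_ge0.
    by rewrite mulrDl E4 p0 P0; ring.
  move: Ex'; rewrite t_0 p0 P0 G0 mulr0 !scale0r !subr0 scaler0 => /eqP.
  by rewrite scaler_eq0 (negbTE x0) gt_eqF.
have lE : l = 2^-1 by apply: (mulIf tx0).
rewrite lE in E2 E3 E4.
have r2 : 0 <= rho ^+ 2 by exact: sqr_ge0.
have q1 : 1 + rho ^+ 2 != 0 by rewrite gt_eqF// ltr_wpDr.
have q2 : 2 + rho ^+ 2 != 0 by rewrite gt_eqF// ltr_wpDr.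
have half (y w' : R) : 2^-1 * y = 2^-1 * w' -> y = w'.
  by apply: mulfI; rewrite invr_neq0.
have e2 : p = - (ze x * be).
  have h : 2 * p = ze x * ze (lie z C).
    apply: half; transitivity (2^-1 * p + 2^-1 * p); first by ring.
    by rewrite {1}E2; ring.
  apply: (mulfI (_ : 2 != 0 :> R)) => //.
  by rewrite h -[ze (lie z C)]opprK -beE; ring.
have e3 : rho * P = - (ze x * al).
  have h : (1 + rho ^+ 2) * P = ze x * om (lie z C).
    by apply: half; rewrite mulrDl mul1r mulrDr E3; ring.
  apply: (mulIf q1); rewrite mulNr -(mulrA (ze x)) alE mulrN opprK.
  by transitivity (rho * ((1 + rho ^+ 2) * P)); [ring|rewrite h; ring].
have e4 : G = - (ze x * ga).
  have h : (2 + rho ^+ 2) * G = ze x * (ze (lie B z) + rho * om (lie A z))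
    - rho * P * ze (lie B A) - rho * p * om (lie A B).
    apply: half; transitivity (2^-1 * G + 2^-1 * (1 + rho ^+ 2) * G); first by ring.
    by rewrite {1}E4; ring.
  apply: (mulfI q2); rewrite h e2 e3.
  by transitivity (- ze x * (ga * (2 + rho ^+ 2))); [rewrite gaE; ring|ring].
apply/vlineP; exists (ze x).
apply: (scalerI (a := 2^-1)); first by rewrite invr_neq0.
by rewrite -{1}lE Ex' e2 e3 e4; module_ring; ring.
Qed.
End DegenerationFamilies.

(** * Generic closure of the Ricci-maximal points *)

Section LinearForms.
Variables (R : realType) (V : vectType R).
Implicit Types (x y z : V) (U : {vspace V}).

Lemma separating_form U x : x \notin U ->
  exists phi : V -> R, [/\ scalar phi, phi x = 1 & forall u, u \in U -> phi u = 0].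
Proof.
move=> xU; have fX : free (x :: vbasis U).
  by rewrite free_cons (span_basis (vbasisP U)) xU (basis_free (vbasisP U)).
have [phi /(_ fX)] := @linear_of_free R V R^o (x :: vbasis U) (1 :: nseq (size (vbasis U)) 0).
rewrite /= size_nseq => /(_ erefl)[phix phiU]; exists phi; split=> //.
  by move=> a u v; rewrite linearP.
move=> u uU; rewrite (coord_vbasis uU) linear_sum big1// => i _.
rewrite linearZ/=; have -> : phi (vbasis U)`_i = 0; last exact: mulr0.
rewrite -(nth_map _ 0) ?size_tuple ?ltn_ord// phiU nth_nseq.
by case: ifP.
Qed.

Lemma mem_span2 x a b : x \in <<[:: a; b]>>%VS ->
  exists k l, x = k *: a + l *: b.
Proof.
rewrite span_cons span_seq1 => /memv_addP[_ /vlineP[k ->] [_ /vlineP[l ->] ->]].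
by exists k, l.
Qed.

Lemma mem_span3 x a b c : x \in <<[:: a; b; c]>>%VS ->
  exists k l m, x = k *: a + l *: b + m *: c.
Proof.
rewrite span_cons => /memv_addP[_ /vlineP[k ->] [y /mem_span2[l [m ->]] ->]].
by exists k, l, m; rewrite addrA.
Qed.

Lemma mem_span4 x a b c d : x \in <<[:: a; b; c; d]>>%VS ->
  exists k l m n, x = k *: a + l *: b + m *: c + n *: d.
Proof.
rewrite span_cons => /memv_addP[_ /vlineP[k ->] [y /mem_span3[l [m [n ->]]] ->]].
by exists k, l, m, n; rewrite !addrA.
Qed.

Lemma quadratic_path_eq0 (d : R) x y z : 0 < d ->
  (forall t, t != 0 -> `|t| < d -> x + t *: y + t ^+ 2 *: z = 0) ->
  [/\ x = 0, y = 0 & z = 0].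
Proof.
(* The nodes [h], [- h], [2 * h] lie inside the interval and avoid 0, where nothing is assumed. *)
move=> d0 H; pose h := d / 3.
have hp : 0 < h by rewrite divr_gt0.
have h0 : h != 0 by rewrite gt_eqF.
have E1 : x + h *: y + h ^+ 2 *: z = 0.
  by apply: H => //; rewrite gtr0_norm// /h; lra.
have E2 : x + (- h) *: y + (- h) ^+ 2 *: z = 0.
  by apply: H; rewrite ?oppr_eq0// normrN gtr0_norm// /h; lra.
have E3 : x + (2 * h) *: y + (2 * h) ^+ 2 *: z = 0.
  have h2 : 0 < 2 * h by rewrite mulr_gt0.
  by apply: H; [rewrite gt_eqF|rewrite gtr0_norm// /h; lra].
suff F phi : (forall u v, phi (u + v) = phi u + phi v :> R) ->
     (forall a u, phi (a *: u) = a * phi u) -> phi 0 = 0 ->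
     [/\ phi x = 0, phi y = 0 & phi z = 0].
  by split; apply: scalar_ext => phi pD pZ _ p0; rewrite p0; have [] := F phi pD pZ p0.
move=> pD pZ p0.
have := congr1 phi E1; have := congr1 phi E2; have := congr1 phi E3.
rewrite !(pD, pZ) p0 => e3 e2 e1.
have hy : h * phi y = 0 by lra.
have hz : h ^+ 2 * phi z = 0 by lra.
split; first by lra.
- by apply: (mulfI h0); rewrite hy mulr0.
- by apply: (mulfI (_ : h ^+ 2 != 0)); rewrite ?expf_neq0// hz mulr0.
Qed.
End LinearForms.

(** * The Engel-type relation at points off the closure *)

Section Nilpotent.
Variables (R : realType) (g : lieAlgType R).
Hypothesis hg : lie_nilpotent g.
Implicit Types (u v w x y z : g).

Lemma iter_lie_nilpotent : exists k, forall x y, iter k (lie x) y = 0.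
Proof.
have [k hk] := hg; exists k => x y; apply/eqP; rewrite -memv0 -hk.
elim: k {hk} => [|k IH] /=; first exact: memvf.
by apply: mem_liev IH; exact: memvf.
Qed.

(** With [N = lie x] nilpotent and [a != 0], the operator [a - p N - q N^2] is invertible. *)
Lemma nilpotent_relation (a p q : R) x z : a != 0 ->
  a *: z = p *: lie x z + q *: lie x (lie x z) -> z = 0.
Proof.
move=> a0 h; have [k hk] := iter_lie_nilpotent.
have : iter k (lie x) z = 0 by [].
elim: k {hk} => [//|k IH] hk; apply: IH.
have il b c u v : iter k (lie x) (b *: u + c *: v) =
    b *: iter k (lie x) u + c *: iter k (lie x) v.
  by elim: k {hk} => //= k ->; rewrite lieDr !lieZr.
have := congr1 (iter k (lie x)) h; rewrite il -[a *: z]addr0 -[0](scale0r 0) il.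
have hk2 : iter k.+2 (lie x) z = 0 by rewrite iterS hk lie0r.
rewrite -!iterSr hk hk2 !scaler0 !scale0r !addr0 => /eqP.
by rewrite scaler_eq0 (negbTE a0) => /eqP.
Qed.

Lemma nilpotent_eigen (a : R) x z : lie x z = a *: z -> a = 0 \/ z = 0.
Proof.
move=> h; have [->|a0] := eqVneq a 0; [by left|right].
by apply: (@nilpotent_relation a 1 0 x z a0); rewrite h scale1r scale0r addr0.
Qed.

Lemma lie_eq_self u v (a : R) : lie u v = a *: v -> lie u v = 0.
Proof. by move=> h; have [a0|v0] := nilpotent_eigen h; rewrite h ?a0 ?v0 ?scale0r ?scaler0. Qed.

Notation M := (ricci_maximal g).

(** The two hypotheses allow a form to be prescribed independently on [Z] and on [lie u Z]. With the
    values 1 and [- (2 / s)] there, the vector of [commutator_maximal] is [Z + s^-1 *: v], whose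
    direction tends to that of [v]. *)
Lemma engel_maximal u v : let Z := lie u v in
  lie u Z \notin <<[:: u; v; Z; lie v Z]>>%VS ->
  Z \notin <<[:: u; v; lie v Z]>>%VS -> in_cl M v.
Proof.
move=> Z uZ ZN.
have ZN' : Z \notin <<[:: u; v; lie v Z; lie u Z]>>%VS.
  apply: contra ZN => /mem_span4[a [b [c [d ZE]]]].
  have d0 : d = 0.
    apply/eqP; apply: contraR uZ => d0.
    have -> : lie u Z = d^-1 *: (Z - a *: u - b *: v - c *: lie v Z).
      rewrite {2}ZE; apply: (scalerI d0); rewrite scalerA divff// scale1r.
      by module_ring; ring.
    by apply: memvZ; rewrite !memvB//; try apply: memvZ; apply: memv_span;
      rewrite !inE ?eqxx ?orbT.
  by rewrite [X in X \in _]ZE d0 scale0r addr0 !memvD//; apply: memvZ; apply: memv_span;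
    rewrite !inE ?eqxx ?orbT.
have [p1 [p1l p1Z p1U]] := separating_form ZN'.
have [p2 [p2l p2Z p2U]] := separating_form uZ.
have m1 x : x \in [:: u; v; lie v Z; lie u Z] -> p1 x = 0.
  by move=> h; apply: p1U; exact: memv_span.
have m2 x : x \in [:: u; v; Z; lie v Z] -> p2 x = 0.
  by move=> h; apply: p2U; exact: memv_span.
apply: (@in_cl_path _ _ _ v Z 0 1) => // s /andP[s0 _].
pose th x := p1 x - 2 / s * p2 x.
have thl : scalar th by move=> a x y; rewrite /th p1l p2l; ring.
have th0 x : x \in [:: u; v; lie v Z] -> th x = 0.
  rewrite !inE /th => /or3P[]/eqP ->; rewrite m1 ?m2 ?inE ?eqxx ?orbT//; ring.
have thu : th u = 0 by rewrite th0// !inE eqxx ?orbT.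
have thv : th v = 0 by rewrite th0// !inE eqxx ?orbT.
have thvZ : th (lie v Z) = 0 by rewrite th0// !inE eqxx ?orbT.
have thuZ : th (lie u Z) = - (2 / s).
  by rewrite /th p2Z m1 ?inE ?eqxx ?orbT//; ring.
have thZ : th Z = 1 by rewrite /th p1Z m2 ?inE ?eqxx ?orbT//; ring.
have := commutator_maximal thl thu thv thZ.
rewrite -/Z (lieC Z u) (lieC Z v) !scalar_funN// thvZ thuZ => h.
have := @in_clZ _ _ _ s _ h; congr in_cl.
by module_ring; field; rewrite gt_eqF.
Qed.

(** One of the two independence conditions of [engel_maximal] must fail, and bracketing the
    resulting dependence with [v], or with a modification [w] of [u], lets nilpotency reduce it to
    the relation. *)
Lemma engel_relation u v : ~ in_cl M v ->
  exists a : R, lie u (lie v u) = a *: lie v (lie v u).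
Proof.
move=> bv; set Z := lie u v.
suff [a aE] : exists a : R, lie u Z = a *: lie v Z.
  by exists a; rewrite (lieC v u) -/Z !lieNr aE scalerN.
have [/mem_span3[x [y [a ZE]]]|ZN] := boolP (Z \in <<[:: u; v; lie v Z]>>%VS).
  exists 0; rewrite scale0r.
  suff -> : Z = 0 by rewrite lie0r.
  have TZ : x *: Z = (-1) *: lie v Z + a *: lie v (lie v Z).
    have : lie v Z = x *: lie v u + a *: lie v (lie v Z).
      by rewrite {1}ZE !lieDr !lieZr lie_alt scaler0 addr0.
    by rewrite (lieC v u) -/Z => h; rewrite {1}h; module_ring; ring.
  have [x0|xn0] := eqVneq x 0; last exact: nilpotent_relation xn0 TZ.
  have vZ : lie v Z = 0.
    apply: (@nilpotent_relation 1 a 0 v); first exact: oner_neq0.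
    move: TZ; rewrite x0 scale0r => /esym/eqP; rewrite scaleN1r addrC subr_eq0 => /eqP TZ.
    by rewrite scale1r scale0r addr0 TZ.
  move: ZE; rewrite x0 vZ scale0r scaler0 add0r addr0; exact: lie_eq_self.
have [/mem_span4[x [y [c [a ZE]]]]|uZ] :=
    boolP (lie u Z \in <<[:: u; v; Z; lie v Z]>>%VS); last first.
  by case: bv; exact: engel_maximal uZ ZN.
exists a; apply/eqP; rewrite -subr_eq0 -lieZl -lieBl; apply/eqP.
(* Replacing [u] by [w] keeps the bracket with [v] and removes [lie v Z] from the dependence; it
   remains to show [lie w Z = 0]. *)
set w := u - a *: v; have wv : lie w v = Z by rewrite lieBl lieZl lie_alt scaler0 subr0.
have wZ : lie w Z = x *: w + (y + a * x) *: v + c *: Z.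
  by rewrite lieBl lieZl ZE /w; module_ring; ring.
have w2 : lie w (lie w Z) = (y + a * x) *: Z + c *: lie w Z.
  by rewrite {1}wZ !lieDr !lieZr lie_alt wv scaler0 add0r.
have [y0|yn0] := eqVneq (y + a * x) 0; last first.
  suff -> : Z = 0 by rewrite lie0r.
  apply: (nilpotent_relation (x := w) (p := - c) (q := 1) yn0).
  by rewrite w2; module_ring; ring.
rewrite y0 scale0r add0r in w2; have [c0|->//] := nilpotent_eigen w2.
move: wZ; rewrite y0 c0 !scale0r !addr0 => wZ.
have : lie Z w = (- x) *: w by rewrite lieC wZ scaleNr.
by move=> /nilpotent_eigen[/eqP|w0]; [rewrite oppr_eq0 wZ => /eqP ->; rewrite scale0r|
  rewrite w0 lie0l].
Qed.

(** The quadratic form [chi (lie u (lie v u))] vanishes on the hyperplane [tau = 0], hence is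
    divisible by the linear form [tau]; the quotient is [mu]. *)
Lemma engel_linear v u0 :
  (forall u, exists a : R, lie u (lie v u) = a *: lie v (lie v u)) ->
  lie v (lie v u0) != 0 ->
  exists mu : g -> R, scalar mu /\
    forall u, lie u (lie v u) = mu u *: lie v (lie v u).
Proof.
move=> hv h0; have [chi [chil chi1 _]] : exists phi : g -> R,
    [/\ scalar phi, phi (lie v (lie v u0)) = 1 & forall u, u \in 0%VS -> phi u = 0].
  by apply: separating_form; rewrite memv0.
have cD x y := scalar_funD x y chil.
have cZ a x := scalar_funZ a x chil.
have cN x := scalar_funN x chil.
pose tau u := chi (lie v (lie v u)).
pose B x y := chi (lie x (lie v y) + lie y (lie v x)).
(* The quotient by [tau u], read off the expansion along [u = tau u *: u0 + k] with [tau k = 0]. *)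
pose mu u := tau u * chi (lie u0 (lie v u0)) + B u0 (u - tau u *: u0).
have taul : scalar tau by move=> a x y; rewrite /tau !lieDr !lieZr cD cZ.
have mul : scalar mu.
  move=> a x y; rewrite /mu /B taul !(lieBr, lieDr, lieZr, lieBl, lieDl, lieZl) !(cD, cZ, cN).
  by ring.
have key u : tau u != 0 -> lie u (lie v u) = mu u *: lie v (lie v u).
  move=> tu; have [a ha] := hv u; rewrite ha; congr (_ *: _).
  apply: (mulIf tu); rewrite /tau -cZ -ha -/(tau u).
  rewrite {1}/mu; set t := tau u in tu *.
  have [k kE] : exists k, k = u - t *: u0 by exists (u - t *: u0).
  have tk : tau k = 0.
    by rewrite kE /tau !(lieBr, lieZr) cD cN cZ chi1 mulr1 subrr.
  have qk : chi (lie k (lie v k)) = 0.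
    by have [b ->] := hv k; rewrite cZ -/(tau k) tk mulr0.
  have uE : u = t *: u0 + k by rewrite kE addrC subrK.
  rewrite -kE /B uE !(lieDr, lieZr, lieDl, lieZl) !(cD, cZ) qk; ring.
exists mu; split=> // u; have [tu|tu] := eqVneq (tau u) 0; last exact: key.
(* On [tau u = 0] the relation is the constant coefficient, in [t], of the relation at
   [t *: u0 + u]. *)
have E t : t != 0 -> (lie u (lie v u) - mu u *: lie v (lie v u))
  + t *: (lie u (lie v u0) + lie u0 (lie v u) - mu u *: lie v (lie v u0) - mu u0 *: lie v (lie v u))
  + t ^+ 2 *: (lie u0 (lie v u0) - mu u0 *: lie v (lie v u0)) = 0.
  move=> t0; have : tau (t *: u0 + u) != 0 by rewrite taul tu addr0 /tau chi1 mulr1.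
  move=> /key; rewrite mul => /eqP; rewrite -subr_eq0 => /eqP <-.
  by rewrite !(lieDr, lieZr, lieDl, lieZl); module_ring; ring.
have [/eqP + _ _] := quadratic_path_eq0 ltr01 (fun t t0 _ => E t t0).
by rewrite subr_eq0 => /eqP.
Qed.
End Nilpotent.

Section LimitFamily.
Variables (R : realType) (g : lieAlgType R).
Notation M := (ricci_maximal g).

(* The degeneration of [two_commutators_maximal] with [A = h + t b], [B = b]
   and [C = e + d b - s A] tends, for [t s] fixed and [s -> 0], to
   [e - (2 d / r) b] where [r = rho ^ 2]; here [rho = 1 / 2]. *)
Lemma limit_family_maximal (e b h : g) (phi psi : g -> R) (d : R) :
  let P := lie e b in let E := lie e h in let Q := lie b h in let F := lie e P in
  lie b P = 0 -> lie h P = 0 -> lie e Q = 0 -> lie b Q = 0 -> lie h Q = 0 ->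
  scalar phi -> scalar psi ->
  [/\ phi e = 0, phi b = 0, phi h = 0 & phi E = 0] ->
  [/\ psi e = 0, psi b = 0, psi h = 0 & psi E = 0] ->
  phi P = 1 -> phi Q = 0 -> psi P = 0 -> psi Q = 1 -> psi F != 0 -> d != 0 ->
  in_cl M (e - (8 * d) *: b).
Proof.
move=> P E Q F bP hP eQ bQ hQ fl sl [fe fb fh fE] [se sb sh sE] fP fQ sP sQ sF d0.
set f1 := phi F; set f2 := psi F in sF.
(* The coefficient [ga] below equals [g0 / s + g1], and [s] times the vector of
   [two_commutators_maximal] is [x0 + s *: x1 + s ^+ 2 *: x2]. The leading term is nonzero because
   [psi F != 0]. *)
pose g0 : R := - 3 * f2 / (32 * d).
have g0n : g0 != 0 by rewrite /g0 !mulf_neq0 ?invr_neq0 ?mulf_neq0 ?oppr_eq0.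
pose g1 : R := f1 / (4 * d) - 5 / (36 * d) * (5 / 8 * f1).
pose x0 := g0 *: (e - (8 * d) *: b).
pose x1 := - P + (- f2 / (4 * d) - g0) *: h + g1 *: e
  + (9 / 20 * f1 - 5 / 8 * f1 + g1 * (- (4 / 5 * d))) *: b.
pose x2 := - Q + (f1 / (4 * d) - g1) *: h.
apply: (@in_clZ' _ _ _ g0) => //; rewrite -/x0.
apply: (@in_cl_path _ _ _ x0 x1 x2 1) => // s /andP[s0 _].
have sn0 : s != 0 by rewrite gt_eqF.
pose t := 9 / 5 * d / s.
pose A := h + t *: b; pose C := e + d *: b - s *: A.
pose ze x := 5 / 4 * phi x - 9 / 4 / s * psi x.
pose om x := 2^-1 * (5 / (4 * d)) * (psi x - s * phi x).
have zl : scalar ze by move=> a x y; rewrite /ze fl sl; ring.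
have ol : scalar om by move=> a x y; rewrite /om fl sl; ring.
have fD x y := scalar_funD x y fl.
have fZ a x := scalar_funZ a x fl.
have fN x := scalar_funN x fl.
have sD x y := scalar_funD x y sl.
have sZ a x := scalar_funZ a x sl.
have sN x := scalar_funN x sl.
have f0 := scalar_fun0 fl. have s00 := scalar_fun0 sl.
have be : lie b e = - P by rewrite lieC.
have he : lie h e = - E by rewrite lieC.
have hb : lie h b = - Q by rewrite lieC.
have Pe : lie P e = - F by rewrite lieC.
have Pb : lie P b = 0 by rewrite lieC bP oppr0.
have Ph : lie P h = 0 by rewrite lieC hP oppr0.
have Qe : lie Q e = 0 by rewrite lieC eQ oppr0.
have Qb : lie Q b = 0 by rewrite lieC bQ oppr0.
have Qh : lie Q h = 0 by rewrite lieC hQ oppr0.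
have zE : lie b C = - P - s *: Q.
  rewrite /C /A !(lieDr, lieNr, lieZr) lie_alt be -/Q.
  by module_ring; ring.
have AC : lie A C = - E - d *: Q - t *: P.
  rewrite /C /A !(lieDr, lieNr, lieZr, lieDl, lieZl) !lie_alt be he hb -/Q.
  by module_ring; ring.
have zC : lie (lie b C) C = F.
  rewrite zE /C /A !(lieDr, lieNr, lieZr, lieDl, lieZl, lieNl) Pe Pb Ph Qe Qb Qh.
  by module_ring; ring.
have Bz : lie b (lie b C) = 0.
  by rewrite zE !(lieDr, lieNr, lieZr) bP bQ; module_ring; ring.
have Az : lie A (lie b C) = 0.
  by rewrite zE /A !(lieDr, lieNr, lieZr, lieDl, lieZl) bP bQ hP hQ; module_ring; ring.
have BA : lie b A = Q by rewrite /A lieDr lieZr lie_alt scaler0 addr0.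
have AB : lie A b = - Q by rewrite lieC BA.
pose al : R := - (f2 - s * f1) / (4 * d).
pose bt : R := - (5 / 8 * f1) + 9 / 8 / s * f2.
pose ga : R := al / s + 5 / (36 * d) * bt.
have two := @two_commutators_maximal R g A b C ze om 2^-1 al bt ga zl ol.
cbv zeta in two; rewrite zC Bz Az BA AB zE AC in two.
have hX : in_cl M (- P - s *: Q + al *: A + bt *: b + ga *: C).
  apply: two.
  - by rewrite /ze /C /A !(fD, fN, fZ, sD, sN, sZ) fe fb fh se sb sh; split; ring.
  - by rewrite /om /C /A !(fD, fN, fZ, sD, sN, sZ) fe fb fh se sb sh; split; ring.
  - by rewrite /ze !(fD, fN, fZ, sD, sN, sZ) fP fQ sP sQ; field; rewrite ?d0 ?sn0//.
  - by rewrite /ze !(fD, fN, fZ, sD, sN, sZ) fP fQ sP sQ fE sE /t; field; rewrite ?d0 ?sn0//.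
  - by rewrite /om !(fD, fN, fZ, sD, sN, sZ) fP fQ sP sQ; field; rewrite ?d0 ?sn0//.
  - by rewrite /om !(fD, fN, fZ, sD, sN, sZ) fP fQ sP sQ fE sE /t; field; rewrite ?d0 ?sn0//.
  - by apply/andP; split; lra.
  - by rewrite /om -/f1 -/f2 /al; field; rewrite ?d0 ?sn0//.
  - by rewrite /ze -/f1 -/f2 /bt; field; rewrite ?d0 ?sn0//.
  - rewrite /ze /om !(fN, sN) fQ sQ !(f0, s00) /ga /al /bt; field; rewrite ?d0 ?sn0//.
have := @in_clZ _ _ _ s _ hX; congr in_cl.
rewrite /x0 /x1 /x2 /C /A /ga /al /bt /t /g1 /g0.
by module_ring; field; rewrite ?d0 ?sn0//.
Qed.
End LimitFamily.

Lemma mem_span5 (R : realType) (V : vectType R) (x a b c d e : V) :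
  x \in <<[:: a; b; c; d; e]>>%VS ->
  exists k l m n p, x = k *: a + l *: b + (m *: c + n *: d + p *: e).
Proof.
rewrite span_cons => /memv_addP[_ /vlineP[k ->] [y + ->]].
rewrite span_cons => /memv_addP[_ /vlineP[l ->] [z /mem_span3[m [n [p ->]]] ->]].
by exists k, l, m, n, p; rewrite !addrA.
Qed.

(** A form equal to 1 at [x] that vanishes at [y] is corrected by one that vanishes at [x] but not
    at [y]. *)
Lemma form_nonzero (R : realType) (V : vectType R) (U : {vspace V}) (x y : V) :
  x \notin U -> y \notin U -> exists psi : V -> R,
    [/\ scalar psi, forall u, u \in U -> psi u = 0, psi x = 1 & psi y != 0].
Proof.
move=> xU yU; have [p [pl px pU]] := separating_form xU.
have [p0|pn] := eqVneq (p y) 0; last by exists p.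
have yU' : y \notin (U + <[x]>)%VS.
  apply: contra yU => /memv_addP[u uU [_ /vlineP[c ->] yuc]].
  move: p0; rewrite yuc -[u]scale1r pl pU// scalar_funZ// px !mulr0 mulr1 add0r => c0.
  by rewrite c0 scale0r addr0 scale1r.
have [q [ql qy qU]] := separating_form yU'.
exists (fun z => p z + q z); split.
- by move=> a u v; rewrite pl ql; ring.
- by move=> u uU; rewrite pU// qU ?addr0// (subvP (addvSl U _)).
- by rewrite px qU ?addr0// (subvP (addvSr U _)) ?memv_line.
- by rewrite p0 qy add0r oner_neq0.
Qed.

(** * Structure forced on the algebra by a point off the closure *)

Section GenericPoints.
Variables (R : realType) (g : lieAlgType R).
Hypothesis hg : lie_nilpotent g.
Implicit Types (u v w x y z : g).
Notation M := (ricci_maximal g).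

Lemma two_stepP : two_step_nilpotent g <-> forall x y z, lie x (lie y z) = 0.
Proof.
rewrite /two_step_nilpotent; split=> [h x y z|h].
  by apply/eqP; rewrite -memv0 -h !mem_liev ?memvf.
apply/eqP; rewrite -subv0; apply/liev_subP => x w _ wd; rewrite memv0.
have [F FE] : exists F : 'End(g), forall y, F y = lie x y.
  by apply: linear_end_exists => a y z; rewrite lieDr lieZr.
rewrite -FE -memv_ker; apply: subvP wd; apply/liev_subP => y z _ _.
by rewrite memv_ker FE h.
Qed.

(* Polarised, the 2-Engel identity [u,[k,u]] = 0 makes [u,[k,w]] alternating,
   and the Jacobi identity then reads 3 [u,[k,w]] = 0. *)
Lemma engel_two_step (K : {vspace g}) :
  (forall u k, u \in K -> k \in K -> lie u (lie k u) = 0) ->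
  forall u k w, u \in K -> k \in K -> w \in K -> lie u (lie k w) = 0.
Proof.
move=> h u k w uK kK wK.
have pol x y z : x \in K -> y \in K -> z \in K ->
    lie x (lie y z) = - lie z (lie y x).
  move=> xK yK zK; apply/eqP; rewrite -addr_eq0; apply/eqP.
  have := h (x + z) y (memvD xK zK) yK.
  by rewrite !(lieDr, lieDl) !h// add0r addr0.
have := lie_jacobi u k w.
have -> : lie k (lie w u) = lie u (lie k w).
  by rewrite (lieC w u) lieNr (pol k u w)// opprK (lieC u k) lieNr -(pol u k w).
have -> : lie w (lie u k) = lie u (lie k w).
  by rewrite (lieC u k) lieNr -(pol u k w).
by move/eqP; rewrite -mulr2n -mulrSr -scaler_nat scaler_eq0 pnatr_eq0/= => /eqP.
Qed.

(** Otherwise [ad e] squares to zero for [e] in an open set. The square is quadratic in [e], so it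
    vanishes identically, and [engel_two_step] makes the algebra two-step nilpotent. *)
Lemma bad_engel_neq0 e0 : ~ in_cl M e0 -> ~ two_step_nilpotent g ->
  exists e u, ~ in_cl M e /\ lie e (lie e u) != 0.
Proof.
move=> b0 n2; apply: contrapT => /forallNP hh.
have h e u : ~ in_cl M e -> lie e (lie e u) = 0.
  move=> be; apply/eqP; apply: contrapT => /negP eu; apply: (hh e).
  by exists u.
have E u k : lie u (lie u k) = 0.
  have [d d0 hd] := not_in_cl_near u 0 b0.
  have key t : t != 0 -> `|t| < d -> lie e0 (lie e0 k) +
      t *: (lie e0 (lie u k) + lie u (lie e0 k)) + t ^+ 2 *: lie u (lie u k) = 0; last first.
    by have [_ _ ->] := quadratic_path_eq0 d0 key.
  move=> t0 td; have <- : lie (e0 + t *: u) (lie (e0 + t *: u) k) = 0.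
    by apply: h; have := hd t td; rewrite scaler0 addr0.
  by rewrite !(lieDr, lieDl, lieZl, lieZr); module_ring; ring.
apply: n2; apply/two_stepP => x y z.
apply: (@engel_two_step fullv) => [u k _ _|||]; rewrite ?memvf//.
by rewrite (lieC k) lieNr E oppr0.
Qed.

(** Passing from [u] to [u + e] leaves [lie e u] unchanged and adds [lie e (lie e u)] to the left
    side of the relation, which pins down [mu e = 1]. *)
Lemma bad_engel e u : ~ in_cl M e -> lie e (lie e u) != 0 ->
  exists mu : g -> R, [/\ scalar mu, mu e = 1 &
    forall x, lie x (lie e x) = mu x *: lie e (lie e x)].
Proof.
move=> be eu; have [mu [mul muE]] := engel_linear (fun x => engel_relation hg x be) eu.
exists mu; split=> //.
have := muE (u + e); rewrite lieDr lie_alt addr0 lieDl muE.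
rewrite -[X in _ + X]scale1r -scalerDl => /eqP.
rewrite (scalar_funD _ _ mul) -subr_eq0 -scalerBl scaler_eq0 (negbTE eu) orbF subr_eq0.
by move=> /eqP/addrI.
Qed.

(** * A noncommuting pair in the kernel puts e into the closure *)

Section BracketPair.
Variables (e b h : g) (mu : g -> R).
Hypotheses (mul : scalar mu) (mue : mu e = 1) (mub : mu b = 0) (muh : mu h = 0).
Hypothesis mu_lie : forall x y, mu (lie x y) = 0.
Let P := lie e b.
Let E := lie e h.
Let Q := lie b h.
Let F := lie e P.
Hypotheses (Q0 : Q != 0) (F0 : F != 0) (eQ : lie e Q = 0).
Hypotheses (bP : lie b P = 0) (bQ : lie b Q = 0) (bE : lie b E = 0) (bF : lie b F = 0).
Hypotheses (hP : lie h P = 0) (hQ : lie h Q = 0) (hE : lie h E = 0) (hF : lie h F = 0).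

Let inner w := [/\ mu w = 0, lie b w = 0 & lie h w = 0].

Let innerD x y : inner x -> inner y -> inner (x + y).
Proof.
by move=> [? b1 h1] [? b2 h2]; split; rewrite ?lieDr ?b1 ?b2 ?h1 ?h2 ?addr0// (scalar_funD _ _ mul); lra.
Qed.

Let innerZ (a : R) x : inner x -> inner (a *: x).
Proof.
move=> [m1 b1 h1]; split; rewrite ?lieZr ?b1 ?h1 ?scaler0//.
by rewrite scalar_funZ// m1 mulr0.
Qed.

Let innerP : inner P. Proof. by split; rewrite ?bP ?hP ?mu_lie. Qed.
Let innerQ : inner Q. Proof. by split; rewrite ?bQ ?hQ ?mu_lie. Qed.
Let innerE : inner E. Proof. by split; rewrite ?bE ?hE ?mu_lie. Qed.
Let innerF : inner F. Proof. by split; rewrite ?bF ?hF ?mu_lie. Qed.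

(** [mu] detects the coefficient of [e], [lie b] that of [h] and [lie h] that of [b], because
    [Q != 0]; all three vanish on inner vectors. *)
Let inner_span w a c (d t : R) : inner w -> inner a -> inner c ->
  w \in <<[:: a; c; (e + d *: b)%R; b; (h + t *: b)%R]>>%VS ->
  exists x y : R, w = x *: a + y *: c.
Proof.
move=> iw ia ic /mem_span5[x [y [m [n [p wE]]]]]; exists x, y.
have [] : inner (m *: (e + d *: b) + n *: b + p *: (h + t *: b)).
  have -> : m *: (e + d *: b) + n *: b + p *: (h + t *: b) =
      w + ((-1) *: (x *: a) + (-1) *: (y *: c)) by rewrite wE; module_ring; ring.
  by apply: innerD => //; apply: innerD; apply: innerZ; exact: innerZ.
have mD u v := scalar_funD u v mul. have mZ k u := scalar_funZ k u mul.
rewrite !(mD, mZ) mue mub muh => h1.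
have m0 : m = 0 by lra.
rewrite m0 scale0r add0r !(lieDr, lieZr) !lie_alt (lieC h b) -/Q => /eqP + h3.
rewrite !scaler0 add0r addr0 scaler_eq0 (negbTE Q0) orbF => /eqP p0.
move: h3; rewrite p0 scale0r addr0 scalerN => /eqP.
rewrite oppr_eq0 scaler_eq0 (negbTE Q0) orbF => /eqP n0.
by rewrite wE m0 n0 p0 !scale0r !addr0.
Qed.

(** Replacing [e] by [e + d *: b] and [h] by [h + t *: b] keeps [P], [Q], [F] and turns [E] into
    [E1]; the limit family with parameter [d / 8] then leads back to [e]. The parameter 0 is not
    allowed, so for [d = 0] the point [e] is approached along [e + s *: b]. *)
Let shifted_maximal (d t : R) : let E1 := E + t *: P + d *: Q in
  (forall x y : R, P <> x *: E1 + y *: Q) -> (forall x y : R, Q <> x *: P + y *: E1) ->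
  (forall x y : R, F <> x *: P + y *: E1) -> in_cl M e.
Proof.
move=> E1 hPn hQn hFn; pose e1 := e + d *: b; pose h1 := h + t *: b.
have iE1 : inner E1.
  by apply: innerD; [|exact: innerZ]; apply: innerD; [|exact: innerZ].
have PU : P \notin <<[:: E1; Q; e1; b; h1]>>%VS.
  by apply/negP => /(inner_span innerP iE1 innerQ)[x [y]]; exact: hPn.
have QU : Q \notin <<[:: P; E1; e1; b; h1]>>%VS.
  by apply/negP => /(inner_span innerQ innerP iE1)[x [y]]; exact: hQn.
have FU : F \notin <<[:: P; E1; e1; b; h1]>>%VS.
  by apply/negP => /(inner_span innerF innerP iE1)[x [y]]; exact: hFn.
have [phi [fl fP fU]] := separating_form PU.
have [psi [sl sU sQ sF]] := form_nonzero QU FU.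
have e1b : lie e1 b = P by rewrite lieDl lieZl lie_alt scaler0 addr0.
have e1h : lie e1 h1 = E1.
  rewrite /e1 /h1 !(lieDl, lieDr, lieZl, lieZr) lie_alt -/P -/E -/Q /E1.
  by module_ring; ring.
have bh : lie b h1 = Q by rewrite /h1 lieDr lieZr lie_alt scaler0 addr0.
have e1P : lie e1 P = F by rewrite lieDl lieZl bP scaler0 addr0.
have key c : c != 0 -> in_cl M (e1 - (8 * c) *: b).
  move=> c0; apply: (@limit_family_maximal _ _ e1 b h1 phi psi c);
    rewrite ?e1b ?e1h ?bh ?e1P//.
  - by rewrite /h1 lieDl lieZl bP hP scaler0 addr0.
  - by rewrite /e1 lieDl lieZl eQ bQ scaler0 addr0.
  - by rewrite /h1 lieDl lieZl bQ hQ scaler0 addr0.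
  - by split; apply: fU; apply: memv_span; rewrite !inE eqxx ?orbT.
  - by split; apply: sU; apply: memv_span; rewrite !inE eqxx ?orbT.
  - by apply: fU; apply: memv_span; rewrite !inE eqxx ?orbT.
  - by apply: sU; apply: memv_span; rewrite !inE eqxx ?orbT.
have [d0|dn] := eqVneq d 0; last first.
  have d8 : d / 8 != 0 by rewrite mulf_neq0 ?invr_neq0.
  have := key _ d8; congr in_cl; rewrite /e1.
  by module_ring; field.
apply: (@in_cl_path _ _ _ e b 0 1) => // s /andP[s0 _].
have s8 : - s / 8 != 0 by rewrite mulf_neq0 ?invr_neq0 ?oppr_eq0 ?gt_eqF.
have := key _ s8; congr in_cl; rewrite /e1 d0.
by module_ring; field.
Qed.

Let PQ_indep (y : R) : P <> y *: Q.
Proof.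
move=> PE; move/eqP: F0; apply; rewrite /F PE lieZr eQ scaler0//.
Qed.

Let QP_indep (x : R) : Q <> x *: P.
Proof.
move=> QE; move/eqP: eQ; rewrite QE lieZr -/F scaler_eq0 (negbTE F0) orbF => /eqP x0.
by move/eqP: Q0; apply; rewrite QE x0 scale0r.
Qed.

Let FP_indep (x : R) : F <> x *: P.
Proof.
by move=> FE; move/eqP: F0; apply; exact: (@lie_eq_self _ _ hg e P x).
Qed.

(** If [E] lies in the span of [P] and [Q], a shift makes [E1 = 0]. Otherwise the shift 0 works
    unless [F] lies in the span of [P] and [E], and then [d = 1] moves [F] off the span of [P] and
    [E1]. *)
Lemma bracket_pair_maximal : in_cl M e.
Proof.
have [[p [q Epq]]|nE] := pselect (exists p q, E = p *: P + q *: Q).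
  have Ez : E + - p *: P + - q *: Q = 0 by rewrite Epq; module_ring; ring.
  apply: (@shifted_maximal (- q) (- p)); rewrite Ez => x y.
  - by rewrite scaler0 add0r; exact: PQ_indep.
  - by rewrite scaler0 addr0; exact: QP_indep.
  - by rewrite scaler0 addr0; exact: FP_indep.
have nE' (k x y : R) : k != 0 -> k *: E <> x *: P + y *: Q.
  move=> k0 kE; apply: nE; exists (x / k), (y / k); apply: (scalerI k0).
  by rewrite kE; module_ring; field.
have c1 (d x y : R) : P <> x *: (E + 0 *: P + d *: Q) + y *: Q.
  have [x0|x0] := eqVneq x 0; first by rewrite x0 (scale0r (_ + _)) add0r; exact: PQ_indep.
  move=> PE; apply: (nE' x 1 (- (x * d) - y) x0).
  by rewrite {1}PE; module_ring; ring.
have c2 (d x y : R) : Q <> x *: P + y *: (E + 0 *: P + d *: Q).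
  have [y0|y0] := eqVneq y 0; first by rewrite y0 (scale0r (_ + _)) addr0; exact: QP_indep.
  move=> QE; apply: (nE' y (- x) (1 - y * d) y0).
  have -> : y *: E = (x *: P + y *: (E + 0 *: P + d *: Q)) - x *: P - (y * d) *: Q.
    by module_ring; ring.
  by rewrite -QE; module_ring; ring.
have [[x0 [y0 FE0]]|nF] := pselect (exists x y : R, F = x *: P + y *: E); last first.
  apply: (@shifted_maximal 0 0) => [||x y FE]; [exact: c1|exact: c2|].
  by apply: nF; exists x, y; rewrite FE; module_ring; ring.
apply: (@shifted_maximal 1 0) => [||x y FE]; [exact: c1|exact: c2|].
have D : (y0 - y) *: E = (x - x0) *: P + y *: Q.
  have : F - F = 0 by rewrite subrr.
  rewrite {1}FE0 FE => D0.
  rewrite -[RHS]addr0 -D0; module_ring; ring.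
have [yy|yy] := eqVneq (y0 - y) 0; last exact: nE' yy D.
have y0n : y0 != 0.
  by apply/eqP => y00; move: FE0; rewrite y00 scale0r addr0; exact: FP_indep.
have yE : y = y0 by lra.
apply: (QP_indep (x := (x0 - x) / y0)); apply: (scalerI y0n).
move: D; rewrite yy scale0r yE => D.
rewrite -[LHS]subr0 D; module_ring; field.
by [].
Qed.
End BracketPair.

(** * The kernel of the linear form is a codimension one abelian ideal *)

Section Structure.
Variables (e : g) (mu : g -> R).
Hypothesis be : ~ in_cl M e.
Hypothesis mul : scalar mu.
Hypothesis mue : mu e = 1.
Hypothesis muE : forall x, lie x (lie e x) = mu x *: lie e (lie e x).
Variable k0 : g.
Hypothesis k0K : mu k0 = 0.
Hypothesis k0N : lie e (lie e k0) != 0.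

Let N x := lie e x.

Let muD x y : mu (x + y) = mu x + mu y. Proof. exact: scalar_funD. Qed.
Let muZ a x : mu (a *: x) = a * mu x. Proof. exact: scalar_funZ. Qed.
Let muN x : mu (- x) = - mu x. Proof. exact: scalar_funN. Qed.

Let muker x : mu (x - mu x *: e) = 0.
Proof. by rewrite muD muN muZ mue mulr1 subrr. Qed.

Let KN u : mu u = 0 -> lie u (N u) = 0.
Proof. by move=> h; rewrite muE h scale0r. Qed.

Let KNpol u w : mu u = 0 -> mu w = 0 -> lie u (N w) = - lie w (N u).
Proof.
move=> hu hw; apply/eqP; rewrite -addr_eq0; apply/eqP.
have : lie (u + w) (N (u + w)) = 0 by apply: KN; rewrite muD hu hw addr0.
by rewrite /N !(lieDr, lieDl) -!/(N _) !KN// add0r addr0.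
Qed.

(** The point [e + s *: k] stays off the closure and has its own linear form [nu]. Its multiplier
    [nu u / s] equals the coefficient [m] of [lie k (lie k u)] along [N (N k)], hence is independent
    of [s]; comparing powers of [s] gives [m ^+ 2 = 0] and then the claim. *)
Let K_engel_generic u k : mu u = 0 -> mu k = 0 -> N (N k) != 0 ->
  lie u (lie k u) = 0.
Proof.
move=> hu hk Nk.
have [d d0 hd] := not_in_cl_near k 0 be.
have kN0 : lie k (N k) = 0 by exact: KN.
have step s : s != 0 -> `|s| < d -> exists m : R,
   lie k (lie k u) = m *: N (N k) /\
   lie u (lie k u) = m *: (N (N u) + s *: (N (lie k u) + lie k (N u)) + s ^+ 2 *: lie k (lie k u)).
  move=> s0 sd; have [v vE] : exists v, v = e + s *: k by exists (e + s *: k).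
  have bv : ~ in_cl M v by have := hd s sd; rewrite scaler0 addr0 -vE.
  have vk : lie v k = N k by rewrite vE lieDl lieZl lie_alt scaler0 addr0.
  have vvk : lie v (lie v k) = N (N k).
    by rewrite vk vE lieDl lieZl kN0 scaler0 addr0.
  have vkN : lie v (lie v k) != 0 by rewrite vvk.
  have [nu [nul nuE]] := engel_linear (fun x => engel_relation hg x bv) vkN.
  have nuk : nu k = 0.
    have /esym/eqP := nuE k; rewrite vk kN0 -vk vvk.
    by rewrite scaler_eq0 (negbTE Nk) orbF => /eqP.
  exists (nu u / s).
  have vu : lie v u = N u + s *: lie k u by rewrite vE lieDl lieZl.
  have E1 : lie u (lie v u) = s *: lie u (lie k u).
    by rewrite vu lieDr lieZr KN// add0r.
  have := nuE (k + u); rewrite (scalar_funD _ _ nul) nuk add0r.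
  rewrite [lie v (k + u)]lieDr vk !lieDl !lieDr kN0 nuE -[in lie v (N k)]vk vvk scalerDr.
  move=> /eqP; rewrite add0r addrA (inj_eq (addIr _)) vu lieDr lieZr => /eqP E2.
  have E3 : s *: lie k (lie k u) = nu u *: N (N k).
    by rewrite -E2 (KNpol hk hu) addrAC addNr add0r.
  split.
    by apply: (scalerI s0); rewrite E3 scalerA mulrCA divff// mulr1.
  apply: (scalerI s0); rewrite -E1 nuE scalerA mulrCA divff// mulr1; congr (_ *: _).
  by rewrite vu vE lieDl !lieDr !lieZl !lieZr; module_ring; ring.
have [chi [chil chi1 _]] := separating_form (U := 0%VS) (x := N (N k)) ltac:(by rewrite memv0).
pose m := chi (lie k (lie k u)).
have stepm s : s != 0 -> `|s| < d -> lie k (lie k u) = m *: N (N k) /\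
   lie u (lie k u) = m *: (N (N u) + s *: (N (lie k u) + lie k (N u)) + s ^+ 2 *: lie k (lie k u)).
  move=> s0 sd; have [c [c1 c2]] := step s s0 sd.
  by have -> : m = c by rewrite /m c1 scalar_funZ// chi1 mulr1.
have [E1 _ E3] := @quadratic_path_eq0 _ _ d (lie u (lie k u) - m *: N (N u))
  (- m *: (N (lie k u) + lie k (N u))) (- m *: lie k (lie k u)) d0
  (fun t t0 td => ltac:(by rewrite (stepm t t0 td).2; module_ring; ring)).
have d2 : d / 2 != 0 by rewrite mulf_neq0 ?invr_neq0 ?gt_eqF.
have kk : lie k (lie k u) = m *: N (N k).
  apply: (stepm (d / 2) d2 _).1; rewrite gtr0_norm ?divr_gt0//; lra.
have m0 : m = 0.
  move: E3; rewrite kk scalerA => /eqP; rewrite scaler_eq0 (negbTE Nk) orbF.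
  by rewrite mulNr oppr_eq0 mulf_eq0 orbb => /eqP.
by move: E1; rewrite m0 scale0r subr0.
Qed.

Let K_engel u k : mu u = 0 -> mu k = 0 -> lie u (lie k u) = 0.
Proof.
move=> hu hk; have [Nk|] := eqVneq (N (N k)) 0; last exact: K_engel_generic.
have -> : k = (k + k0) - k0 by rewrite addrK.
have hkk : mu (k + k0) = 0 by rewrite muD hk k0K addr0.
rewrite lieBl lieBr !K_engel_generic ?subr0//.
by rewrite /N !lieDr -!/(N _) Nk add0r.
Qed.

Let kernel_exists : exists K : {vspace g}, (forall x, (x \in K) = (mu x == 0)) /\
  \dim {: g} = (\dim K).+1.
Proof.
have [F FE] : exists F : 'End(g), forall x, F x = mu x *: e.
  by apply: linear_end_exists => a x y; rewrite mul scalerDl scalerA.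
have e0 : e != 0.
  apply/eqP => e0; move: mue; rewrite e0 (scalar_fun0 mul) => /eqP.
  by rewrite eq_sym oner_eq0.
exists (lker F); split=> [x|].
  by rewrite memv_ker FE scaler_eq0 (negbTE e0) orbF.
have := limg_ker_dim F fullv; rewrite capfv.
have -> : (F @: fullv)%VS = <[e]>%VS.
  apply/eqP; rewrite eqEsubv; apply/andP; split.
    by apply/subvP => _ /memv_imgP[x _ ->]; rewrite FE memvZ// memv_line.
  by rewrite -memvE; apply/memv_imgP; exists e; rewrite ?memvf// FE mue scale1r.
by rewrite dim_vline e0 addn1.
Qed.

Let K_two_step u k w : mu u = 0 -> mu k = 0 -> mu w = 0 -> lie u (lie k w) = 0.
Proof.
have [K [KP _]] := kernel_exists => hu hk hw.
apply: (@engel_two_step K); rewrite ?KP ?hu ?hk ?hw// => x y.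
by rewrite !KP => /eqP hx /eqP hy; exact: K_engel.
Qed.

(** If [mu] were nonzero at [y = lie k w], then [y], which commutes with the kernel, would commute
    with [e] too and be central. Adding it to [k0] then changes [mu] but none of the brackets in
    [muE]. *)
Let K_lie k w : mu k = 0 -> mu w = 0 -> mu (lie k w) = 0.
Proof.
move=> hk hw; set y := lie k w; apply/eqP; apply: contraT => y0.
have yK u : mu u = 0 -> lie u y = 0 by move=> hu; exact: K_two_step.
have ye : lie e y = 0.
  have := yK (y - mu y *: e) (muker y); rewrite lieBl lie_alt lieZl sub0r => /eqP.
  by rewrite oppr_eq0 scaler_eq0 (negbTE y0) => /eqP.
have yx x : lie y x = 0.
  rewrite lieC -[x](subrK (mu x *: e)) lieDl lieZl ye scaler0 addr0 yK ?oppr0//.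
have Nk : lie e (k0 + y) = lie e k0 by rewrite lieDr ye addr0.
have := muE (k0 + y); rewrite Nk lieDl yx addr0 muE muD k0K add0r scale0r.
by move=> /esym/eqP; rewrite scaler_eq0 (negbTE y0) (negbTE k0N).
Qed.

(** For [u] in the kernel, [mu (lie u z) = c * mu z], and [c = 0] because [lie u] is nilpotent. *)
Let mu_lie x y : mu (lie x y) = 0.
Proof.
have h u : mu u = 0 -> mu (lie u e) = 0.
  move=> hu; set c := mu (lie u e).
  have hc z : mu (lie u z) = c * mu z.
    by rewrite -{1}[z](subrK (mu z *: e)) lieDr lieZr muD muZ (K_lie hu (muker z)) add0r mulrC.
  have [k hk] := iter_lie_nilpotent hg.
  have : mu (iter k (lie u) e) = c ^+ k.
    by elim: k {hk} => [|k IH] /=; rewrite ?hc ?IH ?exprS.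
  by rewrite hk (scalar_fun0 mul) => /esym/eqP; rewrite expf_eq0 => /andP[_ /eqP].
have split z : exists c a, z = a + c *: e /\ mu a = 0.
  by exists (mu z), (z - mu z *: e); rewrite subrK.
have [c [a [-> ha]]] := split x; have [d [b [-> hb]]] := split y.
rewrite !(lieDr, lieDl, lieZr, lieZl) lie_alt scaler0 !(muD, muZ) (K_lie ha hb) (h a ha).
by rewrite (lieC e b) muN (h b hb) (scalar_fun0 mul); ring.
Qed.

Let NlieC u w : mu u = 0 -> mu w = 0 -> lie u (N w) = lie (N u) w.
Proof. by move=> hu hw; rewrite KNpol// -lieC. Qed.

(** The Jacobi identity, with [lie u (N w) = lie (N u) w] on the kernel. *)
Let N_lie u w : mu u = 0 -> mu w = 0 -> N (lie u w) = 2 *: lie u (N w).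
Proof.
move=> hu hw; have := lie_jacobi e u w.
rewrite -!/(N _) (lieC w e) (lieC w (lie e u)) lieNr -!/(N _) -/(N u) -NlieC//.
rewrite -addrA -opprD => /eqP; rewrite subr_eq0 => /eqP ->.
by module_ring; ring.
Qed.
Lemma codim1_of_bad : exists a : {vspace g}, codim1_abelian_ideal a.
Proof.
have [K [KP Kd]] := kernel_exists; exists K; split=> //.
  by apply/liev_subP => u w _ _; rewrite KP mu_lie.
apply/eqP; rewrite -subv0; apply/liev_subP => b0 h0; rewrite !KP memv0.
move=> /eqP hb0 /eqP hh0; apply: contraT => Q0; exfalso.
have [b [hb Nb bh0]] : exists b, [/\ mu b = 0, N (N b) != 0 & lie b h0 != 0].
  have [Nb|Nb] := eqVneq (N (N b0)) 0; last by exists b0.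
  have [kh|kh] := eqVneq (lie k0 h0) 0; last by exists k0.
  exists (b0 + k0); split; first by rewrite muD hb0 k0K addr0.
    by rewrite /N !lieDr -!/(N _) Nb add0r.
  by rewrite lieDl kh addr0.
have muN0 j : mu (iter j N h0) = 0 by case: j => [|j] //=; exact: mu_lie.
have ex : exists j, lie b (iter j N h0) == 0.
  by have [k hk] := iter_lie_nilpotent hg; exists k; rewrite hk lie0r.
case: (ex_minnP ex) => [[|i] /eqP i0 imin].
  by rewrite /= in i0; rewrite i0 eqxx in bh0.
(* The last iterate that does not commute with [b]: then [lie b (N h) = 0], and [N_lie] gives
   [N (lie b h) = 0]. *)
pose h := iter i N h0; have hh : mu h = 0 by exact: muN0.
have Qn : lie b h != 0 by apply/negP => /imin; rewrite ltnn.
have bNh : lie b (N h) = 0 by rewrite -[N h]iterS.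
have eQ : N (lie b h) = 0 by rewrite N_lie// bNh scaler0.
have two u w : mu u = 0 -> mu w = 0 -> N (lie u w) = 0 -> lie u (N w) = 0.
  move=> hu hw; rewrite N_lie// => /eqP; rewrite scaler_eq0 pnatr_eq0/= => /eqP //.
have hNb : lie h (N b) = 0 by rewrite KNpol// bNh oppr0.
apply: be; apply: (@bracket_pair_maximal e b h mu) => //.
- by rewrite -/(N b) KN.
- by apply: K_two_step.
- by rewrite -/(N b) -/(N (N b)) NlieC ?mu_lie// lie_alt.
- by apply: K_two_step.
- by rewrite -/(N h) KN.
- rewrite -/(N b) -/(N (N b)) KNpol ?mu_lie// -NlieC ?mu_lie//.
  have -> : lie b (N (N h)) = 2^-1 *: N (lie b (N h)).
    by rewrite N_lie ?mu_lie// scalerA mulVf// scale1r.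
  by rewrite bNh /N lie0r scaler0 oppr0.
Qed.
End Structure.

Lemma maximal_generic x : ~ two_step_nilpotent g ->
  ~ (exists a : {vspace g}, codim1_abelian_ideal a) -> in_cl M x.
Proof.
move=> n2 n1; apply: contrapT => bx; apply: n1.
have [e [u [be eu]]] := bad_engel_neq0 bx n2.
have [mu [mul mue muE]] := bad_engel be eu.
apply: (@codim1_of_bad e mu be mul mue muE (u - mu u *: e)).
  rewrite (scalar_funD _ _ mul) -scaleNr (scalar_funZ _ _ mul) mue; ring.
by rewrite lieBr lieZr lie_alt scaler0 subr0.
Qed.
End GenericPoints.

(** * Ricci-maximal points confined to a subspace *)

Section ProjectiveSubspaces.
Variables (R : realType) (V : vectType R).

Lemma proj_piP (u : projective V) : exists x (x0 : x != 0), u = proj_pi x0.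
Proof.
have x0 : vpick (pline u) != 0.
  rewrite vpick0 -dimv_eq0; case: u => U /= /eqP ->//.
exists (vpick (pline u)), x0; apply: val_inj; apply/eqP => /=.
rewrite eq_sym eqEdim -memvE memv_pick dim_vline x0.
by case: u {x0} => U /= /eqP ->.
Qed.

(** Membership in [L] is the vanishing of the continuous function [G], the squared coordinate length
    of a vector minus its projection to [L]. *)
Lemma closed_proj_sub (L : {vspace V}) : closed (proj_sub L).
Proof.
rewrite -[proj_sub L]setCK; apply: open_closedC.
rewrite -[open _]/(Defs.proj_open _) /Defs.proj_open.
pose G (x : 'rV[R]_(\dim {: V})) :=
  \sum_j ((x - rVof (vbasis {: V}) (projv L (vecof (vbasis {: V}) x))) 0 j) ^+ 2.
have GE x : (vecof (vbasis {: V}) x \in L) <-> G x = 0.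
  have -> : (vecof (vbasis {: V}) x \in L) <->
     (x - rVof (vbasis {: V}) (projv L (vecof (vbasis {: V}) x)) = 0).
    split=> [h|/eqP]; first by rewrite projv_id// vecofK ?vbasisP// subrr.
    rewrite subr_eq0 => /eqP ->; rewrite rVofK ?vbasisP//; exact: memv_proj.
  split=> [e0|G0]; first by rewrite /G e0 big1// => j _; rewrite mxE expr0n.
  apply/rowP => j; rewrite [RHS]mxE; apply/eqP; rewrite -sqrf_eq0; apply/eqP.
  by have /psumr_eq0P -> // := G0; move=> i _; exact: sqr_ge0.
have cG : continuous G.
  apply: continuous_bigsum => j; apply: continuous_pow.
  pose P := mxof (vbasis {: V}) (vbasis {: V}) (projv L).
  have -> : (fun x => (x - rVof (vbasis {: V}) (projv L (vecof (vbasis {: V}) x))) 0 j) =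
      (fun x : 'rV[R]_(\dim {: V}) => x 0 j - \sum_i x 0 i * P i j).
    by apply/funext => x; rewrite -mul_mxof !mxE.
  apply: continuous_sub; first exact: continuous_coord.
  by apply: continuous_bigsum => i; apply: continuous_mul;
    [exact: continuous_coord|exact: cst_continuous].
suff -> : [set x : 'rV[R]_(\dim {: V}) | exists v0 : vecof (vbasis {: V}) x != 0,
    (~` proj_sub L) (proj_pi v0)] = ~` [set x | G x = 0].
  by apply: closed_openC; exact: closed_eq0.
apply/seteqP; split=> x /=.
  by move=> [x0 xL] /GE h; apply: xL; rewrite /proj_sub/= -memvE.
move=> xL; have x0 : vecof (vbasis {: V}) x != 0.
  by apply: contra_notN xL => /eqP x0; apply/GE; rewrite x0 mem0v.
by exists x0; rewrite /proj_sub/= -memvE => /GE.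
Qed.

Lemma closure_proj_sub (Q : set (projective V)) (L : {vspace V}) :
  (forall x (x0 : x != 0), Q (proj_pi x0) -> x \in L) ->
  (forall x, x \in L -> in_cl Q x) -> closure Q = proj_sub L.
Proof.
move=> h1 h2; apply/seteqP; split.
  rewrite [X in _ `<=` X]((closure_id _).1 (@closed_proj_sub L)); apply: closureS => u.
  have [x [x0 ->]] := proj_piP u; rewrite /proj_sub/= -memvE; exact: h1.
move=> u; have [x [x0 ->]] := proj_piP u; rewrite /proj_sub/= -memvE => /h2; exact.
Qed.
End ProjectiveSubspaces.

Lemma dot_exists (R : realType) (V : vectType R) :
  exists dot : {dot V for (@idfun R)}, True.
Proof.
pose e := vbasis {: V}.
have [|x|i|dot _] := @weighted_dot_exists R V 'I_(\dim {: V}) (tnth e) (coord e) _ _ (fun=> 1).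
- by move=> i a u v; rewrite linearP.
- rewrite {1}(coord_vbasis (memvf x)); apply: eq_bigr => i _.
  by rewrite (tnth_nth 0).
- exact: ltr01.
- by exists dot.
Qed.

Section MaximalSubspaces.
Variables (R : realType) (g : lieAlgType R).
Hypothesis hg : lie_nilpotent g.
Notation M := (ricci_maximal g).
Implicit Types (dot : {dot g for (@idfun R)}).

Lemma dotZr dot a x y : dot x (a *: y) = a * dot x y.
Proof. by rewrite dotC dotZl dotC. Qed.

Lemma dnorm_gt0 dot (v : g) : v != 0 -> 0 < dot v v.
Proof. exact: neq0_dnorm_gt0. Qed.

Lemma ricci_in_central dot (v : g) : (forall x, lie v x = 0) ->
  ricci_form dot v v =
  4^-1 * (\sum_(i <- onb dot) \sum_(j <- onb dot) dot (lie i j) v ^+ 2).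
Proof.
move=> hv; rewrite /ricci_form /ricci_in [X in _ - _ * X]big1 => [|i _]; last first.
  by rewrite hv (scalar_fun0 (dot_linearl dot _)).
by rewrite mulr0 subr0; congr (_ * _); apply: eq_bigr => i _; apply: eq_bigr => j _; rewrite expr2.
Qed.

Lemma central_exists (x : g) : x != 0 ->
  exists v : g, v != 0 /\ forall x, lie v x = 0.
Proof.
move=> x0; have [k hk] := hg.
have ex : exists k, iter k (liev fullv) (fullv : {vspace g}) == 0%VS by exists k; rewrite hk.
case: (ex_minnP ex) => [[|j] /eqP j0 jmin].
  by move: x0; rewrite -memv0 -j0 memvf.
have Cn : iter j (liev fullv) (fullv : {vspace g}) != 0%VS.
  by apply/negP => /jmin; rewrite ltnn.
exists (vpick (iter j (liev fullv) fullv)); rewrite vpick0; split=> // y.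
rewrite lieC; apply/eqP; rewrite oppr_eq0 -memv0 -j0 /=.
by apply: mem_liev; rewrite ?memvf ?memv_pick.
Qed.

(** * Algebras with a codimension one abelian ideal *)

Section CodimensionOne.
Variable a : {vspace g}.
Hypothesis ha : codim1_abelian_ideal a.
Hypothesis n2 : ~ two_step_nilpotent g.

Let transversal : exists (e : g) (chi : g -> R), [/\ scalar chi, chi e = 1,
  forall x, x \in a -> chi x = 0 & forall x, x - chi x *: e \in a].
Proof.
have [_ _ da] := ha.
have [e ea] : exists e, e \notin a.
  apply/not_existsP => h; have : (fullv <= a)%VS.
    by apply/subvP => v _; have /negP := h v; rewrite negbK.
  by move=> /dimvS; rewrite da ltnn.
have [chi [chil chie chia]] := separating_form ea.
exists e, chi; split=> // x.
have e0 : e != 0 by apply: contraNneq ea => ->; rewrite mem0v.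
have full : (a + <[e]>)%VS = fullv.
  apply/eqP; rewrite eqEdim subvf/= da.
  have := dimv_sum_cap a <[e]>; rewrite dim_vline e0.
  suff -> : (a :&: <[e]>)%VS = 0%VS by rewrite dimv0 addn0 => ->; rewrite addn1.
  apply/eqP; rewrite -subv0; apply/subvP => y; rewrite memv_cap memv0 => /andP[ya].
  move=> /vlineP[k ye]; move: ya; rewrite ye; have [->|k0] := eqVneq k 0.
    by rewrite scale0r.
  by move=> /(memvZ k^-1); rewrite scalerA mulVf// scale1r (negbTE ea).
have : x \in (a + <[e]>)%VS by rewrite full memvf.
move=> /memv_addP[y ya [_ /vlineP[k ->] ->]].
by rewrite (scalar_funD _ _ chil) (scalar_funZ _ _ chil) chie mulr1 chia// add0r addrK.
Qed.

Let abel x y : x \in a -> y \in a -> lie x y = 0.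
Proof. by have [_ aa _] := ha => xa ya; apply/eqP; rewrite -memv0 -aa mem_liev. Qed.

Let ideal x y : y \in a -> lie x y \in a.
Proof. by have [/subvP h _ _] := ha => ya; apply: h; rewrite mem_liev ?memvf. Qed.

(** The metric normal [n] of [a] is an eigenvector with negative eigenvalue: brackets lie in [a], so
    the positive term of the Ricci form vanishes at [n], and [n] is Ricci-orthogonal to [a]. A
    central vector shows that the maximal eigenvalue is nonnegative, so its eigenvectors have no
    component along [n]. *)
Lemma maximal_in_codim1 x (x0 : x != 0) : M (proj_pi x0) -> x \in a.
Proof.
have [e [chi [chil chie chia chix]]] := transversal.
move=> /ricci_maximal_elim[dot [y [l [y0 xy Hy hl]]]].
suff ya : y \in a.
  move: xy; rewrite /= => /vlineP[k yk].
  have k0 : k != 0 by apply: contraNneq y0 => k0; rewrite yk k0 scale0r.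
  by rewrite -[x]scale1r -(mulVf k0) -scalerA -yk memvZ.
have ob := onbP dot.
pose n := \sum_(i <- onb dot) chi i *: i.
have nE z : dot n z = chi z.
  rewrite /n (scalar_sum _ _ (dot_linearl dot z)) [in RHS](onb_expand z ob).
  by rewrite (scalar_sum _ _ chil); apply: eq_bigr => i _; rewrite mulrC (dotC dot z).
have n0 : n != 0.
  by apply/eqP => n0; have := nE e; rewrite n0 (scalar_fun0 (dot_linearl dot e)) chie => /eqP; rewrite eq_sym oner_eq0.
have nn : 0 < dot n n by exact: neq0_dnorm_gt0.
have brk u v : lie u v \in a.
  have sp z : exists c z', z = z' + c *: e /\ z' \in a.
    by exists (chi z), (z - chi z *: e); rewrite subrK.
  have [c [u' [-> ua]]] := sp u; have [d [v' [-> va]]] := sp v.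
  rewrite !(lieDl, lieDr, lieZl, lieZr) lie_alt !scaler0 addr0.
  by rewrite (lieC u' e) !memvD// ?memvZ ?memvN ?ideal.
have l0 : 0 <= l.
  have [v [v0 hv]] := central_exists x0.
  have := hl v; rewrite (ricci_in_central dot hv) => h.
  rewrite -(pmulr_lge0 _ (dnorm_gt0 dot v0)); apply: le_trans h.
  by rewrite mulr_ge0 ?invr_ge0// sumr_ge0// => i _; rewrite sumr_ge0// => j _; exact: sqr_ge0.
have Qn w : ricci_form dot n w = - 2^-1 * (\sum_(i <- onb dot) dot (lie n i) (lie w i)).
  rewrite /ricci_form /ricci_in big1 => [|i _]; first by rewrite mulr0 sub0r mulNr.
  by rewrite big1// => j _; rewrite (dotC _ _ n) nE chia// mul0r.
have nlie w : w \in a -> ricci_form dot n w = 0.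
  move=> wa; rewrite Qn.
  (* Since [a] is abelian, [lie w i = chi i *: lie w e], and the sum collapses to a multiple of
     [lie n n]. *)
  have -> : \sum_(i <- onb dot) dot (lie n i) (lie w i) =
      dot (lie n (\sum_(i <- onb dot) chi i *: i)) (lie w e).
    rewrite lie_sumr linear_sumlz; apply: eq_bigr => i _.
    rewrite lieZr /= dotZl -dotZr -lieZr; congr (dot _ _).
    by rewrite -[in LHS](subrK (chi i *: e) i) lieDr abel ?add0r.
  by rewrite -/n lie_alt (scalar_fun0 (dot_linearl dot _)) mulr0.
have chin : chi n = dot n n by rewrite nE.
have chin0 : chi n != 0 by rewrite chin gt_eqF.
have xE z : exists c w, [/\ w \in a, z = c *: n + w & chi z = c * chi n].
  exists (chi z / chi n), (z - (chi z / chi n) *: n); split.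
  - have hz : chi (z - (chi z / chi n) *: n) = 0.
      by rewrite (scalar_funD _ _ chil) (scalar_funN _ chil) (scalar_funZ _ _ chil) divfK// subrr.
    by have := chix (z - (chi z / chi n) *: n); rewrite hz scale0r subr0.
  - by rewrite addrC subrK.
  - by rewrite divfK.
(* If it were zero, [n] would be central and the algebra, spanned by [n] and [a], abelian. *)
have Qnn : ricci_form dot n n < 0.
  rewrite Qn mulNr oppr_lt0; apply: mulr_gt0; first by rewrite invr_gt0.
  rewrite lt_def; have h0 i : 0 <= dot (lie n i) (lie n i).
    by have [->|h] := eqVneq (lie n i) 0; [rewrite (scalar_fun0 (dot_linearl dot 0))|
      exact/ltW/neq0_dnorm_gt0].
  rewrite sumr_ge0 ?andbT//; apply/eqP => s0; apply: n2; apply/two_stepP => u v w.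
  have ni i : i \in onb dot -> lie n i = 0.
    move=> ii; apply/eqP; apply: contraT => nz.
    move/eqP: s0; rewrite psumr_eq0// => /allP/(_ _ ii)/=.
    by rewrite gt_eqF// neq0_dnorm_gt0.
  have nz z : lie n z = 0.
    rewrite (onb_expand z ob) lie_sumr big_seq big1// => i ii.
    by rewrite lieZr ni// scaler0.
  suff -> : lie v w = 0 by rewrite lie0r.
  have [c [v' [va -> _]]] := xE v; have [d [w' [wa -> _]]] := xE w.
  by rewrite !(lieDl, lieDr, lieZl, lieZr) !nz (abel va wa) (lieC v' n) nz
    oppr0 !scaler0 !addr0.
have [c [w [wa yE chiy]]] := xE y.
have : l * chi y = c * ricci_form dot n n.
  rewrite -nE dotC -dotZl -Hy ricci_opP {1}yE.
  by rewrite ricci_form_linearl (ricci_formC dot w) (nlie w wa) addr0.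
have [c0|c0] := eqVneq c 0; first by rewrite yE c0 scale0r add0r.
rewrite chiy mulrCA => /(mulfI c0) h; move: Qnn; rewrite -h ltNge mulr_ge0//.
by rewrite chin ltW.
Qed.

(** For [v] in [a] off the closure, [engel_relation] with [u = e] forces [lie e (lie e v) = 0], as
    [lie v (lie v e) = 0]. The vectors of [a] violating this are dense in [a], since the algebra is
    not two-step nilpotent. *)
Lemma codim1_in_maximal x : x \in a -> in_cl M x.
Proof.
move=> xa; have [e [chi [chil chie chia chix]]] := transversal.
have sp z : exists c z', z = z' + c *: e /\ z' \in a.
  by exists (chi z), (z - chi z *: e); rewrite subrK.
have good v : v \in a -> lie e (lie e v) != 0 -> in_cl M v.
  move=> va ev; apply: contrapT => bv; have [k] := engel_relation hg e bv.
  rewrite [lie v (lie v e)]abel//; last by rewrite lieC memvN ideal.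
  rewrite scaler0 (lieC v e) lieNr => /eqP; rewrite oppr_eq0 => /eqP h.
  by rewrite h eqxx in ev.
have [k [ka ke]] : exists k, k \in a /\ lie e (lie e k) != 0.
  apply: contrapT => /forallNP nk; apply: n2; apply/two_stepP => u v w.
  have h y : y \in a -> lie e (lie e y) = 0.
    by move=> ya; apply/eqP; apply: contraT => yn; exfalso; apply: (nk y).
  have [c [u' [-> ua]]] := sp u; have [d [v' [-> va]]] := sp v.
  have [f [w' [-> wa]]] := sp w.
  rewrite !(lieDl, lieDr, lieZl, lieZr) lie_alt (abel va wa) (lieC v' e).
  rewrite !(lieNr, scaler0, addr0, add0r, lie0r) !h// !(abel ua) ?ideal//.
  by rewrite !(oppr0, scaler0, addr0).
have [xe|] := eqVneq (lie e (lie e x)) 0; last exact: good.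
apply: (@in_cl_path _ _ _ x k 0 1) => // s /andP[s0 _].
rewrite scaler0 addr0; apply: good; first by rewrite memvD// memvZ.
by rewrite !lieDr !lieZr xe add0r scaler_eq0 (negbTE ke) orbF gt_eqF.
Qed.
End CodimensionOne.

(** * Two-step nilpotent algebras *)

Section TwoStep.
Hypothesis h2 : two_step_nilpotent g.
Hypothesis d0 : derived_lie g <> 0%VS.

Let form_kernel (chi : g -> R) : scalar chi -> exists K : {vspace g},
  forall x, (x \in K) = (chi x == 0).
Proof.
move=> cl; have [e e0] : exists e : g, e != 0.
  apply: contrapT => /forallNP h; apply: d0; apply/eqP; rewrite -subv0.
  by apply/subvP => x _; rewrite memv0; apply: contraT => x0; case: (h x).
have [F FE] : exists F : 'End(g), forall x, F x = chi x *: e.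
  by apply: linear_end_exists => k x y; rewrite cl scalerDl scalerA.
by exists (lker F) => x; rewrite memv_ker FE scaler_eq0 (negbTE e0) orbF.
Qed.

Let derived_form (chi : g -> R) : scalar chi ->
  (forall x y, chi (lie x y) = 0) -> forall w, w \in derived_lie g -> chi w = 0.
Proof.
move=> cl h w wd; have [K KP] := form_kernel cl; apply/eqP; rewrite -KP.
by apply: subvP wd; apply/liev_subP => x y _ _; rewrite KP h.
Qed.

Let derived_central w x : w \in derived_lie g -> lie x w = 0.
Proof.
move=> wd; apply/eqP; rewrite -memv0.
by have := h2; rewrite /two_step_nilpotent => <-; rewrite mem_liev ?memvf.
Qed.

Let mem_derived x y : lie x y \in derived_lie g.
Proof. by rewrite mem_liev ?memvf. Qed.

(** In [l *: y = p + u] the part [p], from the positive term of the Ricci form, is a combination of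
    brackets, hence central, so [lie u = l *: lie y]. Pairing [u] with itself gives [- l / 2] times
    a sum of squares, so [u = 0]. Here [l > 0] because the Ricci form is positive on nonzero vectors
    of the derived algebra. *)
Lemma maximal_in_derived x (x0 : x != 0) : M (proj_pi x0) -> x \in derived_lie g.
Proof.
move=> /ricci_maximal_elim[dot [y [l [y0 xy Hy hl]]]].
suff ya : y \in derived_lie g.
  move: xy; rewrite /= => /vlineP[k yk].
  have k0 : k != 0 by apply: contraNneq y0 => k0; rewrite yk k0 scale0r.
  by rewrite -[x]scale1r -(mulVf k0) -scalerA -yk memvZ.
have ob := onbP dot.
have dot_ge0 v : 0 <= dot v v.
  by have [->|h] := eqVneq v 0; [rewrite (scalar_fun0 (dot_linearl dot 0))|
    exact/ltW/neq0_dnorm_gt0].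
have l0 : 0 < l.
  pose v := vpick (derived_lie g).
  have v0 : v != 0 by rewrite vpick0; apply/eqP.
  have hv z : lie v z = 0 by rewrite lieC derived_central ?oppr0// memv_pick.
  rewrite -(pmulr_lgt0 _ (dnorm_gt0 dot v0)); apply: lt_le_trans (hl v).
  rewrite (ricci_in_central dot hv) mulr_gt0 ?invr_gt0// lt_def.
  rewrite sumr_ge0 ?andbT => [|i _]; last by rewrite sumr_ge0// => j _; exact: sqr_ge0.
  apply/eqP => s0; move/eqP: s0; rewrite psumr_eq0 => [/allP s0|i _]; last first.
    by rewrite sumr_ge0// => j _; exact: sqr_ge0.
  have ij i j : i \in onb dot -> j \in onb dot -> dot (lie i j) v = 0.
    move=> ii jj; have /= := s0 i ii; rewrite psumr_eq0 => [/allP/(_ j jj)/=|k _]; last exact: sqr_ge0.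
    by rewrite sqrf_eq0 => /eqP.
  have lv u w : dot (lie u w) v = 0.
    rewrite (onb_expand u ob) (onb_expand w ob) lie_suml linear_sumlz big_seq big1// => i ii.
    rewrite lie_sumr linear_sumlz big_seq big1// => j jj.
    by rewrite lieZl lieZr /= !dotZl ij// !mulr0.
  have := @derived_form (dot^~ v) (dot_linearl dot v) lv v (memv_pick _).
  by move=> /eqP; rewrite gt_eqF// neq0_dnorm_gt0.
pose p := 4^-1 *: \sum_(i <- onb dot) \sum_(j <- onb dot) dot (lie i j) y *: lie i j.
have pd : p \in derived_lie g.
  by rewrite memvZ// memv_suml// => i _; rewrite memv_suml// => j _; rewrite memvZ.
pose u := l *: y - p.
have uE z : dot u z = - 2^-1 * \sum_(i <- onb dot) dot (lie y i) (lie z i).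
  rewrite /u linearBl/= dotZl -dotZl -Hy ricci_opP /p dotZl linear_sumlz.
  rewrite /ricci_form /ricci_in.
  have -> : \sum_(i <- onb dot) dot (\sum_(j <- onb dot) dot (lie i j) y *: lie i j) z =
     \sum_(i <- onb dot) \sum_(j <- onb dot) dot (lie i j) y * dot (lie i j) z.
    apply: eq_bigr => i _; rewrite linear_sumlz; apply: eq_bigr => j _; exact: dotZl.
  ring.
have ui i : lie u i = l *: lie y i.
  by rewrite /u lieBl lieZl (lieC p) (@derived_central p i pd) oppr0 subr0.
have u0 : u = 0.
  apply/eqP; apply: contraT => un; have := dnorm_gt0 dot un.
  rewrite uE mulNr oppr_gt0 ltNge mulr_ge0 ?invr_ge0// sumr_ge0// => i _.
  by rewrite ui dotZr mulr_ge0// ltW.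
have -> : y = l^-1 *: p.
  apply: (scalerI (a := l)); first by rewrite gt_eqF.
  by rewrite scalerA divff ?gt_eqF// scale1r; apply/eqP; rewrite -subr_eq0; apply/eqP.
by rewrite memvZ.
Qed.

(* [X] is the image of a form [th] on [derived_lie g] under the positive
   definite operator sum [v_i,v_j] (x) [v_i,v_j], the [v_i] spanning a
   complement; the degeneration of weights 2 and 4 then tends to [X]. *)
Lemma derived_in_maximal X : X \in derived_lie g -> in_cl M X.
Proof.
move=> Xd; have [->|X0] := eqVneq X 0; first by move=> x0; exfalso; rewrite eqxx in x0.
have [dot _] := dot_exists g.
set U := derived_lie g in Xd *; pose v := vbasis (U^C)%VS.
pose p := \dim (U^C)%VS; pose b (i j : 'I_p) := lie (tnth v i) (tnth v j).
have bU i j : b i j \in U by exact: mem_derived.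
have split x : exists k y, [/\ y \in U & x = \sum_(i < p) k i *: tnth v i + y].
  have : x \in (U + U^C)%VS by rewrite addv_complf memvf.
  move=> /memv_addP[y yU [w wC ->]]; exists (fun i => coord v i w), y; split=> //.
  rewrite addrC; congr (_ + _); rewrite {1}(coord_vbasis wC).
  by apply: eq_bigr => i _; rewrite (tnth_nth 0).
have brE (chi : g -> R) : scalar chi -> (forall i j, chi (b i j) = 0) ->
    forall w, w \in U -> chi w = 0.
  move=> cl h; apply: derived_form => // x y.
  have [k [x' [xU ->]]] := split x; have [l [y' [yU ->]]] := split y.
  rewrite lieDl (lieC x') !(derived_central _ xU) oppr0 addr0.
  rewrite lieDr (derived_central _ yU) addr0 lie_suml.
  under eq_bigr => i _ do rewrite lieZl.
  rewrite scalar_bigsum// big1// => i _; rewrite lie_sumr.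
  under eq_bigr => j _ do rewrite lieZr.
  rewrite scalar_bigsum// big1 ?mulr0// => j _.
  by rewrite -/(b i j) h mulr0.
have [A AE] : exists A : 'End(g), forall y, A y = \sum_i \sum_j dot (b i j) y *: b i j.
  apply: linear_end_exists => k x y; rewrite scaler_sumr -big_split/=.
  apply: eq_bigr => i _; rewrite scaler_sumr -big_split/=; apply: eq_bigr => j _.
  by rewrite dot_linearr scalerDl scalerA.
have dA y z : dot (A y) z = \sum_i \sum_j dot (b i j) y * dot (b i j) z.
  rewrite AE linear_sumlz; apply: eq_bigr => i _; rewrite linear_sumlz.
  by apply: eq_bigr => j _; exact: dotZl.
have Apos y : y \in U -> dot (A y) y = 0 -> y = 0.
  move=> yU; rewrite dA => /eqP.
  rewrite psumr_eq0 => [/allP h|i _]; last by rewrite sumr_ge0// => j _; rewrite -expr2 sqr_ge0.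
  have hij i j : dot (b i j) y = 0.
    have /= := h i (mem_index_enum i); rewrite psumr_eq0 => [/allP/(_ j (mem_index_enum j))/=|k _].
      by rewrite mulf_eq0 orbb => /eqP.
    by rewrite -expr2 sqr_ge0.
  apply/eqP; apply: contraT => y0; have := brE _ (dot_linearl dot y) hij y yU.
  by move=> /eqP; rewrite gt_eqF// dnorm_gt0.
have Ainj y : y \in U -> A y = 0 -> y = 0.
  by move=> yU Ay; apply: Apos => //; rewrite Ay (scalar_fun0 (dot_linearl dot y)).
have AU : (A @: U)%VS = U.
  apply/eqP; rewrite eqEdim; apply/andP; split.
    apply/subvP => _ /memv_imgP[y _ ->]; rewrite AE memv_suml// => i _.
    by rewrite memv_suml// => j _; rewrite memvZ.
  rewrite limg_dim_eq//; apply/eqP; rewrite -subv0; apply/subvP => y.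
  by rewrite memv_cap memv_ker memv0 => /andP[yU /eqP Ay]; apply/eqP; exact: Ainj.
have [y yU XE] : exists2 y, y \in U & X = A y by apply/memv_imgP; rewrite AU.
pose th x := dot (projv U x) y.
have thl : scalar th by move=> k x z; rewrite /th linearP dot_linearl.
have thU x : x \in U -> th x = dot x y by move=> xU; rewrite /th projv_id.
have thV i : th (tnth v i) = 0.
  rewrite /th; have -> : projv U (tnth v i) = 0.
    by apply/eqP; rewrite -memv_ker lker_proj vbasis_mem// mem_tnth.
  exact: (scalar_fun0 (dot_linearl dot y)).
have y0 : y != 0.
  by apply: contraNneq X0 => yz; rewrite XE yz linear0.
have thX : 0 < th X.
  rewrite thU// XE dA lt_def; apply/andP; split; last first.
    by rewrite sumr_ge0// => i _; rewrite sumr_ge0// => j _; rewrite -expr2 sqr_ge0.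
  rewrite -dA; apply: contra y0 => /eqP h; apply/eqP; exact: Apos.
have LE x : graded_ricci v (fun _ : 'I_1 => th) (fun=> 2%N) 4 x =
    (4^-1 * th x) *: X - 2^-1 *: \sum_k (\sum_i th (lie x (tnth v i)) *
      th (lie (tnth v k) (tnth v i))) *: tnth v k.
  rewrite /graded_ricci; congr (_ - _ *: _).
    rewrite -scalerA; congr (_ *: _); rewrite XE AE scaler_sumr.
    apply: eq_bigr => i _; rewrite scaler_sumr; apply: eq_bigr => k _.
    by rewrite big_ord1 mul1r scalerA mulrC (thU _ (bU i k)).
  apply: eq_bigr => k _; rewrite scaler_suml; apply: eq_bigr => i _.
  by rewrite big_ord1 mul1r.
pose w : g := (th X)^-1 *: X.
have thw : th w = 1 by rewrite scalar_funZ// mulVf// gt_eqF.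
apply: (@graded_maximal R g p 1 v (fun=> th) (fun=> w) (fun=> 2%N) 4 3 _ _ _ _ _ _ _ _ _ _ ord0) => //.
- exact: basis_free (vbasisP _).
- by move=> j k; rewrite thw !ord1 eqxx.
move=> x l x0; rewrite !LE => Hx.
have wv i : lie w (tnth v i) = 0.
  by rewrite lieZl lieC (derived_central _ Xd) oppr0 scaler0.
rewrite [X in _ - 2^-1 *: X]big1 => [|k _]; last first.
  by rewrite big1 ?scale0r// => i _; rewrite wv scalar_fun0// mul0r.
rewrite scaler0 subr0 thw mulr1 scalar_funZ// => hl.
have l0 : 0 < l by apply: lt_le_trans hl; rewrite mulr_gt0.
(* With [S k i = th (lie (tnth v k) (tnth v i))], the eigenvector equation reads
   [l N = - S^T S N / 2]; as [l > 0], this forces [N = 0] and leaves [x] on the line of [X]. *)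
pose N i := th (lie x (tnth v i)).
have NE i : l * N i = - 2^-1 * \sum_k (\sum_m N m * th (lie (tnth v k) (tnth v m))) *
    th (lie (tnth v k) (tnth v i)).
  rewrite -scalar_funZ// -lieZl -Hx lieBl !lieZl (lieC X) (derived_central _ Xd) oppr0 scaler0 sub0r.
  rewrite (scalar_funN _ thl) (scalar_funZ _ _ thl) mulNr; congr (- (_ * _)).
  rewrite lie_suml; under eq_bigr => k _ do rewrite lieZl.
  exact: scalar_bigsum.
have N2 : l * (\sum_i N i ^+ 2) <= 0.
  have -> : l * (\sum_i N i ^+ 2) =
      - 2^-1 * \sum_k (\sum_m N m * th (lie (tnth v k) (tnth v m))) ^+ 2.
    rewrite mulr_sumr; under eq_bigr => i _ do rewrite expr2 mulrA NE -mulrA mulr_suml.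
    rewrite -mulr_sumr exchange_big/=; congr (_ * _); apply: eq_bigr => k _.
    rewrite expr2 [in RHS]mulr_sumr; apply: eq_bigr => i _; ring.
  by rewrite mulNr oppr_le0 mulr_ge0// sumr_ge0// => k _; exact: sqr_ge0.
have N0 i : N i = 0.
  move: N2; rewrite pmulr_rle0// => N2.
  have /eqP : \sum_i N i ^+ 2 = 0.
    by apply: le_anti; rewrite N2 sumr_ge0// => k _; exact: sqr_ge0.
  rewrite psumr_eq0 => [/allP/(_ i (mem_index_enum i))/=|k _]; last exact: sqr_ge0.
  by rewrite sqrf_eq0 => /eqP.
move: Hx; rewrite [X in _ - 2^-1 *: X]big1 => [|k _]; last first.
  by rewrite big1 ?scale0r// => i _; rewrite -/(N i) N0 mul0r.
rewrite scaler0 subr0 => Hx; apply/vlineP; exists (l^-1 * (4^-1 * th x)).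
by rewrite -scalerA Hx scalerA mulVf ?scale1r// gt_eqF.
Qed.
End TwoStep.
End MaximalSubspaces.

(** * Ricci-minimal points *)

(** Gives Cauchy-Schwarz together with its equality case: the left side vanishes only for
    proportional [a] and [b]. *)
Lemma lagrange_identity (R : realType) (T : finType) (a b : T -> R) :
  \sum_i \sum_k (a i * b k - a k * b i) ^+ 2 =
  2 * ((\sum_i a i ^+ 2) * (\sum_i b i ^+ 2) - (\sum_i a i * b i) ^+ 2).
Proof.
pose S (u v : T -> R) := \sum_i \sum_k u i * v k.
have SE u v : (\sum_i u i) * (\sum_i v i) = S u v.
  by rewrite mulr_suml; apply: eq_bigr => i _; rewrite mulr_sumr.
transitivity (S (fun i => a i ^+ 2) (fun i => b i ^+ 2) +
   S (fun i => b i ^+ 2) (fun i => a i ^+ 2) - 2 * S (fun i => a i * b i) (fun i => a i * b i)).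
  rewrite /S mulr_sumr -big_split/= -sumrB; apply: eq_bigr => i _.
  rewrite mulr_sumr -big_split/= -sumrB; apply: eq_bigr => k _; ring.
by rewrite -!SE; ring.
Qed.

Lemma cauchy_schwarz_sum (R : realType) (T : finType) (a b : T -> R) :
  (\sum_i a i * b i) ^+ 2 <= (\sum_i a i ^+ 2) * (\sum_i b i ^+ 2).
Proof.
rewrite -subr_ge0 -(pmulr_rge0 _ (ltr0Sn R 1)) -lagrange_identity.
by apply: sumr_ge0 => i _; apply: sumr_ge0 => k _; exact: sqr_ge0.
Qed.

Section Minimal.
Variables (R : realType) (g : lieAlgType R).
Hypothesis hg : lie_nilpotent g.
Implicit Types (u v w x y z : g).
Notation m := (ricci_minimal g).

(* Weight 0 for [x] and 1 for a complement: only the brackets with [x], taken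
   modulo [x], survive in the limit. *)
Lemma minimal_two_brackets x u v :
  (forall s t, s *: lie x u + t *: lie x v = 0 -> s = 0 /\ t = 0) -> in_cl m x.
Proof.
move=> fuv; have x0 : x \notin (0%VS : {vspace g}).
  rewrite memv0; apply/eqP => x0; have := fuv 1 0.
  by rewrite x0 !lie0l !scaler0 addr0 => /(_ erefl)[/eqP]; rewrite oner_eq0.
have [th [thl thx _]] := separating_form x0.
have xn0 : x != 0 by rewrite -memv0.
have [||||q [f [c [cl cf fE _ fr]]]] := @adapted_dual_basis R g 0 1 [tuple] (fun=> th) (fun=> x).
- by [].
- by rewrite nil_free.
- by move=> j k; rewrite !ord1 thx.
- by move=> j [].
pose T : finType := ('I_0 + ('I_1 + 'I_q))%type.
pose k0 : T := inr (inl ord0).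
have fk0 : f k0 = x by have [] := fr ord0.
pose d (i : T) : nat := (i != k0).
have cf0 i y : c i (lie y y) = 0 by rewrite lie_alt scalar_fun0.
have dP i j l : c l (lie (f i) (f j)) != 0 -> (d l <= d i + d j)%N.
  rewrite /d; have [->|] := eqVneq i k0; have [->|] := eqVneq j k0; last 3 first.
  - by move=> *; case: (l != k0).
  - by move=> *; case: (l != k0).
  - by move=> *; case: (l != k0).
  by rewrite cf0 eqxx.
apply: (degenerate_minimal cl cf fE dP (k0 := k0)) => y l y0 Hy.
have cD i a b : c i (a + b) = c i a + c i b by exact: scalar_funD.
have cZ i a b : c i (a *: b) = a * c i b by exact: scalar_funZ.
have cN i a : c i (- a) = - c i a by exact: scalar_funN.
(* [e] masks the coordinate along [x]; [n] is the matrix of [lie x] modulo [x], and [w] the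
   coordinates of [y] modulo [x]. *)
pose e (i : T) : R := (i != k0)%:R.
pose n i j := e j * c j (lie x (f i)).
pose w k := e k * c k y.
have LE k z : c k (limit_ricci f c d z) =
   4^-1 * (\sum_i \sum_j \sum_r (d i + d j <= d r)%N%:R *
      (c r (lie (f i) (f j)) * c r z) * c k (lie (f i) (f j)))
   - 2^-1 * \sum_i \sum_j (d k + d i <= d j)%N%:R * (c j (lie z (f i)) * c j (lie (f k) (f i))).
  rewrite /limit_ricci cD cN !cZ; congr (_ * _ - _ * _).
    have cS (I : finType) (F : I -> g) : c k (\sum_i F i) = \sum_i c k (F i).
      transitivity (c k (\sum_i 1 *: F i)).
        by congr (c k _); apply: eq_bigr => i _; rewrite scale1r.
      by rewrite scalar_bigsum//; apply: eq_bigr => i _; rewrite mul1r.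
    by rewrite cS; apply: eq_bigr => i _; rewrite cS; apply: eq_bigr => j _;
      rewrite cS; apply: eq_bigr => r _; rewrite cZ.
  have -> : \sum_k \sum_i \sum_j ((d k + d i <= d j)%N%:R *
      (c j (lie z (f i)) * c j (lie (f k) (f i)))) *: f k =
    \sum_k (\sum_i \sum_j ((d k + d i <= d j)%N%:R *
      (c j (lie z (f i)) * c j (lie (f k) (f i))))) *: f k.
    by apply: eq_bigr => r _; rewrite scaler_suml; apply: eq_bigr => i _; rewrite scaler_suml.
  rewrite scalar_bigsum// (bigD1 k)//= cf eqxx mulr1 [X in _ + X]big1 ?addr0// => r rk.
  by rewrite cf eq_sym (negbTE rk) mulr0.
(* Distinct [i], [j] have total weight at least 1, so a bracket survives only if that weight is 1
   and its coordinate is not the one along [x]. *)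
pose be i j := (d i + d j <= 1)%N%:R : R.
have first i j r z : (d i + d j <= d r)%N%:R * (c r (lie (f i) (f j)) * c r z) =
    be i j * (e r * (c r (lie (f i) (f j)) * c r z)).
  have [->|ij] := eqVneq i j; first by rewrite cf0 !(mul0r, mulr0).
  suff -> : (d i + d j <= d r)%N%:R = be i j * e r by ring.
  rewrite /be /e /d.
  case: (eqVneq i k0) ij => [->|_]; case: (eqVneq j k0) => [_|_];
    by rewrite ?eqxx//=; case: (r != k0); rewrite /= !(mul0r, mul1r, mulr0).
have lam : c k0 (limit_ricci f c d (f k0)) = - 2^-1 * \sum_i \sum_j n i j ^+ 2.
  rewrite LE big1 => [|i _]; last first.
    rewrite big1// => j _; rewrite big1// => r _; rewrite first cf /e.
    by case: (eqVneq r k0) => [->|_]; rewrite !(mul0r, mulr0).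
  rewrite mulr0 sub0r mulNr; congr (- (_ * _)).
  apply: eq_bigr => i _; apply: eq_bigr => j _; rewrite /n fk0.
  have [->|ik] := eqVneq i k0; first by rewrite fk0 cf0 !mulr0 expr0n.
  rewrite /d /e ik eqxx; case: (j != k0) => /=; ring.
have nk0 j : n k0 j = 0 by rewrite /n fk0 cf0 mulr0.
have wn j : e j * c j (lie y x) = - \sum_i w i * n i j.
  rewrite lieC cN mulrN; congr (- _).
  rewrite [in LHS](fE y) lie_sumr; under eq_bigr => i _ do rewrite lieZr.
  rewrite scalar_bigsum// mulr_sumr; apply: eq_bigr => i _.
  rewrite /w {2}/e; have [->|_] := eqVneq i k0; first by rewrite fk0 cf0 nk0 !mulr0.
  by rewrite mul1r /n; ring.
have Hw k : w k * c k (limit_ricci f c d y) = l * w k ^+ 2.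
  by rewrite Hy cZ /w /e; case: (k != k0); rewrite ?mul1r ?mul0r ?expr2; ring.
rewrite lam => hl.
have second k : w k * (\sum_i \sum_j (d k + d i <= d j)%N%:R *
    (c j (lie y (f i)) * c j (lie (f k) (f i)))) =
  \sum_j (\sum_i w i * n i j) * (w k * n k j).
  have wk0 : w k0 = 0 by rewrite /w /e eqxx mul0r.
  have [->|kk] := eqVneq k k0.
    by rewrite wk0 mul0r big1// => j _; rewrite nk0 !mulr0.
  rewrite (bigD1 k0)//= [X in _ + X]big1 ?addr0 => [|i ik]; last first.
    by rewrite big1// => j _; rewrite /d ik kk; case: (j != k0); rewrite mul0r.
  rewrite mulr_sumr; apply: eq_bigr => j _; rewrite fk0 /d kk eqxx addn0.
  have -> : \sum_i w i * n i j = - (e j * c j (lie y x)) by rewrite wn opprK.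
  rewrite /n (lieC (f k)) cN /e; case: (j != k0) => /=; ring.
(* The positive term of the limit operator contributes a sum of squares, which is dropped. *)
have lw : l * (\sum_k w k ^+ 2) >= - 2^-1 * \sum_j (\sum_i w i * n i j) ^+ 2.
  rewrite [leRHS]mulr_sumr; under [leRHS]eq_bigr => k _ do rewrite -Hw LE mulrBr.
  rewrite sumrB.
  have -> : \sum_k w k * (2^-1 * \sum_i \sum_j (d k + d i <= d j)%N%:R *
    (c j (lie y (f i)) * c j (lie (f k) (f i)))) = 2^-1 * \sum_j (\sum_i w i * n i j) ^+ 2.
    under eq_bigr => k _ do rewrite mulrCA second.
    rewrite -mulr_sumr exchange_big/=; congr (_ * _); apply: eq_bigr => j _.
    by rewrite -mulr_sumr expr2.
  rewrite mulNr lerBrDr addNr.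
  under eq_bigr => k _ do rewrite mulrCA mulr_sumr.
  rewrite -mulr_sumr mulr_ge0 ?invr_ge0// exchange_big/= sumr_ge0// => i _.
  under eq_bigr => k _ do rewrite mulr_sumr.
  rewrite exchange_big/= sumr_ge0// => j _.
  have -> : \sum_k w k * (\sum_r (d i + d j <= d r)%N%:R * (c r (lie (f i) (f j)) * c r y) *
      c k (lie (f i) (f j))) = be i j * (\sum_k w k * c k (lie (f i) (f j))) ^+ 2.
    under eq_bigr => k _ do rewrite -mulr_suml.
    have -> : \sum_r (d i + d j <= d r)%N%:R * (c r (lie (f i) (f j)) * c r y) =
        be i j * \sum_r w r * c r (lie (f i) (f j)).
      by rewrite mulr_sumr; apply: eq_bigr => r _; rewrite first /w; ring.
    rewrite expr2 mulrA [in RHS]mulr_sumr; apply: eq_bigr => k _; ring.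
  by rewrite mulr_ge0 ?sqr_ge0// ler0n.
pose W := \sum_k w k ^+ 2.
have W0 : 0 <= W by apply: sumr_ge0 => k _; exact: sqr_ge0.
(* [hl] and [lw] combine to the reverse Cauchy-Schwarz inequality, summed over the columns of [n];
   equality makes each column proportional to [w]. *)
have prop j k i : w k * n i j = w i * n k j.
  have L0 (r : T) : 0 <= \sum_i \sum_k (w i * n k r - w k * n i r) ^+ 2.
    by apply: sumr_ge0 => ? _; apply: sumr_ge0 => ? _; exact: sqr_ge0.
  have S0 : \sum_r \sum_i \sum_k (w i * n k r - w k * n i r) ^+ 2 = 0.
    apply: le_anti; rewrite sumr_ge0 ?andbT; last by move=> r _; exact: L0.
    under eq_bigr => r _ do rewrite (lagrange_identity w (n^~ r)).
    rewrite -mulr_sumr sumrB -mulr_sumr -/W pmulr_rle0// subr_le0.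
    have := ler_wpM2r W0 hl; rewrite exchange_big/= => h; move: lw; rewrite -/W; lra.
  have /psumr_eq0P/(_ j isT) : \sum_r \sum_i \sum_k (w i * n k r - w k * n i r) ^+ 2 = 0 by [].
  move=> /(_ (fun r _ => L0 r)) Sj.
  have L1 (i' : T) : 0 <= \sum_k (w i' * n k j - w k * n i' j) ^+ 2.
    by apply: sumr_ge0 => ? _; exact: sqr_ge0.
  have /psumr_eq0P/(_ k isT) := Sj => /(_ (fun r _ => L1 r)) Sk.
  have /psumr_eq0P/(_ i isT) := Sk => /(_ (fun r _ => sqr_ge0 _))/eqP.
  by rewrite sqrf_eq0 subr_eq0 => /eqP.
have [w0|] := boolP [forall k, w k == 0].
  apply/vlineP; exists (c k0 y); rewrite {1}(fE y) (bigD1 k0)//= fk0 big1 ?addr0// => k kk.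
  by have /eqP := forallP w0 k; rewrite /w /e kk mul1r => ->; rewrite scale0r.
rewrite negb_forall => /existsP[a wa]; exfalso.
(* If [w != 0], all brackets with [x] lie on one line modulo [x], and nilpotency contradicts the
   independence of those with [u] and [v]. *)
have key z : exists al eta : R, lie x z = al *: lie x (f a) + eta *: x.
  pose al := \sum_k c k z * (w k / w a).
  exists al, (c k0 (lie x z - al *: lie x (f a))).
  apply/eqP; rewrite addrC -subr_eq; apply/eqP; apply: (dual_inj fE) => j; rewrite [RHS]cZ.
  have -> : c j x = (j == k0)%:R by rewrite -fk0 cf.
  have [->|jj] := eqVneq j k0; first by rewrite mulr1.
  rewrite mulr0; have nE i : c j (lie x (f i)) = n i j by rewrite /n /e jj mul1r.
  rewrite cD cN cZ nE {1}(fE z) lie_sumr; under eq_bigr => i _ do rewrite lieZr.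
  rewrite scalar_bigsum// /al mulr_suml; apply/eqP; rewrite subr_eq0; apply/eqP.
  apply: eq_bigr => i _; rewrite nE -mulrA; congr (_ * _).
  by apply: (mulfI wa); rewrite prop; field.
have [a1 [e1 E1]] := key u; have [a2 [e2 E2]] := key v.
have E : a2 *: lie x u + (- a1) *: lie x v = (a2 * e1 - a1 * e2) *: x.
  by rewrite E1 E2; module_ring; ring.
have : lie (a1 *: v - a2 *: u) x = (a2 * e1 - a1 * e2) *: x.
  by rewrite -E lieBl !lieZl !(lieC _ x) !scalerN scaleNr opprK addrC.
move=> /(nilpotent_eigen hg)[h|/eqP]; last by rewrite (negbTE xn0).
have [|_ /eqP] := fuv a2 (- a1); first by rewrite E h scale0r.
rewrite oppr_eq0 => /eqP a10; rewrite a10 scale0r add0r in E1.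
have : lie u x = (- e1) *: x by rewrite lieC E1 scaleNr.
move=> /(nilpotent_eigen hg)[/eqP|/eqP]; last by rewrite (negbTE xn0).
rewrite oppr_eq0 => /eqP e10.
have := fuv 1 0; rewrite E1 e10 !scale0r scaler0 addr0 => /(_ erefl)[/eqP].
by rewrite oner_eq0.
Qed.

(** Independence holds after an arbitrarily small move of [x] along [x0]: the determinant against
    forms dual to [lie x0 u] and [lie x0 v] is quadratic in [s] with leading coefficient 1. *)
Lemma minimal_rank_two x0 u v :
  (forall s t, s *: lie x0 u + t *: lie x0 v = 0 -> s = 0 /\ t = 0) ->
  forall x, in_cl m x.
Proof.
move=> fuv x; apply: contrapT => /(@not_in_cl_near _ _ _ x x0 0)[d d0 hd].
have nu : lie x0 u \notin <[lie x0 v]>%VS.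
  apply/vlineP => -[k uk]; have [|/eqP] := fuv 1 (- k).
    by rewrite uk scale1r scaleNr subrr.
  by rewrite oner_eq0.
have nv : lie x0 v \notin <[lie x0 u]>%VS.
  apply/vlineP => -[k vk]; have [|_ /eqP] := fuv (- k) 1.
    by rewrite vk scale1r scaleNr addNr.
  by rewrite oner_eq0.
have [al [all_ alu alv]] := separating_form nu.
have [be [bel bev beu]] := separating_form nv.
have alv0 := alv _ (memv_line _); have beu0 := beu _ (memv_line _).
have key s : s != 0 -> `|s| < d ->
    (al (lie x u) * be (lie x v) - al (lie x v) * be (lie x u) : R^o) +
    s *: (al (lie x u) + be (lie x v) : R^o) + s ^+ 2 *: (1 : R^o) = 0.
  move=> s0 sd; apply: contrapT => D; apply: (hd s sd); rewrite scaler0 addr0.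
  apply: (@minimal_two_brackets _ u v) => a b.
  rewrite !lieDl !lieZl => h.
  have := congr1 al h; have := congr1 be h.
  rewrite !(scalar_funD _ _ all_, scalar_funZ _ _ all_, scalar_fun0 all_).
  rewrite !(scalar_funD _ _ bel, scalar_funZ _ _ bel, scalar_fun0 bel).
  rewrite alu alv0 bev beu0 => h2 h1.
  pose E : R := (al (lie x u) + s) * (be (lie x v) + s) - al (lie x v) * be (lie x u).
  have E0 : E != 0.
    by apply/eqP => E0; apply: D; rewrite -E0 /E /GRing.scale/=; ring.
  split; apply: (mulfI E0); rewrite mulr0 /E.
    transitivity ((be (lie x v) + s) * (a * (al (lie x u) + s) + b * al (lie x v))
      - al (lie x v) * (a * be (lie x u) + b * (be (lie x v) + s))); first by ring.
    have -> : a * (al (lie x u) + s) + b * al (lie x v) = 0 by rewrite -h1; ring.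
    have -> : a * be (lie x u) + b * (be (lie x v) + s) = 0 by rewrite -h2; ring.
    by rewrite !mulr0 subr0.
  transitivity ((al (lie x u) + s) * (a * be (lie x u) + b * (be (lie x v) + s))
    - be (lie x u) * (a * (al (lie x u) + s) + b * al (lie x v))); first by ring.
  have -> : a * (al (lie x u) + s) + b * al (lie x v) = 0 by rewrite -h1; ring.
  have -> : a * be (lie x u) + b * (be (lie x v) + s) = 0 by rewrite -h2; ring.
  by rewrite !mulr0 subr0.
have [_ _ /eqP] := quadratic_path_eq0 d0 key.
by rewrite oner_eq0.
Qed.

(** The bracket is a 2-form [om] times [z]. Take [x], [y] orthonormal and orthogonal to their
    [om]-complement, whose chosen basis vectors get length [sg^-1], so that brackets of unit vectors
    there are small. Then [x] realises the smallest eigenvalue [- dot z z / 2]. *)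
Lemma minimal_rank_one x y (x0 : x != 0) : lie x y != 0 ->
  (forall u v, exists k : R, lie u v = k *: lie x y) -> m (proj_pi x0).
Proof.
move=> xy hz; set z := lie x y in xy hz.
have [phi [phil phiz _]] : exists phi : g -> R, [/\ scalar phi, phi z = 1 &
    forall u, u \in 0%VS -> phi u = 0] by apply: separating_form; rewrite memv0.
have phiD u v : phi (u + v) = phi u + phi v by exact: scalar_funD.
have phiZ k u : phi (k *: u) = k * phi u by exact: scalar_funZ.
have phiN u : phi (- u) = - phi u by exact: scalar_funN.
pose om u v := phi (lie u v).
have omE u v : lie u v = om u v *: z.
  by have [k uv] := hz u v; rewrite /om uv phiZ phiz mulr1.
have omC u v : om u v = - om v u by rewrite /om lieC phiN.
have omxx u : om u u = 0 by rewrite /om lie_alt scalar_fun0.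
have oml v : scalar (om^~ v) by move=> k u w; rewrite /om lieDl lieZl phiD phiZ.
have omr v : scalar (om v) by move=> k u w; rewrite /om lieDr lieZr phiD phiZ.
have omxy : om x y = 1 by [].
have omz u : om z u = 0.
  by have := omE z u; rewrite lieC => h; apply/eqP; move: h => /esym h;
   have /(nilpotent_eigen hg)[/eqP|/eqP] : lie u z = (- om z u) *: z;
   rewrite ?(negbTE xy) ?oppr_eq0// scaleNr h opprK.
pose th (j : 'I_2) u := if j == ord0 then - om y u else om x u.
pose w (j : 'I_2) := if j == ord0 then x else y.
have [||||q [f [c [cl cf fE _ fr]]]] := @adapted_dual_basis R g 0 2 [tuple] th w.
- move=> j k u v; rewrite /th; case: ifP => _; last exact: omr.
  by rewrite (omr y); ring.
- by rewrite nil_free.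
- move=> j k; rewrite /th /w; case: (unliftP ord0 j) => [j' ->|->];
    case: (unliftP ord0 k) => [k' ->|->]; rewrite ?eq_refl/= ?ord1 ?omxx ?oppr0//=.
  by rewrite omC omxy opprK.
- by move=> j [].
pose i0 : 'I_0 + ('I_2 + 'I_q) := inr (inl ord0).
pose i1 : 'I_0 + ('I_2 + 'I_q) := inr (inl (lift ord0 ord0)).
have [f0 c0] : f i0 = x /\ c i0 = fun u => - om y u by have [] := fr ord0.
have [f1 c1] : f i1 = y /\ c i1 = om x by have [] := fr (lift ord0 ord0).
have omf0 v : om v (f i0) = - c i1 v by rewrite f0 c1 omC.
have omf1 v : om v (f i1) = c i0 v by rewrite f1 c0 -omC.
pose fr' r := f (inr (inr r)); pose cr r := c (inr (inr r)).
have sumT (F : 'I_0 + ('I_2 + 'I_q) -> R) :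
    \sum_i F i = F i0 + F i1 + \sum_r F (inr (inr r)).
  by rewrite !big_sumType/= big_ord0 add0r !big_ord_recl big_ord0 addr0.
pose Om := \sum_r \sum_k om (fr' k) (fr' r) ^+ 2.
have Om0 : 0 <= Om by apply: sumr_ge0 => r _; apply: sumr_ge0 => k _; exact: sqr_ge0.
(* Since [sg * Om <= 1] and [sg <= 1], Cauchy-Schwarz bounds the [om] terms of the complement by its
   share of the norm. *)
pose sg := (1 + Om)^-1.
have sg0 : 0 < sg by rewrite invr_gt0 ltr_pwDl.
pose s (i : 'I_0 + ('I_2 + 'I_q)) := if i is inr (inr _) then sg else 1.
have s0 i : 0 < s i by case: i => [[]|[i|i]] //=.
have [dot dotE] := weighted_dot_exists cl fE s0.
have oe := weighted_onb cl cf fE s0 dotE.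
have omS u v : \sum_(i <- [seq s i *: f i | i <- index_enum ('I_0 + ('I_2 + 'I_q))%type])
    om u i * om v i =
    c i1 u * c i1 v + c i0 u * c i0 v + sg ^+ 2 * \sum_r om u (fr' r) * om v (fr' r).
  rewrite big_map sumT /= !scale1r !omf0 !omf1 mulrNN mulr_sumr; congr (_ + _).
  by apply: eq_bigr => r _; rewrite /om !lieZr !phiZ -!/(om _ _); ring.
have ricE u v : ricci_form dot u v = 4^-1 * (dot z u * dot z v *
     \sum_(i <- [seq s i *: f i | i <- index_enum ('I_0 + ('I_2 + 'I_q))%type])
     \sum_(j <- [seq s i *: f i | i <- index_enum ('I_0 + ('I_2 + 'I_q))%type]) om i j ^+ 2)
   - 2^-1 * dot z z * (c i1 u * c i1 v + c i0 u * c i0 v +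
       sg ^+ 2 * \sum_r om u (fr' r) * om v (fr' r)).
  rewrite (ricci_formE _ _ oe) /ricci_in -omS; congr (_ * _ - _).
    rewrite mulr_sumr; apply: eq_bigr => i _; rewrite mulr_sumr; apply: eq_bigr => j _.
    by rewrite omE !dotZl; ring.
  rewrite -mulrA; congr (_ * _); rewrite mulr_sumr; apply: eq_bigr => i _.
  by rewrite !(omE _ i) dotZl dotC dotZl; ring.
have c0x : c i0 x = 1 by rewrite -f0 cf eqxx.
have c1x : c i1 x = 0 by rewrite -f0 cf.
have omxr r : om x (fr' r) = 0 by rewrite -c1 /fr' cf.
have omyr r : om y (fr' r) = 0.
  by apply/eqP; rewrite -oppr_eq0; apply/eqP; have := cf i0 (inr (inr r)); rewrite c0.
have dx v : dot x v = c i0 v by rewrite -f0 (dot_weighted_l cf dotE) /= expr1n invr1 mul1r.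
apply: (@ricci_minimal_intro _ _ dot _ _ (- 2^-1 * dot z z)).
  apply: ricci_op_eigen => v; rewrite ricE dx (dotC dot z x) dx.
  have -> : c i0 z = 0 by rewrite c0 omC omz !oppr0.
  have -> : \sum_r om x (fr' r) * om v (fr' r) = 0.
    by rewrite big1// => r _; rewrite omxr mul0r.
  by rewrite c0x c1x; ring.
move=> v; have zz : 0 <= dot z z by exact/ltW/neq0_dnorm_gt0.
rewrite ricE; set S := \sum_(i <- _) _.
have S0 : 0 <= S.
  by rewrite /S sumr_ge0// => i _; apply: sumr_ge0 => j _; exact: sqr_ge0.
rewrite !mulNr; apply: le_trans (_ : - (2^-1 * dot z z * dot v v) <= - (2^-1 * dot z z *
  (c i1 v * c i1 v + c i0 v * c i0 v + sg ^+ 2 * \sum_r om v (fr' r) * om v (fr' r)))) _.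
  rewrite lerN2 ler_wpM2l ?mulr_ge0 ?invr_ge0//.
  rewrite dotE sumT /= expr1n invr1 !mul1r (addrC (c i0 v * _)) lerD2l.
  set C := \sum_r cr r v ^+ 2.
  have -> : \sum_(i < q) sg ^- 2 * (c (inr (inr i)) v * c (inr (inr i)) v) = sg ^- 2 * C.
    by rewrite mulr_sumr; apply: eq_bigr => r _; rewrite -expr2.
  have C0 : 0 <= C by apply: sumr_ge0 => r _; exact: sqr_ge0.
  have omC' : \sum_r om v (fr' r) * om v (fr' r) <= C * Om.
    rewrite mulr_sumr; apply: ler_sum => r _; rewrite -expr2.
    have -> : om v (fr' r) = \sum_k cr k v * om (fr' k) (fr' r).
      rewrite [in LHS](fE v) (scalar_bigsum _ _ _ (oml _)) sumT.
      by rewrite f0 f1 omxr omyr !mulr0 !add0r.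
    exact: cauchy_schwarz_sum.
  have sgOm : sg * (1 + Om) = 1 by rewrite mulVf// gt_eqF// ltr_pwDl.
  have sgC : sg ^+ 2 * (C * Om) <= sg ^- 2 * C.
    have sg1 : sg <= 1 by rewrite invf_le1 ?lerDl// ltr_pwDl.
    have sg3 : sg ^+ 3 <= 1 by rewrite exprn_ile1// ltW.
    rewrite [leRHS]mulrC ler_pdivlMr ?exprn_gt0//.
    have -> : sg ^+ 2 * (C * Om) * sg ^+ 2 = C * (sg ^+ 3 * (sg * Om)) by ring.
    rewrite ler_piMr// mulr_ile1 ?mulr_ge0 ?exprn_ge0 ?(ltW sg0)//.
    by move: sgOm; rewrite mulrDr mulr1 => <-; rewrite lerDr ltW.
  by apply: le_trans sgC; rewrite ler_pM2l ?exprn_gt0.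
rewrite lerBrDr addNr mulr_ge0 ?invr_ge0// mulr_ge0// -expr2; exact: sqr_ge0.
Qed.

Lemma minimal_generic x : in_cl m x.
Proof.
have [[x1 [u [v fuv]]]|h] := pselect (exists x1 u v : g, forall s t : R,
    s *: lie x1 u + t *: lie x1 v = 0 -> s = 0 /\ t = 0).
  exact: minimal_rank_two fuv x.
have dep x1 u v : lie x1 u != 0 -> exists k : R, lie x1 v = k *: lie x1 u.
  move=> xu; apply: contrapT => /forallNP nk; apply: h; exists x1, u, v => s t st.
  have t0 : t = 0.
    apply/eqP; apply: contraT => t0; exfalso; apply: (nk (- (t^-1 * s))).
    apply: (scalerI t0); rewrite scalerA mulrN mulrA divff// mul1r scaleNr.
    by apply/eqP; rewrite -addr_eq0 addrC st.
  move: st; rewrite t0 scale0r addr0 => /eqP; rewrite scaler_eq0 (negbTE xu) orbF.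
  by move=> /eqP.
(* Modulo [y] and [z], vectors can be taken to commute with both. For such [u'], [v'] the bracket
   [lie u' v' = lie (y + u') v'] is a multiple of [lie (y + u') z = lie y z]. *)
have line y z : lie y z != 0 -> forall u v, exists k : R, lie u v = k *: lie y z.
  move=> yz u v.
  have red w : exists a b w', [/\ w = a *: y + b *: z + w', lie y w' = 0 & lie z w' = 0].
    have zy : lie z y != 0 by rewrite lieC oppr_eq0.
    have [b hb] := dep y z w yz; have [a ha] := dep z y w zy.
    exists a, b, (w - a *: y - b *: z); split.
    - by module_ring; ring.
    - by rewrite !lieBr !lieZr lie_alt scaler0 subr0 hb subrr.
    - by rewrite !lieBr !lieZr lie_alt scaler0 subr0 ha subrr.
  have [a [b [u' [-> yu zu]]]] := red u; have [c [d [v' [-> yv zv]]]] := red v.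
  have hz : lie (y + u') z = lie y z by rewrite lieDl (lieC u') zu oppr0 addr0.
  have [k hk] := dep (y + u') z v' (etrans (congr1 (fun w => w != 0) hz) yz).
  rewrite hz lieDl yv add0r in hk; exists (a * d - b * c + k).
  rewrite !(lieDl, lieDr, lieZl, lieZr) !lie_alt hk yv zv (lieC u' y) (lieC u' z) yu zu.
  by rewrite (lieC z y) !(oppr0, scaler0, addr0, add0r); module_ring; ring.
have noncentral y z : lie y z != 0 -> in_cl m y.
  by move=> yz y0; apply: subset_closure; exact: minimal_rank_one yz (line y z yz).
have [[y xy]|hx] := pselect (exists y, lie x y != 0); first exact: noncentral xy.
have cx y : lie x y = 0.
  by apply/eqP; apply: contraT => xy; case: hx; exists y.
have [[y [z yz]]|ab] := pselect (exists y z : g, lie y z != 0).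
  apply: (@in_cl_path _ _ _ x y 0 1) => // s /andP[s0 _]; rewrite scaler0 addr0.
  apply: (noncentral _ z); rewrite lieDl cx add0r lieZl scaler_eq0 (negbTE yz) orbF.
  by rewrite gt_eqF.
have ab0 y z : lie y z = 0.
  by apply/eqP; apply: contraT => yz; case: ab; exists y, z.
(* In the abelian case the Ricci form vanishes, so every point is minimal for any inner product. *)
move=> x0; apply: subset_closure; have [dot _] := dot_exists g.
have ric0 y z : ricci_form dot y z = 0.
  rewrite /ricci_form /ricci_in big1 => [|i _]; last first.
    by rewrite big1// => j _; rewrite ab0 (scalar_fun0 (dot_linearl dot _)) mul0r.
  by rewrite big1 ?mulr0 ?subr0// => i _; rewrite ab0 (scalar_fun0 (dot_linearl dot _)).
apply: (@ricci_minimal_intro _ _ dot _ _ 0) => [|y]; last by rewrite ric0 mul0r.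
by apply: ricci_op_eigen => y; rewrite ric0 mul0r.
Qed.
End Minimal.

Theorem theorem2 (R : realType) (g : lieAlgType R) (hg : lie_nilpotent g) :
  [/\ two_step_nilpotent g -> derived_lie g <> 0%VS ->
        closure (ricci_maximal g) = proj_sub (derived_lie g),
      forall a : {vspace g}, codim1_abelian_ideal a -> ~ two_step_nilpotent g ->
        closure (ricci_maximal g) = proj_sub a,
      ~ two_step_nilpotent g ->
        ~ (exists a : {vspace g}, codim1_abelian_ideal a) ->
        closure (ricci_maximal g) = setT
    & closure (ricci_minimal g) = setT].
Proof.
split=> [h2 d0|a ha n2|n2 n1|].
- apply: closure_proj_sub => [x x0|x]; first exact: maximal_in_derived.
  exact: derived_in_maximal.
- apply: closure_proj_sub => [x x0|x]; first exact: maximal_in_codim1.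
  exact: codim1_in_maximal.
- apply/seteqP; split=> // u _; have [x [x0 ->]] := proj_piP u.
  exact: maximal_generic.
- apply/seteqP; split=> // u _; have [x [x0 ->]] := proj_piP u.
  exact: minimal_generic.
Qed.
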